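(* Consider the following downlink model in $\mathbb{R}^2$. Let $\alpha>2$, $\mu>0$, $P_m,P_f>0$, $W\in(0,1]$, $\sigma^2\ge0$, $\lambda_m>0$, $P_{\mathrm{busy},m}\in(0,1]$, $\lambda_m'=\lambda_mP_{\mathrm{busy},m}$, $\lambda_p>0$, $\lambda_c'\ge0$, $R_c>0$. Let $\Phi_m$ be a homogeneous Poisson point process (PPP) of intensity $\lambda_m$ and $\Phi_m'$ its independent thinning with retention probability $P_{\mathrm{busy},m}$. Let $\Phi_f'$ be a Neyman–Scott cluster process independent of $\Phi_m$ and the thinning: $\Phi_f'=\bigcup_{x\in\Phi_p}\Phi^x$, where $\Phi_p$ is a homogeneous PPP of intensity $\lambda_p$ and, given $\Phi_p$, the $\Phi^x$ are independent PPPs of intensity $\lambda_c'$ on the disk of radius $R_c$ centered at $x$. A typical user is at the origin $o$ and is served by the point $b_0\in\Phi_m$ nearest to $o$; $r=|b_0|$. Let $h$ and $\{g_y\}$ (one per point $y$ of $\Phi_m'\cup\Phi_f'$) be i.i.d. with $\mathbb{P}\{h>x\}=\mathbb{P}\{g_y>x\}=e^{-\mu x}$, independent of the point processes. Define $$\mathrm{SINR}=\frac{P_m h r^{-\alpha}}{\sum_{y\in\Phi_m'\setminus\{b_0\}}P_m g_y|y|^{-\alpha}+\sum_{y\in\Phi_f'}W P_f g_y|y|^{-\alpha}+\sigma^2}.$$ Then for every $T>0$, $$\mathbb{P}\{\mathrm{SINR}\le T\}=1-\pi\lambda_m\int_0^\infty\exp\bigg(-\pi v\lambda_m-\lambda_p\int_{\mathbb{R}^2}\Big(1-\eta\Big(\frac{Tv^{\alpha/2}WP_f}{P_m},x\Big)\Big)\mathrm{d}x-\frac{\mu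 T v^{\alpha/2}\sigma^2}{P_m}-\pi v\lambda_m'\varphi(T,\alpha)\bigg)\mathrm{d}v,$$ and $$\mathbb{E}\{\ln(1+\mathrm{SINR})\}=\pi\lambda_m\int_0^\infty\int_0^\infty\exp\bigg(-\pi v\lambda_m-\lambda_p\int_{\mathbb{R}^2}\Big(1-\eta\Big(\frac{(e^t-1)v^{\alpha/2}WP_f}{P_m},x\Big)\Big)\mathrm{d}x-\frac{\mu(e^t-1)v^{\alpha/2}\sigma^2}{P_m}-\pi v\lambda_m'\varphi(e^t-1,\alpha)\bigg)\mathrm{d}v\,\mathrm{d}t,$$ where $\varphi(T,\alpha)=T^{2/\alpha}\int_{T^{-2/\alpha}}^\infty\frac{1}{1+u^{\alpha/2}}\mathrm{d}u$ and, for $s>0$ and $x\in\mathbb{R}^2$, $$\eta(s,x)=\exp\Big(-\lambda_c'\int_{C(o,R_c)}\frac{1}{1+\frac{1}{s}|x+y|^\alpha}\,\mathrm{d}y\Big),$$ with $C(o,R_c)$ the disk of radius $R_c$ centered at the origin.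
   Context: $\ln$ is the natural logarithm. The model describes a macrocell user in a two-tier network with clustered femtocell access points and Rayleigh fading on all links: $\Phi_m'$ are the macro base stations active on the user's subchannel, $\Phi_f'$ the (clustered) femtocell access points active on that subchannel, $W$ a wall penetration loss, $P_m,P_f$ transmit powers, $\sigma^2$ noise power. *)

(* Defs.v *)
From HB Require Import structures.
From mathcomp Require Import all_boot all_order all_algebra.
From mathcomp Require Import finmap.
From mathcomp Require Import all_classical all_reals all_analysis measurable_realfun.
Set Implicit Arguments. Unset Strict Implicit. Unset Printing Implicit Defensive.
Import Order.TTheory GRing.Theory Num.Theory.
Local Open Scope classical_set_scope.
Local Open Scope ring_scope.

Section Geometry.
Variable R : realType.

Definition pt := (R * R)%type.
Definition addp (x y : pt) : pt := (x.1 + y.1, x.2 + y.2).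
Definition eucl (x : pt) : R := Num.sqrt (x.1 ^+ 2 + x.2 ^+ 2).
Definition leb2 := ((@lebesgue_measure R) \x (@lebesgue_measure R))%E.
Definition disk (c : R) : set pt := [set y | eucl y <= c].
(** Poisson probability of k with mean rate (rate >= 0), convention 0^0 = 1 *)
Definition poissonp (rate : R) (k : nat) : R :=
  rate ^+ k / (k`!)%:R * expR (- rate).
End Geometry.

Section Probability.
Context {R : realType} {d : measure_display} {Ω : measurableType d}.
Variable P : probability Ω R.

Definition events_of {d'} {T : measurableType d'} (Y : Ω -> T) : set (set Ω) :=
  [set E | exists2 B, measurable B & E = Y @^-1` B].

Definition gen_events {I : choiceType} {d'} {T : measurableType d'}
    (X : I -> Ω -> T) : set (set Ω) :=
  [set E | exists (J : {fset I}) (B : I -> set T),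
      (forall i, measurable (B i)) /\ E = \bigcap_(i in [set` J]) (X i @^-1` B i)].

Definition mutually_independent {K : choiceType} (F : K -> set (set Ω)) :=
  forall (J : {fset K}) (E : K -> set Ω), (forall k, k \in J -> F k (E k)) ->
  (P (\bigcap_(k in [set` J]) E k) = \prod_(k <- J) P (E k))%E.

Definition indep_rvs {I : choiceType} {d'} {T : measurableType d'}
    (X : I -> Ω -> T) := mutually_independent (fun i => events_of (X i)).

(** A point process is given by an enumeration: the points are the X n w
    for the indices n with A n w (A = "n-th point exists").
    count A X B w = number of points in B. *)
Definition count (A : nat -> Ω -> bool) (X : nat -> Ω -> pt R) (B : set (pt R))
    (w : Ω) : \bar R :=
  counting [set n | A n w /\ B (X n w)].

Definition is_PPP (A : nat -> Ω -> bool) (X : nat -> Ω -> pt R)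
    (Lam : set (pt R) -> \bar R) :=
  [/\ (forall n, measurable_fun setT (A n)),
      (forall n, measurable_fun setT (X n)),
      (forall B, measurable B -> (Lam B < +oo)%E -> forall k : nat,
          P [set w | count A X B w = k%:R%:E] = (poissonp (fine (Lam B)) k)%:E) &
      (forall Bs : nat -> set (pt R),
          (forall i, measurable (Bs i) /\ (Lam (Bs i) < +oo)%E) ->
          trivIset setT Bs -> indep_rvs (T := \bar R) (fun i : nat => count A X (Bs i)))].

Definition is_hPPP (X : nat -> Ω -> pt R) (lam : R) :=
  is_PPP (fun _ _ => true) X (fun B => (lam%:E * @leb2 R B)%E).

Definition exp_rv (mu : R) (g : Ω -> R) :=
  measurable_fun setT g /\
  forall x, 0 <= x -> P [set w | x < g w] = (expR (- (mu * x)))%:E.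
End Probability.

Section Model.
Context {R : realType} {Ω : Type}.
Local Open Scope ereal_scope.

(** interference from the active macro BSs other than the serving one b0 = X 0 *)
Definition interf_m (Pm alpha : R) (X : nat -> Ω -> pt R)
    (busy : nat -> Ω -> bool) (g : nat -> Ω -> R) (w : Ω) : \bar R :=
  \sum_(1 <= n <oo)
     (if busy n w then (Pm * g n w * powR (eucl (X n w)) (- alpha))%:E else 0).

(** interference from the femtocells: cluster k has points Y k + U k j *)
Definition interf_f (W Pf alpha : R) (Y : nat -> Ω -> pt R)
    (M : nat -> nat -> Ω -> bool) (U : nat -> nat -> Ω -> pt R)
    (g : nat * nat -> Ω -> R) (w : Ω) : \bar R :=
  \sum_(0 <= k <oo) \sum_(0 <= j <oo)
     (if M k j w then
        (W * Pf * g (k, j) w * powR (eucl (addp (Y k w) (U k j w))) (- alpha))%:E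
      else 0).

(** num / den in the extended nonnegative reals (den = +oo gives 0, den = 0 gives +oo) *)
Definition ediv (num : R) (den : \bar R) : \bar R :=
  match den with
  | r%:E => if r == 0%R then +oo else (num / r)%:E
  | +oo => 0
  | -oo => 0
  end.

Definition SINR (Pm Pf W alpha sigma2 : R) (X : nat -> Ω -> pt R)
    (busy : nat -> Ω -> bool) (Y : nat -> Ω -> pt R)
    (M : nat -> nat -> Ω -> bool) (U : nat -> nat -> Ω -> pt R)
    (h : Ω -> R) (gm : nat -> Ω -> R) (gf : nat * nat -> Ω -> R) (w : Ω) : \bar R :=
  ediv (Pm * h w * powR (eucl (X 0%N w)) (- alpha))
       (interf_m Pm alpha X busy gm w + interf_f W Pf alpha Y M U gf w + sigma2%:E).

Definition ln1pE (x : \bar R) : \bar R :=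
  match x with r%:E => (ln (1 + r))%:E | +oo => +oo | -oo => 0 end.
End Model.

Section Formula.
Context {R : realType}.
Local Open Scope ereal_scope.

Definition phi (T alpha : R) : \bar R :=
  (powR T (2 / alpha))%:E *
  \int[@lebesgue_measure R]_(u in `[powR T (- (2 / alpha)), +oo[%classic)
     ((1 + powR u (alpha / 2))^-1)%:E.

Definition eta (lc Rc alpha s : R) (x : pt R) : \bar R :=
  expeR (- (lc%:E * \int[@leb2 R]_(y in disk Rc)
                      ((1 + s^-1 * powR (eucl (addp x y)) alpha)^-1)%:E)).

Definition expo (lm lm' lp lc Rc Pm Pf W mu sigma2 alpha T v : R) : \bar R :=
  - (pi * v * lm)%:E
  - lp%:E * \int[@leb2 R]_x (1 - eta lc Rc alpha (T * powR v (alpha / 2) * W * Pf / Pm) x)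
  - (mu * T * powR v (alpha / 2) * sigma2 / Pm)%:E
  - (pi * v * lm')%:E * phi T alpha.
End Formula.

(* Main.v *)
(* Since the fading h is exponential, P(SINR > T) is the expectation of
   exp(- mu s (I + sigma2)) with s = T r^alpha / Pm and I the interference, that
   is, a Laplace functional. All such expectations are computed in the extended
   reals, so that no almost sure finiteness of I is ever needed, and independence
   is used in the form "integrate over an independent copy" ([decoupling]).

   Given the macro base stations, the fading and thinning marks integrate out to a
   product over the points, and the femtocells to an explicit function of r^2, by
   the Laplace functionals of Poisson processes and clusters. What remains is the
   expectation of exp(- G(q) - sum_(n >= 1) L(q, X_n)), where q = |X_0|^2 is the
   squared distance of the nearest point. As G and L are monotone in q, on each
   annulus a < q <= b this is squeezed between two Laplace functionals of the whole
   process; summing over a grid and refining it yields the integral over v.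
   The mean rate is the integral of the tails P(ln (1 + SINR) > t). *)
Require Import Defs.
From HB Require Import structures.
From mathcomp Require Import all_boot all_order all_algebra.
From mathcomp Require Import finmap ring lra.
From mathcomp Require Import all_classical all_reals all_analysis measurable_realfun.
Import Order.TTheory GRing.Theory Num.Theory.
Local Open Scope classical_set_scope.
Local Open Scope ring_scope.
Import numFieldNormedType.Exports.

Set Implicit Arguments.
Unset Strict Implicit.
Unset Printing Implicit Defensive.

(** * Independent sigma-algebras *)

Section Independence.
Local Open Scope ereal_scope.
Context {R : realType} {d : measure_display} {Ω : measurableType d}.
Variable P : probability Ω R.

(** The law of a point process is given only through its counts on disjoint sets, and no conditional
    law given the nearest point is ever formed. What can be computed are Laplace functionals of
    deterministic test functions, whereas the interference involves a test function that depends on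
    the random [q]. Freezing [q] at an endpoint of a thin annulus restores a deterministic one; the
    price is a factor [expR (lam * pi * dl)] and a boundary term for the innermost cells, both
    harmless as the mesh [dl] tends to 0. Test functions may take the value [+oo], so that the
    indicator of an empty disk is itself of the form [expeR (- sum)]. The gains are nonnegative only
    almost surely; exponents therefore use [Num.max 0 g], which makes every term nonnegative at
    every sample point and lets limits and sums be exchanged without exceptional sets. *)

Definition pi_events (G : set (set Ω)) :=
  [/\ G `<=` measurable, G setT & setI_closed G].

Lemma pi_events_sub (G : set (set Ω)) : pi_events G -> <<s G >> `<=` measurable.
Proof.
by case=> Gm _ _; apply: smallest_sub => //; exact: sigma_algebra_measurable.
Qed.

(** With one event fixed, both sides are finite measures in the other event, so agreement on a
    pi-system containing [setT] extends to the generated sigma-algebra. [half] treats one argument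
    and is applied to each in turn. *)
Lemma independent_sigma (G1 G2 : set (set Ω)) :
    pi_events G1 -> pi_events G2 ->
    (forall A B, G1 A -> G2 B -> P (A `&` B) = P A * P B) ->
  forall A B, <<s G1 >> A -> <<s G2 >> B -> P (A `&` B) = P A * P B.
Proof.
have half (G : set (set Ω)) (B : set Ω) : pi_events G -> measurable B ->
    (forall A, G A -> P (A `&` B) = P A * P B) ->
    forall A, <<s G >> A -> P (A `&` B) = P A * P B.
  move=> [Gm GT GI] mB GB A sA.
  have PB0 : (0 <= fine (P B))%R by rewrite fine_ge0.
  have E : mscale (NngNum PB0) P A = mrestr P mB A.
    apply: (@g_sigma_algebra_measure_unique _ _ _ G Gm (fun _ => setT)) => //.
    - by apply: bigcup_const; exists 0%N.
    - by move=> C GC; rewrite /= /mscale /mrestr/= GB// fineK ?fin_num_measure// muleC.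
    - by move=> _; rewrite /= /mscale/= probability_setT mule1 ltry.
  by move: E; rewrite /= /mscale /mrestr/= fineK ?fin_num_measure// => <-; rewrite muleC.
move=> pG1 pG2 G12 A B sA sB.
have [G2m _ _] := pG2.
rewrite setIC muleC; apply: (half G2) => //; first exact: (pi_events_sub pG1).
move=> C GC; rewrite setIC muleC.
by apply: (half G1) => //; [exact: G2m|move=> ? ?; exact: G12].
Qed.

Lemma measurable_id_sigma (G : set (set Ω)) : pi_events G ->
  measurable_fun setT (idfun : Ω -> g_sigma_algebraType G).
Proof. by move=> pG _ A mA; rewrite setTI; exact: (pi_events_sub pG). Qed.

(* Independence turns the law of the diagonal map w |-> (w, w) into a product
   measure, the two coordinates carrying the two sub-sigma-algebras. *)
Lemma decoupling (G1 G2 : set (set Ω)) (F : Ω -> Ω -> \bar R) :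
    pi_events G1 -> pi_events G2 ->
    (forall A B, G1 A -> G2 B -> P (A `&` B) = P A * P B) ->
    measurable_fun setT
      (fun p : g_sigma_algebraType G1 * g_sigma_algebraType G2 => F p.1 p.2) ->
    (forall w1 w2, 0 <= F w1 w2) ->
  \int[P]_w F w w = \int[P]_w1 \int[P]_w2 F w1 w2.
Proof.
move=> pG1 pG2 G12 mF F0.
pose id1 := @measurable_id_sigma G1 pG1.
pose id2 := @measurable_id_sigma G2 pG2.
pose m1 : {mfun Ω >-> g_sigma_algebraType G1} :=
  HB.pack (idfun : Ω -> g_sigma_algebraType G1) (isMeasurableFun.Build _ _ _ _ _ id1).
pose m2 : {mfun Ω >-> g_sigma_algebraType G2} :=
  HB.pack (idfun : Ω -> g_sigma_algebraType G2) (isMeasurableFun.Build _ _ _ _ _ id2).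
have mdiag := measurable_fun_pair id1 id2.
pose md : {mfun Ω >-> (g_sigma_algebraType G1 * g_sigma_algebraType G2)%type} :=
  HB.pack (fun w : Ω => (w, w) : g_sigma_algebraType G1 * g_sigma_algebraType G2)
    (isMeasurableFun.Build _ _ _ _ _ mdiag).
transitivity (\int[distribution P md]_z F z.1 z.2).
  by rewrite ge0_integral_distribution.
transitivity (\int[distribution P m1 \x distribution P m2]_z F z.1 z.2).
  apply: eq_measure_integral => A mA _; apply/esym.
  apply: product_measure_unique => //= X Y mX mY.
  exact: (@independent_sigma G1 G2 pG1 pG2 G12 X Y mX mY).
rewrite fubini_tonelli1// /fubini_F.
have mF1 : measurable_fun setT
    (fun x : g_sigma_algebraType G1 => \int[distribution P m2]_y F x y).
  by have := measurable_fun_fubini_tonelli_F (m2 := distribution P m2) _ mF (fun z => F0 z.1 z.2).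
have I0 (x : g_sigma_algebraType G1) : 0 <= \int[distribution P m2]_y F x y.
  exact: integral_ge0.
rewrite (ge0_integral_distribution m1 mF1)//.
apply: eq_integral => w1 _ /=.
rewrite (ge0_integral_distribution m2 (f := F w1))//.
have := measurable_fun_pair2 (w1 : g_sigma_algebraType G1) mF; exact.
Qed.

(** The partial integral is measurable for the small sigma-algebra of the first coordinate. Since
    [P] lives on the full sigma-algebra, the second coordinate is first enlarged to [Ω], after which
    Tonelli applies. *)
Lemma decoupling_measurable (G1 G2 : set (set Ω)) (F : Ω -> Ω -> \bar R) :
    pi_events G1 -> pi_events G2 ->
    measurable_fun setT
      (fun p : g_sigma_algebraType G1 * g_sigma_algebraType G2 => F p.1 p.2) ->
    (forall w1 w2, 0 <= F w1 w2) ->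
  measurable_fun setT (fun w1 : g_sigma_algebraType G1 => \int[P]_w2 F w1 w2).
Proof.
move=> pG1 pG2 mF F0.
have mF' : measurable_fun setT (fun p : g_sigma_algebraType G1 * Ω => F p.1 p.2).
  have idp : measurable_fun setT (fun p : g_sigma_algebraType G1 * Ω =>
     (p : g_sigma_algebraType G1 * g_sigma_algebraType G2)).
    apply/measurable_fun_pairP; split; first exact: measurable_fst.
    exact: (measurableT_comp (measurable_id_sigma pG2) measurable_snd).
  exact: (measurableT_comp mF idp).
exact: (measurable_fun_fubini_tonelli_F (m2 := P) _ mF' (fun z => F0 z.1 z.2)).
Qed.

Section Families.
Context {K : choiceType}.
Variable F : K -> set (set Ω).
Hypothesis piF : forall k, pi_events (F k).

(** A pi-system generating the join of the sigma-algebras indexed by [S]. Finite intersections are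
    used because mutual independence speaks of exactly these. *)
Definition join_events (S : set K) : set (set Ω) :=
  [set E | exists (J : {fset K}) (B : K -> set Ω),
     [/\ [set` J] `<=` S, (forall k, F k (B k)) & E = \bigcap_(k in [set` J]) B k]].

Lemma join_eventsS k (S : set K) : S k -> F k `<=` join_events S.
Proof.
move=> Sk A FA; exists [fset k]%fset, (fun j => if j == k then A else setT); split.
- by move=> j /=; rewrite inE => /eqP ->.
- by move=> j; case: eqP => [->//|_]; have [] := piF j.
- apply/seteqP; split=> [w Aw j /=|w /(_ k)/=]; rewrite inE; first by move=> ->.
  by rewrite eqxx; apply.
Qed.

Lemma pi_join_events S : pi_events (join_events S).
Proof.
split.
- move=> _ [J [B [_ FB ->]]]; apply: fin_bigcap_measurable => // k _.
  by have [Fm _ _] := piF k; exact: Fm.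
- exists fset0, (fun=> setT); split=> //.
  + by move=> k; have [] := piF k.
  + by rewrite bigcapT.
- move=> _ _ [J1 [B1 [J1S FB1 ->]]] [J2 [B2 [J2S FB2 ->]]].
  exists (J1 `|` J2)%fset,
    (fun k => (if k \in J1 then B1 k else setT) `&` (if k \in J2 then B2 k else setT)).
  split.
  + by move=> k /=; rewrite inE => /orP[/J1S|/J2S].
  + move=> k; have [_ FT FI] := piF k.
    by apply: FI; case: ifP.
  + apply/seteqP; split=> [w [H1 H2] k /= _|w H].
      by split; case: ifPn => // kJ; [exact: H1|exact: H2].
    split=> k /= kJ; have := H k; rewrite /= inE kJ ?orbT => /(_ isT)[];
      by case: ifP.
Qed.

Hypothesis indF : mutually_independent P F.

(** The finite index sets of the two events are disjoint, so their selectors merge into a single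
    selector on the union; mutual independence turns the intersection into one product, which splits
    back along the two index sets. *)
Lemma join_events_indep (S1 S2 : set K) : S1 `&` S2 = set0 ->
  forall A B, join_events S1 A -> join_events S2 B -> P (A `&` B) = P A * P B.
Proof.
move=> S12 _ _ [J1 [B1 [J1S FB1 ->]]] [J2 [B2 [J2S FB2 ->]]].
have J12 k : k \in J1 -> k \in J2 -> False.
  by move=> /J1S S1k /J2S S2k; rewrite -[False]/(set0 k) -S12.
pose B k := if k \in J1 then B1 k else B2 k.
have -> : (\bigcap_(k in [set` J1]) B1 k) `&` (\bigcap_(k in [set` J2]) B2 k) =
    \bigcap_(k in [set` (J1 `|` J2)%fset]) B k.
  apply/seteqP; split=> [w [H1 H2] k /=|w H].
    by rewrite /B inE; case: ifPn => [kJ _|_ /= kJ]; [exact: H1|exact: H2].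
  split=> k /= kJ; have := H k; rewrite /= inE kJ ?orbT /B => /(_ isT) //.
    by rewrite kJ.
  by case: ifPn => // /J12/(_ kJ).
rewrite !indF//; last by move=> k _; rewrite /B; case: ifP.
rewrite (big_fsetID _ (mem J1))/=; congr (_ * _).
- rewrite (_ : [fset x in _ | _]%fset = J1); last first.
    by apply/fsetP => k; rewrite !inE/=; case: (k \in J1); rewrite ?andbT ?andbF.
  by apply: eq_big_seq => k kJ; rewrite /B kJ.
- rewrite (_ : [fset x in _ | _]%fset = J2); last first.
    apply/fsetP => k; rewrite !inE/=; case: (boolP (k \in J1)) => kJ1; rewrite ?andbT ?andbF//=.
    by apply/esym/negP => /(J12 _ kJ1).
  by apply: eq_big_seq => k kJ; rewrite /B; case: ifPn => // /J12/(_ kJ).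
Qed.

Lemma join_decoupling (S1 S2 : set K) (f : Ω -> Ω -> \bar R) :
    S1 `&` S2 = set0 ->
    measurable_fun setT (fun p : g_sigma_algebraType (join_events S1) *
      g_sigma_algebraType (join_events S2) => f p.1 p.2) ->
    (forall w1 w2, 0 <= f w1 w2) ->
  \int[P]_w f w w = \int[P]_w1 \int[P]_w2 f w1 w2.
Proof.
move=> S12 mf f0; apply: (@decoupling (join_events S1) (join_events S2)) => //;
  by [exact: pi_join_events|exact: join_events_indep].
Qed.

Lemma sub_sigma_measurable (G G' : set (set Ω)) d' (T : measurableType d') (f : Ω -> T) :
  G `<=` <<s G' >> -> measurable_fun setT (f : g_sigma_algebraType G -> T) ->
  measurable_fun setT (f : g_sigma_algebraType G' -> T).
Proof.
move=> GG' mf _ B mB; have := mf measurableT B mB.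
by apply: smallest_sub => //; exact: smallest_sigma_algebra.
Qed.

Lemma join_measurable k (S : set K) d' (T : measurableType d') (f : Ω -> T) :
  S k -> measurable_fun setT (f : g_sigma_algebraType (F k) -> T) ->
  measurable_fun setT (f : g_sigma_algebraType (join_events S) -> T).
Proof.
move=> Sk; apply: sub_sigma_measurable.
by apply: (subset_trans (join_eventsS Sk)); exact: sub_sigma_algebra.
Qed.

Lemma measurable_eprod d' (T : measurableType d') (s : seq K) (f : K -> T -> \bar R) :
  (forall k, k \in s -> measurable_fun setT (f k)) ->
  measurable_fun setT (fun w => \prod_(k <- s) f k w).
Proof.
elim: s => [_|k s IH mf].
  by apply: (eq_measurable_fun (cst 1)) => // w _; rewrite big_nil.
apply: (eq_measurable_fun (fun w => f k w * \prod_(j <- s) f j w)) => [w _|].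
  by rewrite big_cons.
apply: emeasurable_funM; first by apply: mf; rewrite mem_head.
by apply: IH => j js; apply: mf; rewrite in_cons js orbT.
Qed.

(** By induction on the list: the head depends on one member of the family, the remaining product on
    the join of the others, and decoupling separates them. *)
Lemma independent_prod (s : seq K) (f : K -> Ω -> \bar R) : uniq s ->
    (forall k, measurable_fun setT (f k : g_sigma_algebraType (F k) -> \bar R)) ->
    (forall k w, 0 <= f k w) ->
  \int[P]_w (\prod_(k <- s) f k w) = \prod_(k <- s) \int[P]_w f k w.
Proof.
move=> us mf f0; elim: s us => [_|k s IH /= /andP[ks us]].
  rewrite (eq_integral (cst 1)); last by move=> w _; rewrite big_nil.
  by rewrite integral_cst// big_nil mul1e; exact: probability_setT.
rewrite big_cons -IH//.
under eq_integral do rewrite big_cons.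
have ms : measurable_fun setT ((fun w => \prod_(j <- s) f j w) :
    g_sigma_algebraType (join_events [set j | j \in s]) -> \bar R).
  by apply: measurable_eprod => j js; exact: (@join_measurable j).
have p0 w : 0 <= \prod_(j <- s) f j w by elim/big_rec: _ => // *; rewrite mule_ge0.
rewrite (@join_decoupling [set k] [set j | j \in s] (fun w1 w2 => f k w1 * \prod_(j <- s) f j w2)).
- under eq_integral => w1 _.
    rewrite ge0_integralZl//; last first.
      move=> _ B mB; have := ms measurableT B mB; apply: (pi_events_sub (pi_join_events _)).
    over.
  rewrite ge0_integralZr//; last exact: integral_ge0.
  by move=> _ B mB; have := mf k measurableT B mB; apply: (pi_events_sub (piF _)).
- by rewrite -subset0 => j [/= ->]; exact/negP.
- apply: emeasurable_funM.
    have := @join_measurable k [set k] _ _ (f k) erefl (mf k).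
    by move=> h; exact: (measurableT_comp h measurable_fst).
  exact: (measurableT_comp ms measurable_snd).
- by move=> *; rewrite mule_ge0.
Qed.

End Families.
End Independence.

(** * Laplace transforms *)

Section ExpeR.
Local Open Scope ereal_scope.
Context {R : realType}.

Lemma measurable_expeR : measurable_fun setT (@expeR R).
Proof.
(* [er_map] fixes [-oo], whereas [expeR] sends it to 0; the other values agree. *)
apply: (eq_measurable_fun (fun x => if x == -oo then 0 else er_map expR x)).
  by case.
apply: measurable_fun_ifT => //.
  by apply: measurable_fun_eqe => //; exact: measurable_cst.
exact: (@measurable_er_map _ (measurableTypeR R) _ _ (@measurable_expR R)).
Qed.

Lemma expeRN_le1 (a : \bar R) : 0 <= a -> expeR (- a) <= 1.
Proof. by move=> a0; rewrite -expeR0 lee_expeR leeNl oppe0. Qed.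

Lemma expeRN_fin_num (a : \bar R) : 0 <= a -> expeR (- a) \is a fin_num.
Proof.
move=> a0; rewrite ge0_fin_numE ?expeR_ge0//.
by rewrite (le_lt_trans (expeRN_le1 a0))// ltry.
Qed.

Lemma oppe_addN (a b : \bar R) : 0 <= a -> 0 <= b -> - (a + b) = - a - b.
Proof. by move=> a0 b0; rewrite oppeD// ge0_adde_def. Qed.

Lemma expeRND (a b : \bar R) : 0 <= a -> 0 <= b ->
  expeR (- (a + b)) = expeR (- a) * expeR (- b).
Proof. by move=> a0 b0; rewrite oppe_addN// expeRD. Qed.

Lemma expeRN_sum (I : Type) (s : seq I) (P : pred I) (a : I -> \bar R) :
  (forall i, P i -> 0 <= a i) ->
  expeR (- (\sum_(i <- s | P i) a i)) = \prod_(i <- s | P i) expeR (- a i).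
Proof.
move=> a0.
elim: s => [|i s IH]; first by rewrite !big_nil oppe0 expeR0.
by rewrite !big_cons; case: ifPn => // Pi; rewrite expeRND ?a0 ?IH// sume_ge0.
Qed.

Lemma cvg_expeRN (u : (\bar R)^nat) (l : \bar R) : (forall n, 0 <= u n) ->
  u @ \oo --> l -> expeR (- u n) @[n --> \oo] --> expeR (- l).
Proof.
move=> u0 ul.
have l0 : 0 <= l.
  by rewrite -(cvg_lim _ ul)//; apply: lime_ge; [apply: cvgP ul|exact: nearW].
case: l l0 ul => [r| |//] l0.
- move=> /fine_cvgP[fu cu]; apply/fine_cvgP; split.
    by apply: nearW => n /=; exact: expeRN_fin_num.
  have : expR (- fine (u n))%R @[n --> \oo] --> (expR (- r) : R).
    by apply: continuous_cvg; [exact: continuous_expR|exact: cvgN].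
  apply: cvg_trans; apply: near_eq_cvg; near=> n => /=.
  have /fineK <- : u n \is a fin_num by near: n; exact: fu.
  by [].
(* Limit [+oo]: [expeR (- u n) <= e] as soon as [u n] exceeds [- ln e]. *)
- move=> /cvgeyPge uy; apply/fine_cvgP; split.
    by apply: nearW => n /=; exact: expeRN_fin_num.
  apply/cvgrPdist_le => e e0; near=> n.
  rewrite /= sub0r normrN ger0_norm ?fine_ge0 ?expeR_ge0//.
  rewrite -lee_fin fineK ?expeRN_fin_num//.
  rewrite -[e]lnK ?posrE// -[X in _ <= X]/(expeR (ln e)%:E) lee_expeR.
  by rewrite leeNl -EFinN; near: n; exact: uy.
Unshelve. all: by end_near. Qed.

Lemma expR_eseries (x : R) : (0 <= x)%R ->
  \sum_(k <oo) (exp_coeff x k)%:E = (expR x)%:E.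
Proof.
move=> x0; rewrite /expR -EFin_lim; last exact: is_cvg_series_exp_coeff.
by apply/congr_lim/funext => n; rewrite /= /series/= sumEFin.
Qed.

End ExpeR.

Section Laplace.
Local Open Scope ereal_scope.
Context {R : realType} {d : measure_display} {Ω : measurableType d}.
Variable P : probability Ω R.

Lemma measurable_expeRN d' (T : measurableType d') (S : T -> \bar R) :
  measurable_fun setT S -> measurable_fun setT (fun w => expeR (- S w)).
Proof.
move=> mS; apply: (measurableT_comp measurable_expeR).
exact: (measurableT_comp (@oppe_measurable _ _) mS).
Qed.

(** Nonnegative exponents keep the integrands below the constant 1, so dominated convergence carries
    a Laplace identity to the limit, even where [S] or [s] is [+oo]. *)
Lemma laplace_cvg (Sn : nat -> Ω -> \bar R) (S : Ω -> \bar R)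
    (sn : nat -> \bar R) (s : \bar R) :
    (forall n, measurable_fun setT (Sn n)) -> (forall n w, 0 <= Sn n w) ->
    (forall n, 0 <= sn n) ->
    (forall w, Sn ^~ w @ \oo --> S w) -> sn @ \oo --> s ->
    (forall n, \int[P]_w expeR (- Sn n w) = expeR (- sn n)) ->
  \int[P]_w expeR (- S w) = expeR (- s).
Proof.
move=> mSn Sn0 sn0 SnS sns E.
have mS : measurable_fun setT S by exact: (emeasurable_fun_cvg Sn).
have H1 : {ae P, forall w, setT w ->
    (fun n => expeR (- Sn n w)) @ \oo --> expeR (- S w)}.
  by apply: aeW => w _; exact: cvg_expeRN.
have H2 : P.-integrable setT (cst 1) by exact: finite_measure_integrable_cst.
have H3 : {ae P, forall w n, setT w -> `|expeR (- Sn n w)| <= cst 1 w}.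
  by apply: aeW => w n _ /=; rewrite gee0_abs ?expeR_ge0// expeRN_le1.
have [_ _] := dominated_convergence measurableT
  (fun n => measurable_expeRN (mSn n)) (measurable_expeRN mS) H1 H2 H3.
rewrite (_ : [sequence _]_n = (fun n => expeR (- sn n))); last exact/funext.
move=> /cvg_lim <- //.
by apply/cvg_lim => //; exact: cvg_expeRN.
Qed.

Lemma laplace_indep_sum (K : choiceType) (F : K -> set (set Ω)) (s : seq K)
    (V : K -> Ω -> \bar R) (v : K -> \bar R) :
    (forall k, pi_events (F k)) -> mutually_independent P F -> uniq s ->
    (forall k, measurable_fun setT (V k : g_sigma_algebraType (F k) -> \bar R)) ->
    (forall k w, 0 <= V k w) -> (forall k, 0 <= v k) ->
    (forall k, \int[P]_w expeR (- V k w) = expeR (- v k)) ->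
  \int[P]_w expeR (- \sum_(k <- s) V k w) = expeR (- \sum_(k <- s) v k).
Proof.
move=> piF indF us mV V0 v0 E.
under eq_integral do rewrite expeRN_sum//.
rewrite (independent_prod piF indF us).
- by rewrite expeRN_sum//; apply: eq_bigr => k _; rewrite E.
- by move=> k; exact: measurable_expeRN.
- by move=> *; exact: expeR_ge0.
Qed.

Lemma pi_sub_measurable (G : set (set Ω)) d' (T : measurableType d') (f : Ω -> T) :
  pi_events G -> measurable_fun setT (f : g_sigma_algebraType G -> T) ->
  measurable_fun setT f.
Proof. by move=> pG mf _ B mB; apply: (pi_events_sub pG); exact: mf. Qed.

Lemma laplace_indep_series (F : nat -> set (set Ω)) m
    (V : nat -> Ω -> \bar R) (v : nat -> \bar R) :
    (forall k, pi_events (F k)) -> mutually_independent P F ->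
    (forall k, measurable_fun setT (V k : g_sigma_algebraType (F k) -> \bar R)) ->
    (forall k w, 0 <= V k w) -> (forall k, 0 <= v k) ->
    (forall k, \int[P]_w expeR (- V k w) = expeR (- v k)) ->
  \int[P]_w expeR (- \sum_(m <= k <oo) V k w) = expeR (- \sum_(m <= k <oo) v k).
Proof.
move=> piF indF mV V0 v0 E.
apply: (@laplace_cvg (fun n w => \sum_(m <= k < n) V k w) _ (fun n => \sum_(m <= k < n) v k)).
- by move=> n; apply: emeasurable_sum => k; exact: (pi_sub_measurable (piF k)).
- by move=> n w; exact: sume_ge0.
- by move=> n; exact: sume_ge0.
- by move=> w; exact: is_cvg_nneseries.
- exact: is_cvg_nneseries.
- by move=> n; apply: (laplace_indep_sum piF indF) => //; exact: iota_uniq.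
Qed.

(** The outer and the inner series are truncated one after the other, each by a limit; what remains
    is a sum over a finite rectangle, that is, over a list of distinct pairs. *)
Lemma laplace_indep_series2 (F : nat * nat -> set (set Ω))
    (V : nat -> nat -> Ω -> \bar R) (v : nat -> nat -> \bar R) :
    (forall k, pi_events (F k)) -> mutually_independent P F ->
    (forall k j, measurable_fun setT (V k j : g_sigma_algebraType (F (k, j)) -> \bar R)) ->
    (forall k j w, 0 <= V k j w) -> (forall k j, 0 <= v k j) ->
    (forall k j, \int[P]_w expeR (- V k j w) = expeR (- v k j)) ->
  \int[P]_w expeR (- \sum_(0 <= k <oo) \sum_(0 <= j <oo) V k j w) =
  expeR (- \sum_(0 <= k <oo) \sum_(0 <= j <oo) v k j).
Proof.
move=> piF indF mV V0 v0 E.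
have mVP k j : measurable_fun setT (V k j) by exact: (pi_sub_measurable (piF _)).
have S0 k w n : 0 <= \sum_(0 <= j < n) V k j w by exact: sume_ge0.
have s0 k n : 0 <= \sum_(0 <= j < n) v k j by exact: sume_ge0.
have mSV k : measurable_fun setT (fun w => \sum_(0 <= j <oo) V k j w).
  by have := @ge0_emeasurable_sum _ _ _ setT (V k) xpredT (fun j w _ _ => V0 k j w)
    (fun j _ => mVP k j).
apply: (@laplace_cvg (fun n w => \sum_(0 <= k < n) \sum_(0 <= j <oo) V k j w) _
  (fun n => \sum_(0 <= k < n) \sum_(0 <= j <oo) v k j)).
- by move=> n; apply: emeasurable_sum => k.
- by move=> n w; apply: sume_ge0 => k _; exact: nneseries_ge0.
- by move=> n; apply: sume_ge0 => k _; exact: nneseries_ge0.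
- by move=> w; apply: is_cvg_nneseries => k _ _; exact: nneseries_ge0.
- by apply: is_cvg_nneseries => k _ _; exact: nneseries_ge0.
move=> n.
apply: (@laplace_cvg (fun m w => \sum_(0 <= k < n) \sum_(0 <= j < m) V k j w) _
  (fun m => \sum_(0 <= k < n) \sum_(0 <= j < m) v k j)).
- by move=> m; do 2 apply: emeasurable_sum => ?.
- by move=> m w; exact: sume_ge0.
- by move=> m; exact: sume_ge0.
- move=> w; apply: cvg_nnesum => [k _|k _]; first exact: nearW.
  exact: is_cvg_nneseries.
- apply: cvg_nnesum => [k _|k _]; first exact: nearW.
  exact: is_cvg_nneseries.
move=> m.
pose s := [seq (k, j) | k <- index_iota 0 n, j <- index_iota 0 m].
have Es (f : nat -> nat -> \bar R) :
    \sum_(0 <= k < n) \sum_(0 <= j < m) f k j = \sum_(p <- s) f p.1 p.2.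
  by rewrite big_allpairs_dep.
under eq_integral do rewrite Es.
rewrite Es; apply: (laplace_indep_sum piF indF (V := fun p => V p.1 p.2)) => //.
- by apply: allpairs_uniq; [exact: iota_uniq|exact: iota_uniq|move=> [? ?] [? ?] _ _].
- by case.
Qed.

(** The law of [g] is known only through its tails. Writing [1 - expR (- (a * G))] as the mass that
    an exponential density of rate [a] gives to the interval from 0 to [G], and exchanging integrals
    by Tonelli, brings in exactly these tails. The value [(1 + c)^-1] is written as an [expeR] to
    fit the lemmas on independent sums. *)
Lemma laplace_exp_rv (mu : R) (g : Ω -> R) (c : R) : (0 < mu)%R -> exp_rv P mu g ->
  (0 <= c)%R ->
  \int[P]_w expeR (- (mu * c * Num.max 0 (g w))%:E) = expeR (- (ln (1 + c))%:E).
Proof.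
move=> mu0 [mg Pg]; rewrite le_eqVlt => /predU1P[<-|c0].
  rewrite (eq_integral (cst 1)); last by move=> w _; rewrite mulr0 mul0r oppe0 expeR0.
  by rewrite integral_cst// mul1e addr0 ln1 oppe0 expeR0; exact: probability_setT.
pose G w := Num.max 0%R (g w); pose a := (mu * c)%R.
have a0 : (0 < a)%R by rewrite mulr_gt0.
have mG : measurable_fun setT G by apply: measurable_maxr.
pose f (p : Ω * R) := if (p.2 < G p.1)%R then (exponential_pdf a p.2)%:E else 0.
have mf : measurable_fun setT f.
  apply: measurable_fun_ifT => //.
    apply: measurable_fun_ltr; first exact: measurable_snd.
    exact: (measurableT_comp mG measurable_fst).
  apply/measurable_EFinP.
  exact: (measurableT_comp (measurable_exponential_pdf a) measurable_snd).
have f0 p : 0 <= f p.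
  by rewrite /f; case: ifP => // _; rewrite lee_fin exponential_pdf_ge0// ltW.
have I1 w : \int[lebesgue_measure]_t f (w, t) = (1 - expR (- (a * G w)))%:E.
  have Gw0 : (0 <= G w)%R by rewrite /G le_max lexx.
  transitivity (\int[@lebesgue_measure R]_(t in `[0%R, (G w)[%classic) (exponential_pdf a t)%:E).
    rewrite [RHS]integral_mkcond; apply: eq_integral => t _; rewrite /f /= patchE.
    rewrite mem_setE in_itv/=; case: ifPn => [tG|_]; last by rewrite andbF.
    rewrite andbT; case: ifPn => //; rewrite -ltNge => t0.
    by rewrite lt0_exponential_pdf.
  rewrite integral_itv_bndo_bndc; last first.
    by apply/measurable_EFinP/measurable_funTS; exact: measurable_exponential_pdf.
  move: Gw0; rewrite le_eqVlt => /predU1P[<-|Gw0].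
    by rewrite set_itv1 integral_set1 mulr0 oppr0 expR0 subrr.
  by have := exponential_prob_itv0c a Gw0; rewrite /exponential_prob => ->; rewrite mulNr.
have I2 t : \int[P]_w f (w, t) = (a / (a + mu) * exponential_pdf (a + mu) t)%:E.
  rewrite /f/=; have [t0|t0] := ltP t 0%R.
    rewrite integral0_eq ?lt0_exponential_pdf ?mulr0//.
    by move=> w _; rewrite ?lt0_exponential_pdf// if_same.
  transitivity (\int[P]_w ((exponential_pdf a t)%:E * (\1_[set w | (t < g w)%R] w)%:E)).
    apply: eq_integral => w _; rewrite /G lt_max ltNge t0/= indicE.
    have -> : (w \in [set w | (t < g w)%R]) = (t < g w)%R.
      by apply/idP/idP; rewrite inE.
    by case: ifP; rewrite ?mule1 ?mule0.
  have mtg : measurable [set w | (t < g w)%R].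
    rewrite -[X in measurable X]setTI; exact: measurable_fun_ltr.
  rewrite ge0_integralZl ?lee_fin ?exponential_pdf_ge0 ?ltW//; last exact/measurable_EFinP/measurable_indic.
  rewrite integral_indic// setIT.
  transitivity ((exponential_pdf a t)%:E * (expR (- (mu * t)))%:E).
    by congr (_ * _); exact: Pg.
  rewrite -EFinM !exponential_pdfE//.
  rewrite /= mulrA divfK ?gt_eqF ?addr_gt0// -mulrA -expRD; congr (_ * expR _)%:E.
  by ring.
have I12 : \int[P]_w (1 - expR (- (a * G w)))%:E = (a / (a + mu))%:E.
  under eq_integral do rewrite -I1.
  have := fubini_tonelli (m1 := P) (m2 := @lebesgue_measure R) f mf f0.
  rewrite /fubini_F /fubini_G => ->.
  under eq_integral do rewrite I2 EFinM.
  have amu : (0 < a + mu)%R by rewrite addr_gt0.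
  rewrite ge0_integralZl//.
  - by rewrite integral_exponential_pdf// mule1.
  - by apply/measurable_EFinP; exact: measurable_exponential_pdf.
  - by move=> t _; rewrite lee_fin exponential_pdf_ge0// ltW.
  - by rewrite lee_fin divr_ge0 ?ltW.
have mexp : measurable_fun setT (fun w => expR (- (a * G w))).
  apply: (measurableT_comp (@measurable_expR R)); apply: (measurableT_comp (@oppr_measurable R _)).
  exact: (measurableT_comp (@mulrl_measurable R _ a)).
have exp1 w : (expR (- (a * G w)) <= 1)%R.
  by rewrite -expR0 ler_expR lerNl oppr0 mulr_ge0 ?(ltW a0)// /G le_max lexx.
have S1 : \int[P]_w (1 - expR (- (a * G w)))%:E + \int[P]_w (expR (- (a * G w)))%:E = 1.
  rewrite -ge0_integralD//.
  - rewrite (eq_integral (cst 1)); last by move=> w _; rewrite -EFinD subrK.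
    by rewrite integral_cst// mul1e; exact: probability_setT.
  - by move=> w _; rewrite lee_fin subr_ge0.
  - by apply/measurable_EFinP; apply: measurable_funB.
  - exact/measurable_EFinP.
have -> : \int[P]_w expeR (- (mu * c * Num.max 0 (g w))%:E) = \int[P]_w (expR (- (a * G w)))%:E by [].
have -> : expeR (- (ln (1 + c))%:E) = (1 - a / (a + mu))%:E.
  rewrite /= expRN lnK ?posrE ?addr_gt0//; congr (_ %:E).
  rewrite /a; field.
  by rewrite !gt_eqF ?addr_gt0 ?mulr_gt0.
move: S1; rewrite I12; case: (\int[P]_w _) => [r| |]//; rewrite -EFinD => -[<-].
by congr (_ %:E); ring.
Qed.

Lemma laplace_bernoulli (b : Ω -> bool) (p : R) (l : R) : measurable_fun setT b ->
  P [set w | b w] = p%:E -> (0 <= l)%R ->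
  \int[P]_w expeR (- (if b w then l%:E else 0)) = (1 - p * (1 - expR (- l)))%:E.
Proof.
move=> mb Pb l0.
have mB : measurable [set w | b w] by rewrite -[X in measurable X]setTI; exact: mb.
have mBC : measurable (~` [set w | b w]) by exact: measurableC.
rewrite -(setUv [set w | b w]) ge0_integral_setU//; last 3 first.
- rewrite setUv; apply: measurable_expeRN; apply: measurable_fun_ifT => //.
- by move=> *; exact: expeR_ge0.
- by rewrite disj_set2E; apply/eqP; rewrite setICr.
rewrite (eq_integral (cst (expR (- l))%:E)); last first.
  by move=> w; rewrite inE/= => ->.
rewrite [X in _ + X](eq_integral (cst 1)); last first.
  by move=> w; rewrite inE/= => /negP/negbTE ->; rewrite oppe0 expeR0.
rewrite !integral_cst//.
have PC : P (~` [set w | b w]) = (1 - p)%:E by rewrite probability_setC// Pb.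
transitivity ((expR (- l))%:E * p%:E + 1 * (1 - p)%:E).
  by congr (_ * _ + _ * _).
by rewrite mul1e -EFinM -EFinD; congr (_ %:E); ring.
Qed.

Lemma laplace_poisson (N : Ω -> \bar R) (rho c : R) : measurable_fun setT N ->
  (0 <= rho)%R -> (forall k : nat, P [set w | N w = k%:R%:E] = (poissonp rho k)%:E) ->
  (0 <= c)%R -> \int[P]_w expeR (- (c%:E * N w)) = (expR (- (rho * (1 - expR (- c)))))%:E.
Proof.
move=> mN rho0 PN c0.
pose A k := [set w | N w = k%:R%:E].
have mA k : measurable (A k).
  by rewrite -[X in measurable X]setTI; apply: (mN measurableT [set k%:R%:E]); exact: emeasurable_set1.
have tA : trivIset setT A.
  move=> i j _ _ [w [/= Ni Nj]]; move: Nj; rewrite /A/= Ni => -[] /eqP.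
  by rewrite eqr_nat => /eqP.
have mexp : measurable_fun setT (fun w => expeR (- (c%:E * N w))).
  by apply: measurable_expeRN; apply: measurable_funeM.
have mU : measurable (\bigcup_k A k) by exact: bigcupT_measurable.
have psum (y : R) : (0 <= y)%R -> \sum_(k <oo) (y ^+ k / k`!%:R * expR (- rho))%:E =
    (expR (y - rho))%:E.
  move=> y0; rewrite expRD mulrC EFinM -(expR_eseries y0) -nneseriesZl; last first.
    by move=> k _; rewrite lee_fin exp_coeff_ge0.
  by apply: eq_eseriesr => k _; rewrite -EFinM mulrC.
(* The Poisson weights sum to 1, so all other values of [N], in particular [+oo], form a null
   event. *)
have PU : P (\bigcup_k A k) = 1.
  rewrite measure_bigcup//=; transitivity (\sum_(k <oo) (rho ^+ k / k`!%:R * expR (- rho))%:E).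
    by rewrite eseries_mkcond; apply: eq_eseriesr => k _; rewrite ifT ?inE//; exact: PN.
  by rewrite psum// subrr expR0.
have PC : P (~` (\bigcup_k A k)) = 0 by rewrite probability_setC// PU subee.
rewrite (@ge0_negligible_integral _ _ _ P setT (~` (\bigcup_k A k)))//; last 2 first.
- exact: measurableC.
- by move=> *; exact: expeR_ge0.
rewrite setTD setCK ge0_integral_bigcup//; last 2 first.
- exact: measurable_funTS.
- by move=> *; exact: expeR_ge0.
transitivity (\sum_(k <oo) ((rho * expR (- c)) ^+ k / k`!%:R * expR (- rho))%:E).
  apply: eq_eseriesr => k _.
  rewrite (eq_integral (cst (expR (- c) ^+ k)%:E)); last first.
    by move=> w; rewrite inE /A/= => ->; rewrite /= -expRM_natl mulrN mulrC.
  rewrite integral_cst//; transitivity ((expR (- c) ^+ k)%:E * (poissonp rho k)%:E).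
    by congr (_ * _); exact: PN.
  rewrite -EFinM /poissonp; congr (_ %:E).
  by rewrite exprMn; ring.
rewrite psum ?mulr_ge0 ?expR_ge0//; congr (expR _)%:E.
by ring.
Qed.

End Laplace.

(** * Laplace functional of a Poisson process *)

Section GeneratedEvents.
Context {d : measure_display} {Ω : measurableType d} {d' : measure_display}.
Context {T : measurableType d'}.

Lemma pi_events_of (Y : Ω -> T) : measurable_fun setT Y -> pi_events (events_of Y).
Proof.
move=> mY; split.
- by move=> _ [B mB ->]; rewrite -[X in measurable X]setTI; exact: mY.
- by exists setT.
- by move=> _ _ [B mB ->] [C mC ->]; exists (B `&` C) => //; exact: measurableI.
Qed.

Lemma measurable_events_of (Y : Ω -> T) d2 (U : measurableType d2) (f : T -> U) :
  measurable_fun setT f ->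
  measurable_fun setT ((fun w => f (Y w)) : g_sigma_algebraType (events_of Y) -> U).
Proof.
move=> mf _ B mB; apply: sub_sigma_algebra; exists (f @^-1` B).
  by rewrite -[X in measurable X]setTI; exact: mf.
by rewrite setTI.
Qed.

Context {I : choiceType}.

Lemma pi_gen_events (X : I -> Ω -> T) : (forall i, measurable_fun setT (X i)) ->
  pi_events (gen_events X).
Proof.
move=> mX; split.
- move=> _ [J [B [mB ->]]]; apply: fin_bigcap_measurable => // i _.
  by rewrite -[X in measurable X]setTI; exact: mX.
- exists fset0, (fun=> setT); split=> //.
  by apply/seteqP; split.
- move=> _ _ [J1 [B1 [mB1 ->]]] [J2 [B2 [mB2 ->]]].
  exists (J1 `|` J2)%fset,
    (fun k => (if k \in J1 then B1 k else setT) `&` (if k \in J2 then B2 k else setT)).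
  split; first by move=> k; apply: measurableI; case: ifP.
  apply/seteqP; split=> [w [H1 H2] k /= _|w H].
    by split; case: ifPn => // kJ; [exact: H1|exact: H2].
  split=> k /= kJ; have := H k; rewrite /= inE kJ ?orbT => /(_ isT)[];
    by case: ifP.
Qed.

Lemma measurable_gen_events (X : I -> Ω -> T) i :
  measurable_fun setT (X i : g_sigma_algebraType (gen_events X) -> T).
Proof.
move=> _ B mB; apply: sub_sigma_algebra.
exists [fset i]%fset, (fun=> B); split=> //; rewrite setTI.
apply/seteqP; split=> [w Bw j /=|w /(_ i)/=]; rewrite inE.
  by move/eqP => ->.
by rewrite eqxx; apply.
Qed.

End GeneratedEvents.

Section Series.
Local Open Scope ereal_scope.
Context {R : realType}.

(** Monotone convergence for the counting measure. *)
Lemma cvg_nneseries (a : nat -> nat -> \bar R) (b : nat -> \bar R) :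
  (forall k n, 0 <= a k n) -> (forall n, nondecreasing_seq (a ^~ n)) ->
  (forall n, a ^~ n @ \oo --> b n) ->
  \sum_(n <oo) a k n @[k --> \oo] --> \sum_(n <oo) b n.
Proof.
move=> a0 nda ab.
have b0 n : 0 <= b n.
  by rewrite -(cvg_lim _ (ab n))//; apply: lime_ge; [apply: cvgP (ab n)|exact: nearW].
rewrite -ge0_integral_count//.
have -> : (fun k => \sum_(n <oo) a k n) = (fun k => \int[counting]_n a k n).
  by apply/funext => k; rewrite ge0_integral_count.
have -> : \int[counting]_n b n = \int[@counting nat R]_n limn (a ^~ n).
  by apply: eq_integral => n _; apply/esym/cvg_lim.
exact: cvg_monotone_convergence.
Qed.

Lemma nneseries_pred1 (F : nat -> \bar R) m : (forall n, 0 <= F n) ->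
  F m <= \sum_(n <oo) F n.
Proof.
move=> F0; apply: (@le_trans _ _ (\sum_(0 <= n < m.+1) F n)).
  by rewrite big_nat_recr//= addeC leeDl// sume_ge0.
exact: nneseries_lim_ge.
Qed.

Lemma measurable_nneseries d (T : measurableType d) m (h : nat -> T -> \bar R) :
  (forall n x, 0 <= h n x) -> (forall n, measurable_fun setT (h n)) ->
  measurable_fun setT (fun x => \sum_(m <= n <oo) h n x).
Proof.
move=> h0 mh.
apply: (emeasurable_fun_cvg (fun n x => \sum_(m <= i < n) h i x)).
  by move=> n; exact: emeasurable_sum.
by move=> x _; exact: is_cvg_nneseries.
Qed.

End Series.

Section PoissonLaplace.
Local Open Scope ereal_scope.
Context {R : realType} {d : measure_display} {Ω : measurableType d}.
Variable P : probability Ω R.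
Variables (A : nat -> Ω -> bool) (X : nat -> Ω -> pt R).
Variable Lam : {measure set (pt R) -> \bar R}.
Hypothesis PPP : is_PPP P A X Lam.

Let mA n : measurable_fun setT (A n). Proof. by case: PPP. Qed.
Let mX n : measurable_fun setT (X n). Proof. by case: PPP. Qed.

Lemma countE B w :
  Defs.count A X B w = \sum_(n <oo) (if A n w then \1_B (X n w) else 0%R)%:E :> \bar R.
Proof.
rewrite /Defs.count counting_dirac; apply: eq_eseriesr => n _.
rewrite /dirac !indicE; congr (_ %:E); case: ifPn => Anw.
  by congr (_ %:R); congr nat_of_bool; apply/idP/idP; rewrite !inE/=; [case|].
by rewrite memNset//= => -[]; rewrite (negbTE Anw).
Qed.

Lemma measurable_mark (L : pt R -> \bar R) n : measurable_fun setT L ->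
  measurable_fun setT (fun w => if A n w then L (X n w) else 0).
Proof.
move=> mL; apply: measurable_fun_ifT => //.
exact: (measurableT_comp mL (mX n)).
Qed.

Lemma measurable_count B : measurable B -> measurable_fun setT (Defs.count A X B).
Proof.
move=> mB; apply: (eq_measurable_fun
  (fun w => \sum_(n <oo) (if A n w then (\1_B (X n w))%:E else 0))).
  by move=> w _; rewrite countE; apply: eq_eseriesr => n _; case: ifP.
apply: measurable_nneseries => [n w|n]; first by case: ifP => // _; rewrite lee_fin.
apply: (@measurable_mark (fun x => (\1_B x)%:E)).
by apply/measurable_EFinP; exact: measurable_indic.
Qed.

Import HBNNSimple.

(** The sum over the points is a finite combination of the counts in the level sets of [L]; these
    sets are disjoint, so the counts are independent Poisson variables and the transform factors. *)
Lemma laplace_ppp_simple (L : {nnsfun (pt R) >-> R}) :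
    Lam [set x | L x != 0%R] < +oo ->
  \int[P]_w expeR (- \sum_(n <oo) (if A n w then (L (X n w))%:E else 0)) =
  expeR (- \int[Lam]_x (1 - expeR (- (L x)%:E))).
Proof.
move=> Lfin.
(* The value 0 is left out: it contributes nothing and its level set may have infinite measure. *)
pose s := [seq r <- fset_set (range L) | r != 0%R].
have us : uniq s by rewrite filter_uniq// fset_uniq.
have s0 r : r \in s -> (0 <= r)%R.
  rewrite mem_filter => /andP[_]; rewrite in_fset_set//.
  by rewrite inE => -[x _ <-].
pose c i := nth 0%R s i.
have c0 i : (0 <= c i)%R.
  rewrite /c; have [si|si] := leqP (size s) i; first by rewrite nth_default.
  exact/s0/mem_nth.
(* Continued by empty sets, because independence of counts is stated for infinite sequences of
   disjoint sets. *)
pose B i := if (i < size s)%N then L @^-1` [set c i] else set0.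
have mB i : measurable (B i).
  rewrite /B; case: ifP => // _; exact: measurable_funPTI.
have BL i : B i `<=` [set x | L x != 0%R].
  rewrite /B; case: ifP => [si x /= ->|_ x []].
  by have := mem_nth 0%R si; rewrite -/(c i) mem_filter => /andP[].
have mL0 : measurable [set x | L x != 0%R].
  rewrite (_ : [set x | _] = ~` (L @^-1` [set 0%R])); last first.
    by apply/seteqP; split=> x /= /eqP.
  apply: measurableC; exact: measurable_funPTI.
have LamB i : Lam (B i) < +oo.
  by apply: le_lt_trans Lfin; apply: le_measure; rewrite ?inE.
have tB : trivIset setT B.
  move=> i j _ _ [x []]; rewrite /B; case: ifP => // si /= Li; case: ifP => // sj /= Lj.
  by apply/eqP; rewrite -(nth_uniq 0%R si sj us) -/(c i) -/(c j) -Li -Lj.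
(* Used twice: with the identity to rewrite the sum over the points, and with [1 - expR (- r)] to
   rewrite the integral against the mean measure. *)
have phiE (phi : R -> R) x : phi 0%R = 0%R ->
    phi (L x) = (\sum_(0 <= i < size s) phi (c i) * \1_(B i) x)%R.
  move=> phi0; transitivity (\sum_(r <- s) phi r * (L x == r)%:R)%R.
    have [Lx0|Lx0] := eqVneq (L x) 0%R.
      rewrite Lx0 phi0 big_seq big1// => r; rewrite mem_filter => /andP[r0 _].
      by rewrite eq_sym (negbTE r0) mulr0.
    have Lxs : L x \in s.
      by rewrite mem_filter Lx0/= in_fset_set// inE; exists x.
    rewrite (bigD1_seq (L x))//= eqxx mulr1 big1 ?addr0// => r.
    by rewrite eq_sym => /negbTE ->; rewrite mulr0.
  rewrite (big_nth 0%R) !big_nat; apply: eq_bigr => i /andP[_ si].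
  by rewrite indicE /B si/= -/(c i); congr (_ * _%:R)%R; congr nat_of_bool;
    apply/eqP/idP; rewrite inE.
have [_ _ Pcount Pind] := PPP.
have /Pind indB := fun i => conj (mB i) (LamB i).
have {}indB := indB tB.
have mC i := measurable_count (mB i).
pose V i w := (c i)%:E * Defs.count A X (B i) w.
have cnt0 i w : 0 <= Defs.count A X (B i) w by exact: measure_ge0.
have V0 i w : 0 <= V i w by rewrite mule_ge0 ?lee_fin.
have phi1 (r : R) : (0 <= r)%R -> (0 <= 1 - expR (- r))%R.
  by move=> r0; rewrite subr_ge0 -expR0 ler_expR lerNl oppr0.
pose v i := (fine (Lam (B i)) * (1 - expR (- c i)))%:E.
have -> : \int[P]_w expeR (- \sum_(n <oo) (if A n w then (L (X n w))%:E else 0)) =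
    \int[P]_w expeR (- \sum_(i <- index_iota 0 (size s)) V i w).
  apply: eq_integral => w _; congr (expeR (- _)).
  transitivity (\sum_(n <oo) \sum_(0 <= i < size s)
      (c i)%:E * (if A n w then \1_(B i) (X n w) else 0%R)%:E).
    apply: eq_eseriesr => n _; case: ifP => _.
      by rewrite (phiE id)// -sumEFin; apply: eq_bigr => i _; rewrite EFinM.
    by rewrite big1// => i _; rewrite mule0.
  rewrite nneseries_sum_nat => [|n i]; last first.
    by rewrite mule_ge0 ?lee_fin//; case: ifP.
  apply: eq_bigr => i _; rewrite /V countE nneseriesZl// => n _.
  by rewrite lee_fin; case: ifP.
have mC' i := pi_events_of (mC i).
rewrite (laplace_indep_sum mC' indB (v := v))//.
- congr (expeR (- _)).
  under [RHS]eq_integral => x _.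
    rewrite (_ : 1 - expeR (- (L x)%:E) = (1 - expR (- L x))%:E)//.
    rewrite (phiE (fun r => 1 - expR (- r))%R) ?oppr0 ?expR0 ?subrr// -sumEFin.
    under eq_bigr do rewrite EFinM.
    over.
  rewrite ge0_integral_sum//.
  + apply: eq_bigr => i _; rewrite ge0_integralZl ?lee_fin ?phi1//; last first.
      by apply/measurable_EFinP; exact: measurable_indic.
    rewrite integral_indic// setIT /v muleC EFinM fineK// ge0_fin_numE//.
  + move=> i; apply: measurable_funeM; apply/measurable_EFinP; exact: measurable_indic.
  + by move=> i x _; rewrite mule_ge0 ?lee_fin ?phi1.
- exact: iota_uniq.
- by move=> i; apply: (measurable_events_of (f := fun y => (c i)%:E * y)); exact: measurable_funeM.
- by move=> i; rewrite lee_fin mulr_ge0 ?phi1// fine_ge0.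
- move=> i; rewrite /V (laplace_poisson (mC i) (rho := fine (Lam (B i)))) ?fine_ge0//.
  by move=> k; exact: Pcount.
Qed.

Variable D : nat -> set (pt R).
Hypothesis mD : forall n, measurable (D n).
Hypothesis ndD : nondecreasing_seq D.
Hypothesis covD : \bigcup_n D n = setT.
Hypothesis finD : forall n, Lam (D n) < +oo.

(** Simple approximations of [L] from below, cut off outside [D k], have supports of finite measure.
    Both sides increase along them in the exponent, so the identity passes to the limit; infinite
    values of [L] are allowed. *)
Lemma laplace_ppp (L : pt R -> \bar R) : measurable_fun setT L -> (forall x, 0 <= L x) ->
  \int[P]_w expeR (- \sum_(n <oo) (if A n w then L (X n w) else 0)) =
  expeR (- \int[Lam]_x (1 - expeR (- L x))).
Proof.
move=> mL L0.
pose f k : {nnsfun (pt R) >-> R} :=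
  mul_nnsfun (nnsfun_approx measurableT mL k) (indic_nnsfun R (mD k)).
have fE k x : f k x = (nnsfun_approx measurableT mL k x * \1_(D k) x)%R by [].
have ndf x : nondecreasing_seq (fun k => (f k x)%:E).
  move=> k l kl; rewrite lee_fin !fE ler_pM//.
    by apply/lefP; exact: nd_nnsfun_approx.
  rewrite !indicE ler_nat; have /subsetPset sD := ndD kl.
  case: (boolP (x \in D k)) => // /[!inE] /sD xD; by rewrite mem_set.
have cvf x : (fun k => (f k x)%:E) @ \oo --> L x.
  have [n _ Dnx] : (\bigcup_n D n) x by rewrite covD.
  have := cvg_nnsfun_approx measurableT mL (fun x _ => L0 x) (x := x) Logic.I.
  apply: cvg_trans; apply: near_eq_cvg; near=> k.
  have Dk : D k x.
    have /subsetPset : (D n <= D k)%O; last by exact.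
    by apply: ndD; near: k; exact: nbhs_infty_ge.
  have fkx : f k x = nnsfun_approx measurableT mL k x.
    by rewrite fE indicE mem_set ?mulr1.
  exact: (congr1 EFin (esym fkx)).
apply: (@laplace_cvg _ _ _ P
  (fun k w => \sum_(n <oo) (if A n w then (f k (X n w))%:E else 0)) _
  (fun k => \int[Lam]_x (1 - expeR (- (f k x)%:E)))).
- move=> k; apply: measurable_nneseries => [n w|n]; first by case: ifP => // _; rewrite lee_fin.
  apply: (@measurable_mark (fun x => (f k x)%:E)).
  by apply/measurable_EFinP; exact: (measurable_funP (f k)).
- by move=> k w; apply: nneseries_ge0 => n _ _; case: ifP => // _; rewrite lee_fin.
- by move=> k; apply: integral_ge0 => x _; rewrite sube_ge0 ?expeRN_le1 ?lee_fin// expeRN_fin_num ?lee_fin.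
- move=> w; apply: cvg_nneseries.
  + by move=> k n; case: ifP => // _; rewrite lee_fin.
  + by move=> n k l kl; case: ifP => // _; exact: ndf.
  + by move=> n; case: (A n w); [exact: cvf|exact: cvg_cst].
- have -> : \int[Lam]_x (1 - expeR (- L x)) = \int[Lam]_x limn (fun k => 1 - expeR (- (f k x)%:E)).
    apply: eq_integral => x _; apply/esym/cvg_lim => //.
    apply: cvgeB; [|exact: cvg_cst|apply: cvg_expeRN => //].
    + by rewrite fin_num_adde_defr.
    + by move=> k; rewrite lee_fin.
  apply: cvg_monotone_convergence => //.
  + move=> k; apply: emeasurable_funB => //; apply: measurable_expeRN.
    by apply/measurable_EFinP; exact: (measurable_funP (f k)).
  + by move=> k x _; rewrite sube_ge0 ?expeRN_le1 ?lee_fin// expeRN_fin_num ?lee_fin.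
  + by move=> x _ k l kl; rewrite leeB// lee_expeR leeN2 ndf.
- move=> k; rewrite laplace_ppp_simple//.
  apply: le_lt_trans (finD k); apply: le_measure; rewrite ?inE//.
    rewrite (_ : [set x | _] = ~` (f k @^-1` [set 0%R])); last first.
      by apply/seteqP; split=> x /= /eqP.
    apply: measurableC; exact: measurable_funPTI.
  move=> x fx0; apply: contrapT => Dx; have := fx0 : f k x != 0%R.
  by rewrite fE indicE memNset// mulr0 eqxx.
Unshelve. all: by end_near. Qed.

End PoissonLaplace.

(** * Radial integration in the plane *)

Lemma ge0_integral_mrestr d (T : measurableType d) (R : realType)
    (mu : {measure set T -> \bar R}) (D : set T) (mD : measurable D) (f : T -> \bar R) :
    measurable_fun setT f -> (forall x, (0 <= f x)%E) ->
  (\int[mrestr mu mD]_x f x = \int[mu]_(x in D) f x)%E.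
Proof.
move=> mf f0.
rewrite (@ge0_negligible_integral _ _ _ (mrestr mu mD) setT (~` D))//.
- rewrite setTD setCK; apply: eq_measure_integral => A mA AD.
  by rewrite /mrestr; congr (mu _); exact: setIidl.
- exact: measurableC.
- by rewrite /= /mrestr setICl measure0.
Qed.

Section Radial.
Local Open Scope ereal_scope.
Context {R : realType}.
Local Notation leb := (@lebesgue_measure R).

Lemma lebesgue_measure_preimageM (c : R) (A : set R) : (0 < c)%R -> measurable A ->
  c%:E * leb [set x | A (c * x)%R] = leb A.
Proof.
move=> c0 mA.
have mc : measurable_fun setT (( *%R c) : measurableTypeR R -> measurableTypeR R).
  exact: mulrl_measurable.
pose f : {mfun (measurableTypeR R) >-> (measurableTypeR R)} :=
  HB.pack (( *%R c) : measurableTypeR R -> measurableTypeR R)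
    (isMeasurableFun.Build _ _ _ _ _ mc).
have := @lebesgue_measure_unique R (mscale (NngNum (ltW c0)) (pushforward leb f)).
move=> /(_ mc _ A mA) -> //= _ [[a b] _ <-].
rewrite /mscale/= /pushforward/=.
have -> : *%R c @^-1` `]a, b] = `](a / c)%R, (b / c)%R]%classic.
  apply/seteqP; split=> x /=; rewrite !in_itv/= ltr_pdivrMr// ler_pdivlMr// [(x * c)%R]mulrC; exact.
rewrite !lebesgue_measure_itv/= !lte_fin ltr_pM2r ?invr_gt0//.
case: ifPn => _; last by rewrite mule0.
by rewrite -!EFinB -EFinM; congr (_ %:E); field; rewrite gt_eqF.
Qed.

Lemma ge0_integral_lebesgueM (c : R) (f : R -> \bar R) : (0 < c)%R ->
  measurable_fun setT f -> (forall x, 0 <= f x) ->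
  c%:E * \int[leb]_x f (c * x)%R = \int[leb]_x f x.
Proof.
move=> c0 mf f0.
have mc : measurable_fun setT (( *%R c) : measurableTypeR R -> measurableTypeR R).
  exact: mulrl_measurable.
pose g : {mfun (measurableTypeR R) >-> (measurableTypeR R)} :=
  HB.pack (( *%R c) : measurableTypeR R -> measurableTypeR R)
    (isMeasurableFun.Build _ _ _ _ _ mc).
have := @ge0_integral_pushforward _ _ _ _ R _ mc leb setT f measurableT mf (fun y _ => f0 y).
rewrite preimage_setT => <-.
rewrite -(@ge0_integral_mscale _ _ _ (pushforward leb g) setT measurableT (NngNum (ltW c0)) f)//.
apply: eq_measure_integral => A mA _.
exact: (lebesgue_measure_preimageM c0 mA).
Qed.

Lemma leb2_preimageM (c : R) (A : set (pt R)) : (0 < c)%R -> measurable A ->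
  (c ^+ 2)%:E * leb2 (R := R) [set x | A (c * x.1, c * x.2)%R] = leb2 A.
Proof.
move=> c0 mA.
pose s (x : measurableTypeR R * measurableTypeR R) : measurableTypeR R * measurableTypeR R :=
  ((c * x.1)%R, (c * x.2)%R).
have ms : measurable_fun setT s.
  apply: measurable_fun_pair.
    exact: (measurableT_comp (@mulrl_measurable R _ c) measurable_fst).
  exact: (measurableT_comp (@mulrl_measurable R _ c) measurable_snd).
pose f : {mfun (measurableTypeR R * measurableTypeR R)%type >->
    (measurableTypeR R * measurableTypeR R)%type} :=
  HB.pack s (isMeasurableFun.Build _ _ _ _ _ ms).
have c20 : (0 <= c ^+ 2)%R by rewrite sqr_ge0.
have H := @product_measure_unique _ _ _ _ R leb leb
  (mscale (NngNum c20) (pushforward (leb \x leb) f)).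
symmetry; refine (H ms _ A mA) => B C mB mC.
rewrite /= /mscale/= /pushforward.
have -> : f @^-1` (B `*` C) = [set x | B (c * x)%R] `*` [set x | C (c * x)%R] by [].
have mpre (D : set R) : measurable D -> measurable [set x | D (c * x)%R].
  by move=> mD; rewrite -[X in measurable X]setTI; exact: (@mulrl_measurable R setT c measurableT D mD).
rewrite product_measure1E; [|exact: mpre..].
rewrite -(lebesgue_measure_preimageM c0 mB) -(lebesgue_measure_preimageM c0 mC).
by rewrite expr2 EFinM muleACA.
Qed.

Definition sqn (x : pt R) : R := (x.1 ^+ 2 + x.2 ^+ 2)%R.

Lemma sqn_ge0 x : (0 <= sqn x)%R.
Proof. by rewrite addr_ge0 ?sqr_ge0. Qed.

Lemma measurable_sqn : measurable_fun setT sqn.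
Proof.
by apply: measurable_funD; apply: measurable_funX; [exact: measurable_fst|exact: measurable_snd].
Qed.

Lemma measurable_sqn_set (B : set R) : measurable B -> measurable [set x | B (sqn x)].
Proof. by move=> mB; rewrite -[X in measurable X]setTI; exact: measurable_sqn. Qed.

Lemma leb2_sqn_le (r : R) : (0 < r)%R ->
  leb2 [set x | (sqn x <= r)%R] = r%:E * leb2 [set x | (sqn x <= 1)%R].
Proof.
move=> r0; have s0 : (0 < (Num.sqrt r)^-1)%R by rewrite invr_gt0 sqrtr_gt0.
have m1 : measurable [set x | (sqn x <= 1)%R].
  by have := measurable_sqn_set (@measurable_itv R `]-oo, 1%R]); rewrite set_itvE.
rewrite -(leb2_preimageM s0 m1) muleA -EFinM.
have -> : (r * (Num.sqrt r)^-1 ^+ 2 = 1)%R.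
  by rewrite exprVn sqr_sqrtr ?divff ?gt_eqF// ltW.
rewrite mul1e; congr (leb2 _); apply/seteqP; split=> x /=;
  by rewrite /sqn/= !exprMn -mulrDr exprVn sqr_sqrtr ?(ltW r0)// ler_pdivrMl ?mulr1.
Qed.

Lemma leb2_sqn1_lty : leb2 (R := R) [set x | (sqn x <= 1)%R] < +oo.
Proof.
have m1 : measurable [set x | (sqn x <= 1)%R].
  by have := measurable_sqn_set (@measurable_itv R `]-oo, 1%R]); rewrite set_itvE.
have mI : measurable (`[(-1)%R, 1%R]%classic : set R) by exact: measurable_itv.
apply: (@le_lt_trans _ _ (leb2 (`[(-1)%R, 1%R]%classic `*` `[(-1)%R, 1%R]%classic))).
  apply: le_measure; rewrite ?inE//; first exact: measurableX.
  move=> [x y] /=; rewrite /sqn/= !in_itv/= => xy1.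
  have sq1 (z : R) : (z ^+ 2 <= 1 -> -1 <= z <= 1)%R.
    move=> z1; rewrite -ler_norml -(@ler_pXn2r _ 2 isT) ?nnegrE//.
    by rewrite expr1n real_normK ?num_real.
  by split; apply: sq1; apply: le_trans xy1; rewrite (lerDl, lerDr) sqr_ge0.
rewrite /leb2 product_measure1E//= !lebesgue_measure_itv/= !lte_fin.
by case: ifPn => _; rewrite ?mule0 ?ltry// -EFinB -EFinM ltry.
Qed.

Lemma leb2_sqn_le0 : leb2 (R := R) [set x | (sqn x <= 0)%R] = 0.
Proof.
have -> : [set x | (sqn x <= 0)%R] = [set 0%R] `*` [set 0%R].
  apply/seteqP; split=> -[x y]; rewrite /sqn/=; last by move=> [-> ->]; rewrite expr0n addr0.
  move=> H.
  have : (x ^+ 2 + y ^+ 2 == 0)%R.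
    by rewrite eq_le H addr_ge0 ?sqr_ge0.
  by rewrite paddr_eq0 ?sqr_ge0// !sqrf_eq0 => /andP[/eqP -> /eqP ->].
have m0 : measurable ([set 0%R] : set R) by [].
by rewrite /leb2 product_measure1E//= lebesgue_measure_set1 mule0.
Qed.

(** Radial integration is first proved with the area of the unit disk as an unknown finite constant,
    which the radial formula itself then determines. *)
Let kappa := leb2 (R := R) [set x | (sqn x <= 1)%R].
Let kappa_fin : kappa \is a fin_num.
Proof. by rewrite ge0_fin_numE; [exact: leb2_sqn1_lty|exact: measure_ge0]. Qed.
Let kappa0 : (0 <= fine kappa)%R.
Proof. by apply: fine_ge0; exact: measure_ge0. Qed.

Let leb2_le (r : R) : leb2 [set x | (sqn x <= r)%R] = (Num.max 0 r * fine kappa)%:E.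
Proof.
have [r0|r0|->] := ltgtP r 0%R.
- have -> : [set x | (sqn x <= r)%R] = set0.
    apply/seteqP; split=> // x /= H.
    by have := le_trans (sqn_ge0 x) H; rewrite leNgt r0.
  by rewrite mul0r; exact: measure0.
- by rewrite leb2_sqn_le// EFinM fineK.
- by rewrite mul0r leb2_sqn_le0.
Qed.

Let mnneg : measurable (`[0%R, +oo[%classic : set R). Proof. exact: measurable_itv. Qed.

Let msqn : measurable_fun setT
  (sqn : measurableTypeR R * measurableTypeR R -> measurableTypeR R).
Proof. exact: measurable_sqn. Qed.

(** The area of a disk is proportional to its squared radius. Hence the image of the area under
    [sqn] and the multiple [kappa] of Lebesgue measure on the half-line agree on half-open
    intervals, and therefore everywhere; in this variable no Jacobian appears. *)
Let leb2_radial (A : set R) : measurable A ->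
  leb2 [set x | A (sqn x)] = kappa * leb (A `&` `[0%R, +oo[%classic).
Proof.
move=> mA.
pose f : {mfun (measurableTypeR R * measurableTypeR R)%type >-> (measurableTypeR R)} :=
  HB.pack (sqn : measurableTypeR R * measurableTypeR R -> measurableTypeR R)
    (isMeasurableFun.Build _ _ _ _ _ msqn).
have E : pushforward (leb \x leb) f A = mscale (NngNum kappa0) (mrestr leb mnneg) A.
  have mle r : measurable [set x | (sqn x <= r)%R].
    by have := measurable_sqn_set (@measurable_itv R `]-oo, r]); rewrite set_itvE.
  have ocE (a b : R) : (a <= b)%R -> pushforward (leb \x leb) f `]a, b]%classic =
      ((Num.max 0 b - Num.max 0 a) * fine kappa)%:E.
    move=> ab; rewrite /pushforward.
    have -> : f @^-1` `]a, b]%classic = [set x | (sqn x <= b)%R] `\` [set x | (sqn x <= a)%R].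
      apply/seteqP; split=> x /=; rewrite in_itv/=.
        by move=> /andP[xa xb]; split=> //; apply/negP; rewrite -ltNge.
      by move=> [xb /negP]; rewrite -ltNge => xa; rewrite xa xb.
    have leP r : (leb \x leb) [set x | (sqn x <= r)%R] = (Num.max 0 r * fine kappa)%:E.
      exact: leb2_le.
    rewrite measureD; [|exact: mle|exact: mle|]; last first.
      have := ltry (Num.max 0 b * fine kappa)%R; rewrite -(leP b); exact.
    rewrite (_ : _ `&` _ = [set x | (sqn x <= a)%R]); last first.
      apply/seteqP; split=> x //=; first by case.
      by move=> xa; split=> //; exact: le_trans ab.
    transitivity ((Num.max 0 b * fine kappa)%:E - (Num.max 0 a * fine kappa)%:E).
      by congr (_ - _); exact: leP.
    by rewrite -EFinB mulrBl.
  have H := @measure_unique _ R (measurableTypeR R) (@ocitv R)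
    (fun n => `](- n%:R)%R, n%:R]%classic) _ _ _ _ (pushforward (leb \x leb) f)
    (mscale (NngNum kappa0) (mrestr leb mnneg)).
  refine (H _ _ _ _ msqn _ _ A mA) => //.
  - exact: ocitvI.
  - by move=> n; exact: is_ocitv.
  - apply/seteqP; split=> // x _.
    have [n xn] : exists n : nat, (`|x| < n%:R)%R.
      by exists (Num.truncn `|x|).+1; exact: truncnS_gt.
    exists n => //=; rewrite in_itv/=; move: xn; rewrite ltr_norml => /andP[-> /ltW ->//].
  - move=> _ [[a b] _ <-] /=; have [ab|ba] := leP a b; last first.
      rewrite set_itv_ge ?measure0//.
      by rewrite bnd_simp -leNgt ltW.
    rewrite ocE// /mscale/= /mrestr.
    have [a0|a0] := leP 0%R a.
      have -> : `]a, b]%classic `&` `[0%R, +oo[%classic = `]a, b]%classic.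
        apply/seteqP; split=> x /=; rewrite !in_itv/= ?andbT; first by case.
        by move=> /andP[ax xb]; rewrite ax xb (le_trans a0)// ltW.
      rewrite lebesgue_measure_itv/= lte_fin (max_r (le_trans a0 ab)).
      case: ifPn => [_|]; first by rewrite -EFinB -EFinM mulrC.
      by rewrite -leNgt => ba; rewrite (@le_anti _ _ a b) ?ab ?ba// subrr mul0r mule0.
    have -> : `]a, b]%classic `&` `[0%R, +oo[%classic = `[0%R, b]%classic.
      apply/seteqP; split=> x /=; rewrite !in_itv/= ?andbT.
        by move=> [/andP[_ ->] ->].
      by move=> /andP[ax xb]; rewrite ax xb (lt_le_trans a0).
    rewrite lebesgue_measure_itv/= lte_fin subr0.
    have [b0|b0] := ltP b 0%R.
      by rewrite mul0r ifF ?mule0//; apply/negbTE; rewrite -leNgt ltW.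
    case: ifPn => [_|]; first by rewrite -EFinB subr0 -EFinM mulrC.
    by rewrite -leNgt => b0'; rewrite (@le_anti _ _ b 0%R) ?b0 ?b0'// mul0r mule0.
  - move=> n; have nn : (- n%:R <= n%:R :> R)%R by rewrite (@le_trans _ _ 0%R)// lerNl oppr0.
    by have := ltry ((Num.max 0 n%:R - Num.max 0 (- n%:R)) * fine kappa)%R; rewrite -ocE.
by move: E; rewrite /mscale/= fineK.
Qed.

Let ge0_integral_radial_kappa (f : R -> \bar R) : measurable_fun setT f -> (forall r, 0 <= f r) ->
  \int[leb2 (R := R)]_x f (sqn x) = kappa * \int[leb]_(v in `[0%R, +oo[%classic) f v.
Proof.
move=> mf f0.
have := @ge0_integral_pushforward _ _ _ _ R _ msqn (leb \x leb) setT f measurableT mf (fun y _ => f0 y).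
rewrite preimage_setT => <-.
transitivity (\int[mscale (NngNum kappa0) (mrestr leb mnneg)]_y f y).
  apply: eq_measure_integral => A mA _.
  rewrite -[RHS]/((fine kappa)%:E * mrestr leb mnneg A) fineK//; exact: leb2_radial.
rewrite ge0_integral_mscale// fineK//; congr (_ * _).
by rewrite ge0_integral_mrestr.
Qed.

(* The area of the unit disk is read off the Gaussian integral computed both in
   Cartesian and in radial coordinates. *)
Let kappaE : kappa = pi%:E.
Proof.
have mexp : measurable_fun setT (fun v : R => (expR (- v))%:E).
  apply/measurable_EFinP; apply: (measurableT_comp (@measurable_expR R)).
  exact: oppr_measurable.
have := ge0_integral_radial_kappa mexp (fun r => expR_ge0 (- r)).
have -> : \int[leb]_(v in `[0%R, +oo[%classic) (expR (- v))%:E = 1.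
  rewrite -[RHS](@integral_exponential_pdf R 1 ltr01) integral_mkcond.
  apply: eq_integral => v _; rewrite /exponential_pdf !patchE; case: ifP => // _.
  by rewrite mul1r mulN1r.
rewrite mule1 => <-.
pose g (x : pt R) := (gauss_fun x.1 * gauss_fun x.2)%:E.
have mg : measurable_fun setT g.
  apply/measurable_EFinP; apply: measurable_funM.
    exact: (measurableT_comp measurable_gauss_fun measurable_fst).
  exact: (measurableT_comp measurable_gauss_fun measurable_snd).
have g0 x : 0 <= g x by rewrite lee_fin mulr_ge0 ?gauss_fun_ge0.
transitivity (\int[leb \x leb]_x g x).
  by apply: eq_integral => x _; rewrite /g /gauss_fun -expRD /sqn opprD.
have mg' : measurable_fun (setT : set (measurableTypeR R * measurableTypeR R)) g := mg.
rewrite (fubini_tonelli1 (m1 := leb) (m2 := leb) g mg' g0) /fubini_F.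
have mG : measurable_fun setT (EFin \o @gauss_fun R) by apply/measurable_EFinP; exact: measurable_gauss_fun.
under eq_integral => x _.
  rewrite /g/=; under eq_integral do rewrite EFinM.
  rewrite ge0_integralZl ?lee_fin ?gauss_fun_ge0//; last by move=> y _; rewrite lee_fin gauss_fun_ge0.
  rewrite integralT_gauss.
  over.
rewrite ge0_integralZr ?lee_fin ?sqrtr_ge0//; try by move=> y _; rewrite lee_fin gauss_fun_ge0.
by rewrite integralT_gauss -EFinM -expr2 sqr_sqrtr// pi_ge0.
Qed.

Lemma ge0_integral_radial (f : R -> \bar R) : measurable_fun setT f -> (forall r, 0 <= f r) ->
  \int[leb2 (R := R)]_x f (sqn x) = pi%:E * \int[leb]_(v in `[0%R, +oo[%classic) f v.
Proof. by move=> mf f0; rewrite ge0_integral_radial_kappa// kappaE. Qed.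

Lemma leb2_disk (r : R) : (0 <= r)%R -> leb2 [set x | (sqn x <= r)%R] = (pi * r)%:E.
Proof. by move=> r0; rewrite leb2_le max_r// kappaE/= mulrC. Qed.

Lemma powR_eucl (x : pt R) (a : R) : powR (eucl x) a = powR (sqn x) (a / 2).
Proof. by rewrite /eucl -powR12_sqrt ?sqn_ge0// -powRrM mulrC. Qed.

(** In the squared radius [r], the substitution [r = c * u] with [c = v * powR T (2 / alpha)]
    absorbs both parameters: the denominator becomes [1 + powR u (alpha / 2)], the condition [v < r]
    becomes [powR T (- (2 / alpha)) < u], and the Jacobian [c] supplies [v] and the prefactor of
    [phi]. *)
Lemma integral_outer_phi (T alpha v : R) : (0 < T)%R -> (0 < alpha)%R -> (0 < v)%R ->
  \int[leb2 (R := R)]_(x in [set x | (v < sqn x)%R])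
    ((1 + T^-1 * powR (sqn x / v) (alpha / 2))^-1)%:E =
  (pi * v)%:E * phi T alpha.
Proof.
move=> T0 al0 v0.
have al20 : (0 < alpha / 2)%R by rewrite divr_gt0.
pose h (u : R) := ((1 + powR u (alpha / 2))^-1)%R.
pose c := (v * powR T (2 / alpha))%R.
have Tp0 : (0 < powR T (2 / alpha))%R by rewrite powR_gt0.
have c0 : (0 < c)%R by rewrite mulr_gt0.
have den0 u : (0 < 1 + powR u (alpha / 2) :> R)%R by rewrite ltr_pwDl ?powR_ge0.
have mh : measurable_fun setT h.
  rewrite (_ : h = (fun u => powR (1 + powR u (alpha / 2)) (-1)))%R; last first.
    by apply/funext => u; rewrite powR_inv1 ?ltW.
  apply: (measurableT_comp (@measurable_powR R (-1))).
  by apply: measurable_funD => //; exact: measurable_powR.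
have hE (r : R) : (0 <= r)%R -> ((1 + T^-1 * powR (r / v) (alpha / 2))^-1 = h (c^-1 * r))%R.
  move=> r0; rewrite /h /c; congr (_^-1)%R; congr (_ + _)%R.
  have -> : ((v * powR T (2 / alpha))^-1 * r = r / v * (powR T (2 / alpha))^-1)%R.
    by rewrite invfM -mulrA mulrC mulrA mulrAC.
  rewrite [RHS]powRM ?divr_ge0 ?invr_ge0 ?(ltW v0) ?(ltW Tp0)// mulrC; congr (_ * _)%R.
  rewrite -powRN -powRrM.
  have -> : (- (2 / alpha) * (alpha / 2) = -1)%R by field; rewrite gt_eqF.
  by rewrite powR_inv1 ?ltW.
pose F (r : R) := if (v < r)%R then (h (c^-1 * r))%:E else 0.
have mF : measurable_fun setT F.
  apply: measurable_fun_ifT => //; first exact: measurable_fun_ltr.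
  apply/measurable_EFinP; apply: (measurableT_comp mh).
  exact: mulrl_measurable.
have F0 r : 0 <= F r by rewrite /F; case: ifP => // _; rewrite lee_fin invr_ge0 ltW.
transitivity (\int[leb2 (R := R)]_x F (sqn x)).
  rewrite integral_mkcond; apply: eq_integral => x _; rewrite patchE /F.
  have -> : (x \in [set x | (v < sqn x)%R]) = (v < sqn x)%R by apply/idP/idP; rewrite inE.
  by case: ifP => // _; rewrite hE ?sqn_ge0.
rewrite ge0_integral_radial// EFinM -muleA; congr (_ * _).
transitivity (\int[leb]_r F r).
  rewrite integral_mkcond; apply: eq_integral => r _; rewrite patchE.
  case: ifPn => //; rewrite notin_setE/= in_itv/= andbT => /negP; rewrite -ltNge => r0.
  by rewrite /F ifF//; apply/negbTE; rewrite -leNgt ltW// (lt_trans r0).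
rewrite -(ge0_integral_lebesgueM c0 mF F0) /phi muleA -EFinM -/c; congr (_ * _).
rewrite -integral_itv_obnd_cbnd; last first.
  by apply/measurable_EFinP/measurable_funTS; exact: mh.
rewrite [RHS]integral_mkcond; apply: eq_integral => u _; rewrite patchE /F mulKf ?gt_eqF//.
have -> : (u \in `](powR T (- (2 / alpha))), +oo[%classic) = (v < c * u)%R.
  rewrite mem_setE in_itv/= andbT powRN /c -mulrA -[X in (X < _ * _)%R]mulr1 ltr_pM2l//.
  by rewrite -[X in (X < _)%R]mulr1 ltr_pdivrMl.
by case: ifP.
Qed.

End Radial.

(** * Femtocell interference *)

Section PlaneMeasure.
Local Open Scope ereal_scope.
Context {R : realType}.

(* [leb2] is a measure for the sigma-algebra with the display of the
   Caratheodory construction; [leb2p] is the same function on [pt R]. *)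
Definition leb2p : set (pt R) -> \bar R := @leb2 R.

Let leb2p0 : leb2p set0 = 0. Proof. exact: measure0. Qed.
Let leb2p_ge0 A : 0 <= leb2p A. Proof. exact: measure_ge0. Qed.
Let leb2p_sigma_additive : semi_sigma_additive leb2p.
Proof.
exact: (@measure_semi_sigma_additive _ _ _ (@lebesgue_measure R \x @lebesgue_measure R)).
Qed.
HB.instance Definition _ := isMeasure.Build _ (pt R) R leb2p
  leb2p0 leb2p_ge0 leb2p_sigma_additive.

Lemma ge0_integral_leb2p (D : set (pt R)) (f : pt R -> \bar R) : measurable D ->
  measurable_fun setT f -> (forall x, 0 <= f x) ->
  \int[leb2p]_(x in D) f x = \int[@leb2 R]_(x in D) f x.
Proof.
move=> mD mf f0.
have mid : measurable_fun setT (idfun : measurableTypeR R * measurableTypeR R -> pt R).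
  by move=> _ B mB; rewrite setTI.
have mfD : measurable_fun D f by exact: measurable_funTS.
have := @ge0_integral_pushforward _ _ _ _ R _ mid
  (@lebesgue_measure R \x @lebesgue_measure R) D f mD mfD (fun x _ => f0 x).
exact.
Qed.

Lemma measurable_addp d (T : measurableType d) (f g : T -> pt R) :
  measurable_fun setT f -> measurable_fun setT g ->
  measurable_fun setT (fun t => addp (f t) (g t)).
Proof.
move=> mf mg; apply: measurable_fun_pair; apply: measurable_funD.
- exact: (measurableT_comp measurable_fst mf).
- exact: (measurableT_comp measurable_fst mg).
- exact: (measurableT_comp measurable_snd mf).
- exact: (measurableT_comp measurable_snd mg).
Qed.

Lemma measurable_powR_eucl d (T : measurableType d) (f : T -> pt R) p :
  measurable_fun setT f -> measurable_fun setT (fun t => powR (eucl (f t)) p).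
Proof.
move=> mf; under eq_fun do rewrite powR_eucl.
apply: (measurableT_comp (@measurable_powR R (p / 2))).
exact: (measurableT_comp measurable_sqn mf).
Qed.

Lemma disk_sqn (r : R) : (0 <= r)%R -> disk r = [set x | (sqn x <= r ^+ 2)%R].
Proof.
move=> r0; apply/seteqP; split=> x; rewrite /disk/= /eucl -/(sqn x) => H.
  by rewrite -(sqr_sqrtr (sqn_ge0 x)) ler_pXn2r ?nnegrE ?sqrtr_ge0.
by rewrite -(@ler_pXn2r _ 2 isT) ?nnegrE ?sqrtr_ge0// sqr_sqrtr ?sqn_ge0.
Qed.

Lemma measurable_sqn_le (r : R) : measurable [set x : pt R | (sqn x <= r)%R].
Proof. by have := measurable_sqn_set (@measurable_itv R `]-oo, r]); rewrite set_itvE. Qed.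

Lemma measurable_disk (r : R) : (0 <= r)%R -> measurable (disk r).
Proof. by move=> r0; rewrite disk_sqn//; exact: measurable_sqn_le. Qed.

Lemma leb2_disk_lty (r : R) : (0 <= r)%R -> leb2 (disk r) < +oo.
Proof. by move=> r0; rewrite disk_sqn// leb2_disk ?sqr_ge0// ltry. Qed.

Lemma leb2_set1 (x : pt R) : leb2 [set x] = 0.
Proof.
have -> : [set x] = [set x.1] `*` [set x.2].
  by apply/seteqP; split=> -[a b]; [move=> ->|move=> [/= -> ->]; rewrite -surjective_pairing].
have m0 (r : R) : measurable ([set r] : set R) by [].
by rewrite /leb2 product_measure1E//= lebesgue_measure_set1 mul0e.
Qed.

Lemma one_sub_expeRN_ge0 (a : \bar R) : 0 <= a -> 0 <= 1 - expeR (- a).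
Proof. by move=> a0; rewrite sube_ge0 ?expeRN_le1// expeRN_fin_num. Qed.

Lemma measurable_one_sub_expeRN d (T : measurableType d) (f : T -> \bar R) :
  measurable_fun setT f -> measurable_fun setT (fun x => 1 - expeR (- f x)).
Proof. by move=> mf; apply: emeasurable_funB => //; exact: measurable_expeRN. Qed.

Context {d : measure_display} {Ω : measurableType d}.
Variable P : probability Ω R.

Lemma laplace_hppp (X : nat -> Ω -> pt R) (lam : R) (L : pt R -> \bar R) :
  (0 <= lam)%R -> is_hPPP P X lam -> measurable_fun setT L -> (forall x, 0 <= L x) ->
  \int[P]_w expeR (- \sum_(n <oo) L (X n w)) =
  expeR (- (lam%:E * \int[@leb2 R]_x (1 - expeR (- L x)))).
Proof.
move=> lam0 HX mL L0.
pose D n := [set x : pt R | (sqn x <= n%:R)%R].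
have mD n : measurable (D n) by exact: measurable_sqn_le.
have ndD : nondecreasing_seq D.
  by move=> m n mn; apply/subsetPset => x /= /le_trans; apply; rewrite ler_nat.
have covD : \bigcup_n D n = setT.
  apply/seteqP; split=> // x _; exists (Num.truncn (sqn x)).+1 => //=.
  by apply: ltW; exact: truncnS_gt.
have := @laplace_ppp R d Ω P (fun _ _ => true) X (mscale (NngNum lam0) leb2p) HX D mD ndD covD.
move=> /(_ _ L mL L0) ->.
  congr (expeR (- _)); rewrite ge0_integral_mscale//; last 2 first.
  - exact: measurable_one_sub_expeRN.
  - by move=> x _; exact: one_sub_expeRN_ge0.
  rewrite ge0_integral_leb2p//; first exact: measurable_one_sub_expeRN.
  by move=> x; exact: one_sub_expeRN_ge0.
move=> n; change (lam%:E * leb2 (D n) < +oo).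
by rewrite /D leb2_disk ?ler0n// -EFinM ltry.
Qed.

Lemma laplace_cluster (A : nat -> Ω -> bool) (X : nat -> Ω -> pt R) (lc Rc : R)
    (L : pt R -> \bar R) :
  (0 <= lc)%R -> (0 <= Rc)%R ->
  is_PPP P A X (fun B => lc%:E * @leb2 R (B `&` disk Rc)) ->
  measurable_fun setT L -> (forall x, 0 <= L x) ->
  \int[P]_w expeR (- \sum_(n <oo) (if A n w then L (X n w) else 0)) =
  expeR (- (lc%:E * \int[@leb2 R]_(x in disk Rc) (1 - expeR (- L x)))).
Proof.
move=> lc0 Rc0 HX mL L0.
have mdk := measurable_disk Rc0.
(* A cluster has finite mean measure, so the whole plane serves as a constant exhaustion. *)
have := @laplace_ppp R d Ω P A X (mscale (NngNum lc0) (mrestr leb2p mdk)) HX (fun=> setT).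
have ndT : nondecreasing_seq (fun _ : nat => [set: pt R]) by move=> ? ? _.
have covT : \bigcup_(_ : nat) [set: pt R] = setT by apply: bigcup_const; exists 0%N.
move=> /(_ (fun=> measurableT) ndT covT _ L mL L0) ->.
- congr (expeR (- _)); rewrite ge0_integral_mscale//; last 2 first.
  + exact: measurable_one_sub_expeRN.
  + by move=> x _; exact: one_sub_expeRN_ge0.
  have mL' := measurable_one_sub_expeRN mL.
  have L0' x := one_sub_expeRN_ge0 (L0 x).
  by rewrite ge0_integral_mrestr// ge0_integral_leb2p.
- move=> n; apply: (@le_lt_trans _ _ (lc%:E * leb2 (disk Rc))).
    by rewrite -[in leRHS](setTI (disk Rc)).
  by apply: lte_mul_pinfty; rewrite ?lee_fin//; exact: leb2_disk_lty.
Qed.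

End PlaneMeasure.

Section Femto.
Local Open Scope ereal_scope.
Context {R : realType} {d : measure_display} {Ω : measurableType d}.
Variable P : probability Ω R.
Context {K : choiceType}.
Variable F : K -> set (set Ω).
Hypothesis piF : forall k, pi_events (F k).
Hypothesis indF : mutually_independent P F.
Variables (Y : nat -> Ω -> pt R) (M : nat -> nat -> Ω -> bool).
Variables (U : nat -> nat -> Ω -> pt R) (gf : nat * nat -> Ω -> R).
Variables (iY iM ig : K).
Hypothesis FY : F iY = gen_events Y.
Hypothesis FM : F iM = gen_events (fun kj w => (M kj.1 kj.2 w, U kj.1 kj.2 w)).
Hypothesis Fg : F ig = gen_events gf.
Hypothesis YM : iY != iM.
Hypothesis Yg : iY != ig.
Hypothesis Mg : iM != ig.
Variables (alpha mu lp lc Rc : R).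
Hypotheses (mu0 : (0 < mu)%R) (lp0 : (0 < lp)%R).
Hypotheses (lc0 : (0 <= lc)%R) (Rc0 : (0 < Rc)%R).
Hypothesis HY : is_hPPP P Y lp.
Hypothesis HU : forall k, is_PPP P (M k) (U k) (fun B => lc%:E * @leb2 R (B `&` disk Rc)).
Hypothesis Hgf : forall kj, exp_rv P mu (gf kj).
Hypothesis indM : mutually_independent P
      (fun k => gen_events (fun j w => (M k j w, U k j w))).
Hypothesis indg : indep_rvs P gf.

Let mjoinY (S : set K) k : S iY ->
  measurable_fun setT (Y k : g_sigma_algebraType (join_events F S) -> pt R).
Proof.
by move=> Si; apply: (join_measurable piF Si); rewrite FY; exact: measurable_gen_events.
Qed.

Let mjoinMU (S : set K) k j : S iM ->
  measurable_fun setT ((fun w => (M k j w, U k j w)) :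
    g_sigma_algebraType (join_events F S) -> bool * pt R).
Proof.
move=> Si; apply: (join_measurable piF Si); rewrite FM.
exact: (@measurable_gen_events _ _ _ _ _ (fun kj w => (M kj.1 kj.2 w, U kj.1 kj.2 w)) (k, j)).
Qed.

Let mjoinM (S : set K) k j : S iM ->
  measurable_fun setT (M k j : g_sigma_algebraType (join_events F S) -> bool).
Proof. by move=> Si; exact: (measurableT_comp measurable_fst (mjoinMU k j Si)). Qed.

Let mjoinU (S : set K) k j : S iM ->
  measurable_fun setT (U k j : g_sigma_algebraType (join_events F S) -> pt R).
Proof. by move=> Si; exact: (measurableT_comp measurable_snd (mjoinMU k j Si)). Qed.

Let mjoing (S : set K) kj : S ig ->
  measurable_fun setT (gf kj : g_sigma_algebraType (join_events F S) -> R).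
Proof.
by move=> Si; apply: (join_measurable piF Si); rewrite Fg; exact: measurable_gen_events.
Qed.

(** Stated on an arbitrary measurable space, so that it covers products of sub-sigma-algebras in
    which positions and marks are read from different coordinates. *)
Lemma measurable_shot_noise d' (T : measurableType d') (Y' : nat -> T -> pt R)
    (M' : nat -> nat -> T -> bool) (U' : nat -> nat -> T -> pt R)
    (g' : nat * nat -> T -> R) (c : R) : (0 <= c)%R ->
  (forall k, measurable_fun setT (Y' k)) ->
  (forall k j, measurable_fun setT (M' k j)) ->
  (forall k j, measurable_fun setT (U' k j)) ->
  (forall kj, measurable_fun setT (g' kj)) ->
  measurable_fun setT (fun w => \sum_(0 <= k <oo) \sum_(0 <= j <oo)
    (if M' k j w then
      (mu * (c * powR (eucl (addp (Y' k w) (U' k j w))) (- alpha)) * Num.max 0 (g' (k, j) w))%:E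
    else 0)).
Proof.
move=> c0 mY mM mU mg.
have t0 k j w : 0 <= (if M' k j w then
    (mu * (c * powR (eucl (addp (Y' k w) (U' k j w))) (- alpha)) * Num.max 0 (g' (k, j) w))%:E
    else 0).
  case: ifP => // _; rewrite lee_fin !mulr_ge0 ?powR_ge0 ?(ltW mu0)//.
  by rewrite le_max lexx.
apply: measurable_nneseries => [k w|k]; first exact: nneseries_ge0.
apply: measurable_nneseries => [j w|j]; first exact: t0.
apply: measurable_fun_ifT => //; apply/measurable_EFinP.
apply: measurable_funM; last by apply: measurable_maxr => //; exact: mg.
apply: measurable_funM => //; apply: measurable_funM => //.
apply: measurable_powR_eucl; exact: measurable_addp.
Qed.

Variable c : R.
Hypothesis c0 : (0 < c)%R.

Let pl (z : pt R) := powR (eucl z) (- alpha).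
Let pl0 z : (0 <= pl z)%R. Proof. exact: powR_ge0. Qed.
(** Three sample points for three independent copies: parents, clusters, fading. *)
Let term k j (w1 w2 w3 : Ω) : \bar R := if M k j w2 then
  (mu * (c * pl (addp (Y k w1) (U k j w2))) * Num.max 0 (gf (k, j) w3))%:E else 0.
Let term0 k j w1 w2 w3 : 0 <= term k j w1 w2 w3.
Proof.
rewrite /term; case: ifP => // _; rewrite lee_fin !mulr_ge0 ?(ltW mu0) ?(ltW c0)//.
by rewrite le_max lexx.
Qed.
(** The exponent that an access point leaves once its fading has been integrated out. *)
Let L (y u : pt R) := (ln (1 + c * pl (addp y u)))%:E.
Let L0 y u : 0 <= L y u.
Proof. by rewrite lee_fin ln_ge0// lerDl mulr_ge0 ?(ltW c0). Qed.
Let mL y : measurable_fun setT (L y).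
Proof.
apply/measurable_EFinP; apply: (measurableT_comp (@measurable_ln R)).
apply: measurable_funD => //; apply: measurable_funM => //.
by apply: measurable_powR_eucl; apply: measurable_addp.
Qed.
Let disk_int (x : pt R) : \bar R := lc%:E * \int[@leb2 R]_(y in disk Rc)
  ((1 + c^-1 * powR (eucl (addp x y)) alpha)^-1)%:E.
Let integrand0 (x y : pt R) : (0 <= (1 + c^-1 * powR (eucl (addp x y)) alpha)^-1)%R.
Proof. by rewrite invr_ge0 addr_ge0// mulr_ge0 ?powR_ge0// invr_ge0 ltW. Qed.
Let disk_int0 x : 0 <= disk_int x.
Proof. by rewrite mule_ge0 ?lee_fin// integral_ge0// => y _; rewrite lee_fin. Qed.

Lemma measurable_path_gain d' (T : measurableType d') (f g : T -> pt R) :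
  measurable_fun setT f -> measurable_fun setT g ->
  measurable_fun setT (fun t => ((1 + c^-1 * powR (eucl (addp (f t) (g t))) alpha)^-1)%:E).
Proof.
move=> mf mg; apply/measurable_EFinP.
rewrite (_ : (fun _ => _) = (fun t =>
  powR (1 + c^-1 * powR (eucl (addp (f t) (g t))) alpha) (-1)))%R; last first.
  apply/funext => t; rewrite powR_inv1// addr_ge0// mulr_ge0 ?powR_ge0//.
  by rewrite invr_ge0 ltW.
apply: (measurableT_comp (@measurable_powR R (-1))).
apply: measurable_funD => //; apply: measurable_funM => //.
by apply: measurable_powR_eucl; exact: measurable_addp.
Qed.

(** The origin has to be excluded: for nonzero [alpha], both [powR 0 alpha] and its inverse are 0 by
    convention, so there the left side is 0 and the right side is 1. *)
Let one_subL (y u : pt R) : addp y u != (0%R, 0%R) ->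
  1 - expeR (- L y u) = ((1 + c^-1 * powR (eucl (addp y u)) alpha)^-1)%:E.
Proof.
move=> yu0; rewrite /L /pl powRN.
have e0 : (0 < powR (eucl (addp y u)) alpha)%R.
  rewrite powR_gt0// sqrtr_gt0 lt_neqAle sqn_ge0 andbT eq_sym.
  apply: contra yu0; rewrite paddr_eq0 ?sqr_ge0// !sqrf_eq0 => /andP[/eqP a0 /eqP b0].
  by rewrite [addp y u]surjective_pairing a0 b0.
set e := powR _ _ in e0 *.
have ce0 : (0 < 1 + c * e^-1)%R by rewrite addr_gt0// mulr_gt0 ?invr_gt0.
rewrite /= expRN lnK ?posrE// -EFinB; congr (_ %:E); field.
by rewrite !gt_eqF ?addr_gt0.
Qed.

Let cluster_laplace (y : pt R) k :
  \int[P]_w expeR (- \sum_(0 <= j <oo) (if M k j w then L y (U k j w) else 0)) =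
  expeR (- disk_int y).
Proof.
rewrite (@laplace_cluster R d Ω P (M k) (U k) lc Rc (L y))//; last exact: ltW.
congr (expeR (- (_ * _))).
have mdk := measurable_disk (ltW Rc0).
(* The single displacement that puts the access point on the user; it has area 0, so the two
   integrands agree almost everywhere. *)
pose N : set (pt R) := [set (- y.1, - y.2)%R].
have mN : measurable N.
  have -> : N = [set (- y.1)%R] `*` [set (- y.2)%R].
    by apply/seteqP; split=> -[a b]; [move=> [-> ->]|move=> [/= -> ->]].
  by apply: measurableX.
have mf1 := measurable_one_sub_expeRN (@mL y).
have mf2 : measurable_fun setT
    (fun u : pt R => ((1 + c^-1 * powR (eucl (addp y u)) alpha)^-1)%:E).
  by apply: measurable_path_gain.
rewrite -!ge0_integral_leb2p//; last 2 first.
- by move=> u; rewrite lee_fin.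
- by move=> u; exact: one_sub_expeRN_ge0.
apply: ge0_ae_eq_integral => //.
- exact: measurable_funTS.
- exact: measurable_funTS.
- by move=> u _; exact: one_sub_expeRN_ge0.
- by move=> u _; rewrite lee_fin.
exists N; split=> //; first exact: leb2_set1.
move=> u /= H; apply: contrapT => uN; apply: H => _.
apply: one_subL; apply/eqP => -[a0 b0]; apply: uN; rewrite /N/=.
rewrite [u]surjective_pairing; congr pair.
  by apply/eqP; rewrite -addr_eq0 addrC a0.
by apply/eqP; rewrite -addr_eq0 addrC b0.
Qed.

Lemma measurable_disk_int : measurable_fun setT disk_int.
Proof.
apply: measurable_funeM.
have mdk := measurable_disk (ltW Rc0).
pose f (p : pt R * (measurableTypeR R * measurableTypeR R)) : \bar R :=
  if p.2 \in disk Rc then ((1 + c^-1 * powR (eucl (addp p.1 p.2)) alpha)^-1)%:E else 0.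
have f0 p : 0 <= f p by rewrite /f; case: ifP => // _; rewrite lee_fin.
have mf : measurable_fun setT f.
  have mid : measurable_fun setT (idfun : measurableTypeR R * measurableTypeR R -> pt R).
    by move=> _ B mB; rewrite setTI.
  have m2 : measurable_fun setT
      (fun p : pt R * (measurableTypeR R * measurableTypeR R) => (p.2 : pt R)).
    exact: (measurableT_comp mid measurable_snd).
  apply: measurable_fun_ifT => //.
    apply: (measurable_fun_bool true); rewrite setTI.
    rewrite (_ : _ @^-1` _ = (fun p : pt R * (measurableTypeR R * measurableTypeR R) =>
      (p.2 : pt R)) @^-1` disk Rc); last first.
      by apply/seteqP; split=> p /=; [move/set_mem|move/mem_set].
    by rewrite -[X in measurable X]setTI; exact: m2.
  by apply: measurable_path_gain => //; exact: measurable_fst.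
(* The planar integral is unfolded into two linear ones, and Tonelli measurability is used once for
   each coordinate. *)
pose h (p : (pt R * measurableTypeR R) * measurableTypeR R) := f (p.1.1, (p.1.2, p.2)).
have mh : measurable_fun setT h.
  apply: (measurableT_comp mf); apply: measurable_fun_pair.
    exact: (measurableT_comp measurable_fst measurable_fst).
  apply: measurable_fun_pair; last exact: measurable_snd.
  exact: (measurableT_comp measurable_snd measurable_fst).
have h0 p : 0 <= h p by exact: f0.
have mF := measurable_fun_fubini_tonelli_F (m2 := @lebesgue_measure R) h mh h0.
have F0 p : 0 <= fubini_F (@lebesgue_measure R) h p by apply: integral_ge0.
have := measurable_fun_fubini_tonelli_F (m2 := @lebesgue_measure R) _ mF F0.
apply: eq_measurable_fun => x _.
rewrite [RHS]integral_mkcond.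
have mfx := measurable_fun_pair2 x mf.
have := fubini_tonelli1 (m1 := @lebesgue_measure R) (m2 := @lebesgue_measure R)
  (fun y => f (x, y)) mfx (fun y => f0 (x, y)).
rewrite /fubini_F /h/= => <-.
by apply: eq_integral => y _; rewrite patchE.
Qed.

(** Parents are frozen first, then clusters, and the integrations run outwards: fading turns each
    term into [L], independent clusters turn each parent into [disk_int], and the Laplace functional
    of the parent process at [disk_int] yields [eta]. *)
Lemma laplace_femto :
  \int[P]_w expeR (- \sum_(0 <= k <oo) \sum_(0 <= j <oo)
    (if M k j w then
      (mu * (c * powR (eucl (addp (Y k w) (U k j w))) (- alpha)) * Num.max 0 (gf (k, j) w))%:E
    else 0)) =
  expeR (- (lp%:E * \int[@leb2 R]_x (1 - Defs.eta lc Rc alpha c x))).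
Proof.
have eSS w1 w2 w3 : 0 <= \sum_(0 <= k <oo) \sum_(0 <= j <oo) term k j w1 w2 w3.
  by apply: nneseries_ge0 => k _ _; exact: nneseries_ge0.
pose S2 : set K := [set k | k = iM \/ k = ig].
rewrite (@join_decoupling _ _ _ P K F piF indF [set iY] S2
  (fun w1 w2 => expeR (- \sum_(0 <= k <oo) \sum_(0 <= j <oo) term k j w1 w2 w2))).
4: by move=> *; exact: expeR_ge0.
2: { by rewrite -subset0 => k [/= -> [/eqP|/eqP]]; [rewrite (negbTE YM)|rewrite (negbTE Yg)]. }
2: { apply: measurable_expeRN; refine (@measurable_shot_noise _
    (g_sigma_algebraType (join_events F [set iY]) * g_sigma_algebraType (join_events F S2))%type
    (fun k p => Y k p.1) (fun k j p => M k j p.2) (fun k j p => U k j p.2)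
    (fun kj p => gf kj p.2) c (ltW c0) _ _ _ _).
  - by move=> k; exact: (measurableT_comp (mjoinY k (erefl : [set iY] iY)) measurable_fst).
  - by move=> k j; exact: (measurableT_comp (mjoinM k j (or_introl erefl : S2 iM)) measurable_snd).
  - by move=> k j; exact: (measurableT_comp (mjoinU k j (or_introl erefl : S2 iM)) measurable_snd).
  - by move=> kj; exact: (measurableT_comp (mjoing kj (or_intror erefl : S2 ig)) measurable_snd). }
transitivity (\int[P]_w1 expeR (- \sum_(k <oo) disk_int (Y k w1))); last first.
  by rewrite (laplace_hppp (ltW lp0) HY measurable_disk_int).
apply: eq_integral => w1 _.
rewrite (@join_decoupling _ _ _ P K F piF indF [set iM] [set ig]
  (fun w2 w3 => expeR (- \sum_(0 <= k <oo) \sum_(0 <= j <oo) term k j w1 w2 w3))).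
4: by move=> *; exact: expeR_ge0.
2: { by rewrite -subset0 => k [/= -> /eqP]; rewrite (negbTE Mg). }
2: { apply: measurable_expeRN; refine (@measurable_shot_noise _
    (g_sigma_algebraType (join_events F [set iM]) * g_sigma_algebraType (join_events F [set ig]))%type
    (fun k _ => Y k w1) (fun k j p => M k j p.1) (fun k j p => U k j p.1)
    (fun kj p => gf kj p.2) c (ltW c0) _ _ _ _).
  - by [].
  - by move=> k j; exact: (measurableT_comp (mjoinM k j (erefl : [set iM] iM)) measurable_fst).
  - by move=> k j; exact: (measurableT_comp (mjoinU k j (erefl : [set iM] iM)) measurable_fst).
  - by move=> kj; exact: (measurableT_comp (mjoing kj (erefl : [set ig] ig)) measurable_snd). }
transitivity (\int[P]_w2 expeR (- \sum_(0 <= k <oo) \sum_(0 <= j <oo)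
   (if M k j w2 then L (Y k w1) (U k j w2) else 0))).
  apply: eq_integral => w2 _.
  have mgf kj : measurable_fun setT (gf kj) by have [] := Hgf kj.
  apply: (@laplace_indep_series2 _ _ _ P (fun kj => events_of (gf kj))).
  - by move=> kj; exact: pi_events_of.
  - exact: indg.
  - move=> k j; rewrite /term; case: (M k j w2) => //.
    have mf : measurable_fun setT (fun y : R =>
        (mu * (c * pl (addp (Y k w1) (U k j w2))) * Num.max 0 y)%:E).
      by apply/measurable_EFinP; apply: measurable_funM => //; apply: measurable_maxr.
    exact: (@measurable_events_of _ _ _ _ (gf (k, j)) _ _ _ mf).
  - by move=> k j w; exact: term0.
  - by move=> k j; case: ifP.
  - move=> k j; rewrite /term; case: (M k j w2).
      by rewrite laplace_exp_rv// mulr_ge0 ?(ltW c0).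
    by rewrite oppe0 expeR0 integral_cst// mul1e; exact: probability_setT.
have mMU k j : measurable_fun setT (fun w => (M k j w, U k j w)).
  by have [mM mU _ _] := HU k; exact: measurable_fun_pair.
apply: (@laplace_indep_series _ _ _ P (fun k => gen_events (fun j w => (M k j w, U k j w)))).
- by move=> k; apply: pi_gen_events => j.
- exact: indM.
- move=> k; apply: measurable_nneseries => [j w|j]; first by case: ifP.
  have mMUj := @measurable_gen_events _ _ _ _ _ (fun j w => (M k j w, U k j w)) j.
  apply: measurable_fun_ifT => //.
    exact: (measurableT_comp measurable_fst mMUj).
  exact: (measurableT_comp (@mL (Y k w1)) (measurableT_comp measurable_snd mMUj)).
- by move=> k w; apply: nneseries_ge0 => j _ _; case: ifP.
- by [].
- by move=> k; exact: cluster_laplace.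
Qed.

End Femto.

(** * Macrocell interference and the nearest point *)

Section Macro.
Local Open Scope ereal_scope.
Context {R : realType} {d : measure_display} {Ω : measurableType d}.
Variable P : probability Ω R.
Context {K : choiceType}.
Variable F : K -> set (set Ω).
Hypothesis piF : forall k, pi_events (F k).
Hypothesis indF : mutually_independent P F.
Variables (busy : nat -> Ω -> bool) (gm : nat -> Ω -> R) (iB ig : K).
Hypothesis FB : F iB = gen_events busy.
Hypothesis Fg : F ig = gen_events gm.
Hypothesis Bg : iB != ig.
Variables (mu p : R).
Hypotheses (mu0 : (0 < mu)%R) (p01 : (0 < p <= 1)%R).
Hypothesis Hbusy : forall n, measurable_fun setT (busy n) /\ P [set w | busy n w] = p%:E.
Hypothesis Hgm : forall n, exp_rv P mu (gm n).
Hypothesis indB : indep_rvs P busy.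
Hypothesis indg : indep_rvs P gm.

(** With positions frozen in [c], a station contributes the factor [(1 + c n)^-1] with probability
    [p] and 1 otherwise; the summand on the right is minus the logarithm of the mean factor, which
    is positive since [p <= 1]. The index starts at 1 because station 0 is the serving one. *)
Lemma laplace_macro (c : nat -> R) : (forall n, 0 <= c n)%R ->
  \int[P]_w expeR (- \sum_(1 <= n <oo)
    (if busy n w then (mu * c n * Num.max 0 (gm n w))%:E else 0)) =
  expeR (- \sum_(1 <= n <oo) (- ln (1 - p * (1 - (1 + c n)^-1)))%:E).
Proof.
move=> c0.
have /andP[p0 p1] := p01.
have t0 n b g : 0 <= (if b then (mu * c n * Num.max 0 g)%:E else 0) :> \bar R.
  by case: b => //; rewrite lee_fin !mulr_ge0 ?(ltW mu0)// le_max lexx.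
have l0 n : (0 <= ln (1 + c n))%R by rewrite ln_ge0// lerDl.
have c1 n : (0 < 1 + c n)%R by rewrite ltr_pwDl.
have ci1 n : (0 < (1 + c n)^-1 <= 1)%R by rewrite invr_gt0 c1/= invf_le1 ?c1// lerDl c0.
have q01 n : (0 < 1 - p * (1 - (1 + c n)^-1) <= 1)%R.
  have /andP[i0 i1] := ci1 n; apply/andP; split; last first.
    by rewrite gerBl mulr_ge0 ?subr_ge0// ltW.
  rewrite subr_gt0; apply: (@le_lt_trans _ _ (1 - (1 + c n)^-1)%R); last by rewrite ltrBlDr ltrDl.
  by rewrite ler_piMl// subr_ge0.
rewrite (@join_decoupling _ _ _ P K F piF indF [set iB] [set ig]
  (fun w1 w2 => expeR (- \sum_(1 <= n <oo)
    (if busy n w1 then (mu * c n * Num.max 0 (gm n w2))%:E else 0)))).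
4: by move=> *; exact: expeR_ge0.
2: { by rewrite -subset0 => k [/= -> /eqP]; rewrite (negbTE Bg). }
2: { apply: measurable_expeRN; apply: measurable_nneseries => [n w|n]; first exact: t0.
  apply: measurable_fun_ifT => //.
    have mb : measurable_fun setT
        (busy n : g_sigma_algebraType (join_events F [set iB]) -> bool).
      by apply: (@join_measurable _ _ _ F piF iB) => //; rewrite FB; exact: measurable_gen_events.
    exact: (measurableT_comp mb measurable_fst).
  have mg : measurable_fun setT
      (gm n : g_sigma_algebraType (join_events F [set ig]) -> R).
    by apply: (@join_measurable _ _ _ F piF ig) => //; rewrite Fg; exact: measurable_gen_events.
  apply/measurable_EFinP; apply: measurable_funM => //; apply: measurable_maxr => //.
  exact: (measurableT_comp mg measurable_snd). }
transitivity (\int[P]_w1 expeR (- \sum_(1 <= n <oo) (if busy n w1 then (ln (1 + c n))%:E else 0))).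
  apply: eq_integral => w1 _.
  apply: (@laplace_indep_series _ _ _ P (fun n => events_of (gm n))).
  - by move=> n; have [mg _] := Hgm n; exact: pi_events_of.
  - exact: indg.
  - move=> n; case: (busy n w1) => //.
    have mf : measurable_fun setT (fun y : R => (mu * c n * Num.max 0 y)%:E).
      by apply/measurable_EFinP; apply: measurable_funM => //; apply: measurable_maxr.
    exact: (@measurable_events_of _ _ _ _ (gm n) _ _ _ mf).
  - by move=> n w; exact: t0.
  - by move=> n; case: (busy n w1); rewrite ?lee_fin.
  - move=> n; case: (busy n w1); first by rewrite laplace_exp_rv.
    by rewrite oppe0 expeR0 integral_cst// mul1e; exact: probability_setT.
apply: (@laplace_indep_series _ _ _ P (fun n => events_of (busy n))).
- by move=> n; have [mb _] := Hbusy n; exact: pi_events_of.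
- exact: indB.
- move=> n.
  have mf : measurable_fun setT (fun y : bool => if y then (ln (1 + c n))%:E else 0 : \bar R).
    by move=> _ B _; rewrite setTI.
  exact: (@measurable_events_of _ _ _ _ (busy n) _ _ _ mf).
- by move=> n w; case: (busy n w); rewrite ?lee_fin.
- by move=> n; have /andP[_ q1] := q01 n; rewrite lee_fin oppr_ge0 ln_le0.
- move=> n; have [mb Pb] := Hbusy n; have /andP[q0 _] := q01 n.
  by rewrite (laplace_bernoulli mb Pb)//= opprK lnK ?posrE// expRN lnK ?posrE.
Qed.

End Macro.

(** * Annuli around the origin and the nearest point *)

Section Nearest.
Local Open Scope ereal_scope.
Context {R : realType} {d : measure_display} {Ω : measurableType d}.
Variable P : probability Ω R.
Variables (X : nat -> Ω -> pt R) (lam : R).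
Hypothesis lam0 : (0 < lam)%R.
Hypothesis HX : is_hPPP P X lam.
Hypothesis Hmin : {ae P, forall w, forall n, (sqn (X 0%N w) <= sqn (X n w))%R}.

Local Notation q0 := (fun w => sqn (X 0%N w)).

Let mX n : measurable_fun setT (X n). Proof. by case: HX. Qed.

Lemma measurable_q0 : measurable_fun setT q0.
Proof. exact: (measurableT_comp measurable_sqn (mX 0)). Qed.

Definition annulus (a b : R) : set Ω := [set w | (a < q0 w <= b)%R].

Lemma measurable_annulus a b : measurable (annulus a b).
Proof.
rewrite -[annulus a b]setTI.
by have := @measurable_q0 measurableT `]a, b]%classic (measurable_itv _).
Qed.

(* The value [+oo] on the inner disk forces [expeR (- sum)] to vanish unless all
   points lie outside it; subtracting the same quantity for the larger radius
   isolates the event that the nearest point lies in the annulus. *)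
Definition ring_fun (a b th : R) (l : pt R -> \bar R) (x : pt R) : \bar R :=
  if (sqn x <= a)%R then +oo else if (sqn x <= b)%R then th%:E else l x.

Definition outer_int (b : R) (l : pt R -> \bar R) : \bar R :=
  \int[@leb2 R]_(x in [set x | (b < sqn x)%R]) (1 - expeR (- l x)).

Section OneFunction.
Variable l : pt R -> \bar R.
Hypotheses (ml : measurable_fun setT l) (l0 : forall x, 0 <= l x).

Lemma outer_int_ge0 b : 0 <= outer_int b l.
Proof. by apply: integral_ge0 => x _; exact: one_sub_expeRN_ge0. Qed.

Lemma measurable_ring_fun a b th : measurable_fun setT (ring_fun a b th l).
Proof.
have mle r : measurable_fun setT (fun x : pt R => (sqn x <= r)%R).
  by apply: measurable_fun_ler => //; exact: measurable_sqn.
apply: measurable_fun_ifT => //.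
by apply: measurable_fun_ifT.
Qed.

Lemma ring_fun_ge0 a b th x : (0 <= th)%R -> 0 <= ring_fun a b th l x.
Proof. by move=> th0; rewrite /ring_fun; case: ifP => // _; case: ifP. Qed.

Lemma measurable_sqn_gt (r : R) : measurable [set x : pt R | (r < sqn x)%R].
Proof. by have := measurable_sqn_set (@measurable_itv R `]r, +oo[); rewrite set_itvE. Qed.

(** On the inner disk, the annulus and the exterior, the integrand of the Laplace functional is 1,
    [1 - expR (- th)] and [1 - expeR (- l)]; the first two zones have areas [pi * a] and
    [pi * (b - a)]. *)
Lemma laplace_ring a b th : (0 <= a)%R -> (a <= b)%R -> (0 <= th)%R ->
  \int[P]_w expeR (- \sum_(n <oo) ring_fun a b th l (X n w)) =
  (expR (- (lam * pi * a + lam * pi * (b - a) * (1 - expR (- th)))))%:E *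
  expeR (- (lam%:E * outer_int b l)).
Proof.
move=> a0 ab th0.
have b0 : (0 <= b)%R by exact: le_trans ab.
have mr := measurable_ring_fun a b th.
have r0 x := ring_fun_ge0 a b x th0.
rewrite (laplace_hppp (ltW lam0) HX mr r0).
have m1 := measurable_one_sub_expeRN mr.
have f0 x := one_sub_expeRN_ge0 (r0 x).
have th1 : (0 <= 1 - expR (- th))%R by rewrite subr_ge0 -expR0 ler_expR lerNl oppr0.
rewrite -[in LHS]ge0_integral_leb2p//.
pose A := [set x : pt R | (sqn x <= a)%R].
pose B := [set x : pt R | (sqn x <= b)%R] `\` A.
pose C := [set x : pt R | (b < sqn x)%R].
have mA : measurable A by exact: measurable_sqn_le.
have mB : measurable B by apply: measurableD => //; exact: measurable_sqn_le.
have mC : measurable C by exact: measurable_sqn_gt.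
have ABC : setT = (A `|` B) `|` C.
  apply/seteqP; split=> // x _; rewrite /A /B /C/=.
  have [xa|xa] := leP (sqn x) a; first by left; left.
  have [xb|xb] := leP (sqn x) b; last by right.
  by left; right; split=> //; apply/negP; rewrite -ltNge.
have AB0 : [disjoint A & B] by rewrite disj_set2E; apply/eqP; rewrite -subset0 => x [xA [_ /(_ xA)]].
have ABC0 : [disjoint A `|` B & C].
  rewrite disj_set2E; apply/eqP; rewrite -subset0 => x [[xa|[xb _]]]; rewrite /C/= ltNge.
    by rewrite (le_trans xa ab).
  by rewrite xb.
rewrite [in LHS]ABC ge0_integral_setU//; last 2 first.
- exact: measurableU.
- exact: measurable_funTS.
rewrite ge0_integral_setU//; last exact: measurable_funTS.
rewrite (eq_integral (cst 1)) /=; last first.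
  by move=> x; rewrite inE /A/= => xa; rewrite /ring_fun xa/= sube0.
rewrite [X in _ + X + _](eq_integral (cst (1 - expR (- th))%:E)) /=; last first.
  move=> x; rewrite inE /B/= => -[xb /negP xa]; rewrite /ring_fun (negbTE xa).
  by rewrite (xb : (sqn x <= b)%R).
rewrite [X in _ + X](eq_integral (fun x => 1 - expeR (- l x))); last first.
  move=> x; rewrite inE /C/= => bx; rewrite /ring_fun.
  by rewrite !leNgt bx (le_lt_trans ab bx).
rewrite !integral_cst//.
have leA (r : R) : (0 <= r)%R -> leb2p [set x | (sqn x <= r)%R] = (pi * r)%:E by exact: leb2_disk.
have IA : [set x : pt R | (sqn x <= b)%R] `&` A = A.
  by apply/seteqP; split=> x //=; [case|move=> xa; split=> //; exact: le_trans xa ab].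
have LB : leb2p B = (pi * (b - a))%:E.
  rewrite /B measureD//; last 2 first.
  - exact: measurable_sqn_le.
  - by have := ltry (pi * b)%R; rewrite -(leA _ b0).
  transitivity ((pi * b)%:E - (pi * a)%:E); last by rewrite -EFinB mulrBr.
  by congr (_ - _); [exact: leA|rewrite IA; exact: leA].
transitivity (expeR (- (lam%:E * (1 * (pi * a)%:E + (1 - expR (- th))%:E * (pi * (b - a))%:E +
    outer_int b l)))).
  congr (expeR (- (_ * (1 * _ + _ * _ + _)))); [exact: leA|exact: LB|].
  by rewrite ge0_integral_leb2p//; [exact: measurable_one_sub_expeRN|move=> x; exact: one_sub_expeRN_ge0].
rewrite mul1e -EFinM -EFinD muleDr//.
rewrite expeRND; last 2 first.
- rewrite mule_ge0 ?lee_fin ?(ltW lam0)// addr_ge0 ?mulr_ge0 ?pi_ge0// subr_ge0//.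
- by rewrite mule_ge0 ?lee_fin ?(ltW lam0)// outer_int_ge0.
by congr (_ * _); rewrite -EFinM /=; congr (expR _)%:E; ring.
Qed.

Lemma integral_annulus a b th : (0 <= a)%R -> (a <= b)%R -> (0 <= th)%R ->
  \int[P]_(w in annulus a b) expeR (- \sum_(n <oo) ring_fun a b th l (X n w)) =
  (expR (- (lam * pi * a + lam * pi * (b - a) * (1 - expR (- th)))) -
   expR (- (lam * pi * b)))%:E * expeR (- (lam%:E * outer_int b l)).
Proof.
move=> a0 ab th0.
have b0 : (0 <= b)%R by exact: le_trans ab.
pose e1 w := expeR (- \sum_(n <oo) ring_fun a b th l (X n w)).
pose e2 w := expeR (- \sum_(n <oo) ring_fun b b 0 l (X n w)).
have S0 a' b' th' w : (0 <= th')%R -> 0 <= \sum_(n <oo) ring_fun a' b' th' l (X n w).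
  by move=> th'0; apply: nneseries_ge0 => n _ _; exact: ring_fun_ge0.
have mS a' b' th' : (0 <= th')%R ->
    measurable_fun setT (fun w => expeR (- \sum_(n <oo) ring_fun a' b' th' l (X n w))).
  move=> th'0; apply: measurable_expeRN; apply: measurable_nneseries => [n w|n].
    exact: ring_fun_ge0.
  exact: (measurableT_comp (measurable_ring_fun a' b' th') (mX n)).
have m1 : measurable_fun setT e1 by exact: mS.
have m2 : measurable_fun setT e2 by exact: mS.
have mann := measurable_annulus a b.
have I1 := laplace_ring a0 ab th0; have I2 := laplace_ring b0 (lexx b) (lexx 0%R).
(* Almost surely pointwise: if the nearest point is within [a], both [e1] and [e2] vanish; if it is
   in the annulus, [e2] vanishes; if it is beyond [b], so are all points and [e1 = e2]. *)
have E12 : \int[P]_(w in annulus a b) e1 w + \int[P]_w e2 w = \int[P]_w e1 w.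
  have p0 w : setT w -> 0 <= (e1 \_ (annulus a b)) w.
    by move=> _; rewrite patchE; case: ifP => // _; exact: expeR_ge0.
  have mp : measurable_fun setT (e1 \_ (annulus a b)).
    by apply/(measurable_restrictT _ mann)/measurable_funTS.
  have e20 w : setT w -> 0 <= e2 w by move=> _; exact: expeR_ge0.
  rewrite [in X in X + _]integral_mkcond -ge0_integralD//.
  apply: ge0_ae_eq_integral => //.
  - exact: emeasurable_funD.
  - by move=> w _; rewrite adde_ge0 ?p0 ?e20.
  - by move=> w _; exact: expeR_ge0.
  apply: filterS Hmin => w minw _ /=; rewrite patchE.
  have ringy a' b' th' : (0 <= th')%R -> (q0 w <= a')%R ->
      expeR (- \sum_(n <oo) ring_fun a' b' th' l (X n w)) = 0.
    move=> th'0 qa; have : +oo <= \sum_(n <oo) ring_fun a' b' th' l (X n w).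
      have := @nneseries_pred1 R (fun n => ring_fun a' b' th' l (X n w)) 0%N.
      rewrite {2}/ring_fun qa; apply => n; exact: ring_fun_ge0.
    by rewrite leye_eq => /eqP ->.
  case: ifPn => [/[!inE]/andP[aq qb]|].
    by rewrite /e2 ringy// adde0.
  rewrite notin_setE => /negP; rewrite negb_and -leNgt -ltNge add0e => /orP[qa|bq].
    by rewrite /e1 /e2 !ringy// (le_trans qa).
  rewrite /e1 /e2; congr (expeR (- _)); apply: eq_eseriesr => n _.
  have bn : (b < sqn (X n w))%R by exact: lt_le_trans bq (minw n).
  by rewrite /ring_fun !leNgt bn (le_lt_trans ab bn).
move: E12; rewrite I1 I2 subrr mulr0 mul0r addr0.
have : expeR (- (lam%:E * outer_int b l)) \is a fin_num.
  by apply: expeRN_fin_num; rewrite mule_ge0 ?lee_fin ?(ltW lam0)// outer_int_ge0.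
case: (expeR _) => [r| |]// _; rewrite -!EFinM.
case: (\int[P]_(w in annulus a b) e1 w) => [s| |]//.
by rewrite -EFinD => -[E]; congr (_ %:E); rewrite mulrBl -E addrK.
Qed.

End OneFunction.

(** The zero test function turns [integral_annulus] into the exact law of the squared nearest
    distance, a difference of two exponentials; [1 - expR (- x) <= x] gives the linear bound. *)
Lemma P_annulus a b : (0 <= a)%R -> (a <= b)%R -> P (annulus a b) <= (lam * pi * (b - a))%:E.
Proof.
move=> a0 ab.
have mc : measurable_fun setT (cst 0 : pt R -> \bar R) by [].
have c0 (x : pt R) : 0 <= (cst 0 x : \bar R) by [].
have := integral_annulus mc c0 a0 ab (lexx 0%R).
have -> : outer_int b (cst 0) = 0.
  rewrite /outer_int integral0_eq// => x _ /=.
  by rewrite ?oppe0 ?expeR0 ?oppr0 ?expR0 subee.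
rewrite mule0 oppe0 expeR0 mule1 oppr0 expR0 subrr mulr0 addr0 => E.
have -> : P (annulus a b) = \int[P]_(w in annulus a b) expeR (- \sum_(n <oo) ring_fun a b 0 (cst 0) (X n w)).
  rewrite -[LHS]mul1e -integral_cst; last exact: measurable_annulus.
  apply: ge0_ae_eq_integral; first exact: measurable_annulus.
  - exact: measurable_cst.
  - apply: measurable_funTS; apply: measurable_expeRN; apply: measurable_nneseries => [n w|n].
      exact: ring_fun_ge0.
    exact: (measurableT_comp (measurable_ring_fun mc a b 0) (mX n)).
  - by [].
  - by move=> w _; exact: expeR_ge0.
  apply: filterS Hmin => w minw /andP[aq qb] /=.
  rewrite eseries0 ?oppe0 ?expeR0// => n _ _.
  have an : (a < sqn (X n w))%R by exact: lt_le_trans aq (minw n).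
  by rewrite /ring_fun leNgt an/=; case: ifP.
rewrite E lee_fin.
have -> : (lam * pi * b = lam * pi * a + lam * pi * (b - a))%R by ring.
set x := (lam * pi * (b - a))%R; set y := (lam * pi * a)%R.
have x0 : (0 <= x)%R by rewrite !mulr_ge0 ?(ltW lam0) ?pi_ge0// subr_ge0.
have y0 : (0 <= y)%R by rewrite !mulr_ge0 ?(ltW lam0) ?pi_ge0.
rewrite opprD expRD -{1}[expR (- y)]mulr1 -mulrBr.
apply: (@le_trans _ _ (1 - expR (- x))%R).
  rewrite ler_piMl// ?subr_ge0 -expR0 ler_expR lerNl oppr0//.
by rewrite lerBlDr addrC -lerBlDr; have := expR_ge1Dx (- x)%R.
Qed.

(** The origin alone has area 0, and a Poisson count of rate 0 is 0 with probability 1. *)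
Lemma q0_gt0 : {ae P, forall w, (0 < q0 w)%R}.
Proof.
pose A := [set w | (q0 w <= 0)%R].
have mA : measurable A.
  rewrite -[A]setTI; have := @measurable_q0 measurableT `]-oo, 0%R]%classic (measurable_itv _).
  by rewrite set_itvE.
exists A; split=> //; last by move=> w /= /negP; rewrite -leNgt.
have [_ _ Pc _] := HX.
have mB : measurable [set x : pt R | (sqn x <= 0)%R] by exact: measurable_sqn_le.
have LB : lam%:E * @leb2 R [set x : pt R | (sqn x <= 0)%R] = 0.
  by rewrite leb2_sqn_le0 mule0.
have := Pc _ mB; rewrite LB => /(_ (ltry 0%R) 0%N).
rewrite /poissonp/= expr0 fact0 divr1 mul1r oppr0 expR0 => P1.
set C := [set w | _] in P1.
have mC : measurable C.
  rewrite -[C]setTI; apply: (@measurable_count R d Ω P (fun _ _ => true) X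
    (mscale (NngNum (ltW lam0)) leb2p) HX _ mB measurableT [set 0%:E]).
  exact: emeasurable_set1.
have AC : A `<=` ~` C.
  move=> w qw Cw.
  have : (\1_[set x : pt R | (sqn x <= 0)%R] (X 0%N w))%:E <= 0%:R%:E :> \bar R.
    rewrite -(Cw : Defs.count (fun _ _ => true) X _ w = _) countE.
    apply: (@nneseries_pred1 R (fun n => (\1_[set x : pt R | (sqn x <= 0)%R] (X n w))%:E) 0%N).
    by move=> n; rewrite lee_fin.
  by rewrite indicE mem_set//= lee_fin ler10.
have PC : P (~` C) = 0 by rewrite probability_setC// P1 subee.
apply/eqP; rewrite eq_le measure_ge0 andbT -PC.
by apply: le_measure; rewrite ?inE//; exact: measurableC.
Qed.

End Nearest.

Lemma le_of_perturbations (R : realType) (e X : R) : 0 <= e -> 0 <= X ->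
  (forall t, 0 < t -> e <= t + expR t * X) -> e <= X.
Proof.
move=> e0 X0 H; rewrite leNgt; apply/negP => Xe.
(* Chosen so that [t * (1 + e)] is half of the gap [e - X]. Multiplying the hypothesis by
   [expR (- t) >= 1 - t] bounds the whole gap by [t * (1 + e)], which is absurd. *)
pose t := (e - X) / (2 * (1 + e)).
have e1 : 0 < 1 + e by lra.
have t0 : 0 < t by rewrite divr_gt0 ?mulr_gt0// subr_gt0.
have tE : t * (1 + e) = (e - X) / 2 by rewrite /t; field; rewrite gt_eqF.
have te : t <= e.
  have : t <= t * (1 + e) by rewrite ler_peMr ?(ltW t0)// lerDl.
  by rewrite tE; lra.
have := H t t0; rewrite -lerBlDl => H1.
have : expR (- t) * (e - t) <= X.
  have := ler_wpM2l (expR_ge0 (- t)) H1.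
  by rewrite mulrA -expRD addNr expR0 mul1r.
have H2 : (1 - t) * (e - t) <= expR (- t) * (e - t).
  by rewrite ler_wpM2r ?subr_ge0//; exact: expR_ge1Dx.
move=> /(le_trans H2) H3.
have : e - X <= t * (1 + e) by nra.
by rewrite tE; lra.
Qed.

(** * From annuli to the integral over the squared distance of the nearest point *)

Section NearestIntegral.
Local Open Scope ereal_scope.
Context {R : realType} {d : measure_display} {Ω : measurableType d}.
Variable P : probability Ω R.
Variables (X : nat -> Ω -> pt R) (lam : R).
Hypothesis lam0 : (0 < lam)%R.
Hypothesis HX : is_hPPP P X lam.
Hypothesis Hmin : {ae P, forall w, forall n, (sqn (X 0%N w) <= sqn (X n w))%R}.
Local Notation q0 := (fun w => sqn (X 0%N w)).
Local Notation leb := (@lebesgue_measure R).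
Local Notation annulus := (annulus X).

Variables (L : R -> pt R -> \bar R) (G : R -> \bar R) (Psi : Ω -> \bar R).
Hypothesis mL : forall v, measurable_fun setT (L v).
Hypothesis L0 : forall v x, 0 <= L v x.
Hypothesis Lmono : forall v v' x, (0 < v)%R -> (v <= v')%R -> L v x <= L v' x.
Hypothesis Lbound : forall a b, (0 < a)%R -> (a <= b)%R ->
  exists2 th : R, (0 <= th)%R & forall x, (a < sqn x)%R -> L b x <= th%:E.
Hypothesis G0 : forall v, 0 <= G v.
Hypothesis Gmono : forall v v', (0 < v)%R -> (v <= v')%R -> G v <= G v'.
Hypothesis mPsi : measurable_fun setT Psi.
Hypothesis Psi0 : forall w, 0 <= Psi w.
Hypothesis Psi1 : forall w, Psi w <= 1.
Hypothesis PsiE : {ae P, forall w, (0 < q0 w)%R ->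
  Psi w = expeR (- (G (q0 w) + \sum_(1 <= n <oo) L (q0 w) (X n w)))}.

(** Up to the factor [lam * pi], the density of the squared nearest distance weighted by the
    conditional expectation: [lam * pi * v] is the cost of an empty disk, [outer_int] that of the
    points beyond it. *)
Definition nearest_density (v : R) : \bar R :=
  expeR (- ((lam * pi * v)%:E + G v + lam%:E * outer_int v (L v))).
Local Notation H := nearest_density.
Hypothesis Hmono : forall v v', (0 < v)%R -> (v <= v')%R -> H v' <= H v.

Let mX n : measurable_fun setT (X n). Proof. by case: HX. Qed.

Let mu0 : (0 < lam * pi)%R. Proof. by rewrite mulr_gt0 ?pi_gt0. Qed.

Let D0 b v : 0 <= lam%:E * outer_int b (L v).
Proof. by rewrite mule_ge0 ?lee_fin ?(ltW lam0)// outer_int_ge0. Qed.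

Let HE v : (0 <= v)%R -> H v =
  (expR (- (lam * pi * v)))%:E * expeR (- G v) * expeR (- (lam%:E * outer_int v (L v))).
Proof.
move=> v0; rewrite /H expeRND ?adde_ge0 ?lee_fin ?mulr_ge0 ?pi_ge0 ?(ltW lam0)//.
by rewrite expeRND// lee_fin !mulr_ge0 ?pi_ge0 ?(ltW lam0).
Qed.

Let series_head (f : nat -> \bar R) : (forall n, 0 <= f n) ->
  \sum_(n <oo) f n = f 0%N + \sum_(1 <= n <oo) f n.
Proof. by move=> f0; rewrite (@nneseries_split _ _ 0 1)// add0n big_nat1. Qed.

Let mring a b th v : (0 <= th)%R -> measurable_fun setT
  (fun w => expeR (- \sum_(n <oo) ring_fun a b th (L v) (X n w))).
Proof.
move=> th0; apply: measurable_expeRN; apply: measurable_nneseries => [n w|n].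
  exact: ring_fun_ge0.
exact: (measurableT_comp (measurable_ring_fun (@mL v) a b th) (mX n)).
Qed.

(** The integrand [1 - expeR (- L)] is at most 1, so moving the inner boundary costs at most the
    area of the annulus. This is the origin of the factor [expR] in the upper bound. *)
Let outer_int_annulus a b v : (0 <= a)%R -> (a <= b)%R ->
  outer_int a (L v) <= (pi * (b - a))%:E + outer_int b (L v).
Proof.
move=> a0 ab; have b0 : (0 <= b)%R by exact: le_trans ab.
have m1 := measurable_one_sub_expeRN (@mL v).
have f0 x := one_sub_expeRN_ge0 (L0 v x).
rewrite /outer_int -!ge0_integral_leb2p//; [|exact: measurable_sqn_gt..].
pose B := [set x : pt R | (sqn x <= b)%R] `\` [set x : pt R | (sqn x <= a)%R].
pose C := [set x : pt R | (b < sqn x)%R].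
have mB : measurable B by apply: measurableD; exact: measurable_sqn_le.
have mC : measurable C by exact: measurable_sqn_gt.
have -> : [set x : pt R | (a < sqn x)%R] = B `|` C.
  apply/seteqP; split=> x; rewrite /B /C/=.
    move=> ax; have [xb|bx] := leP (sqn x) b; last by right.
    by left; split=> //; apply/negP; rewrite -ltNge.
  by move=> [[_ /negP]|bx]; rewrite -?ltNge//; exact: le_lt_trans bx.
rewrite ge0_integral_setU//; last 2 first.
- exact: measurable_funTS.
- rewrite disj_set2E; apply/eqP; rewrite -subset0 => x [[xb _]]; rewrite /C/= ltNge.
  by rewrite (xb : (sqn x <= b)%R).
rewrite leeD2r//.
have leA (r : R) : (0 <= r)%R -> leb2p [set x | (sqn x <= r)%R] = (pi * r)%:E by exact: leb2_disk.
have LB : leb2p B = (pi * (b - a))%:E.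
  rewrite /B measureD//; [|exact: measurable_sqn_le|exact: measurable_sqn_le|]; last first.
    by have := ltry (pi * b)%R; rewrite -(leA _ b0).
  transitivity ((pi * b)%:E - (pi * a)%:E); last by rewrite -EFinB mulrBr.
  congr (_ - _); first exact: leA.
  rewrite (_ : _ `&` _ = [set x : pt R | (sqn x <= a)%R]); first exact: leA.
  by apply/seteqP; split=> x //=; [case|move=> xa; split=> //; exact: le_trans xa ab].
rewrite -LB; apply: (@le_trans _ _ (\int[leb2p]_(x in B) (cst 1) x)); last first.
  by rewrite integral_cst// mul1e.
apply: ge0_le_integral => //; first exact: measurable_funTS.
by move=> x _; rewrite /= leeBlDr ?expeRN_fin_num// leeDl ?expeR_ge0.
Qed.

(** Freezing [G] and [L] at the left endpoint and charging nothing ([th = 0]) to points of the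
    annulus only lowers the exponent. The law of the nearest distance gives the factor [x], and
    pulling the outer boundary back from [b] to [a] costs [expR x]. *)
Lemma nearest_upper a b : (0 < a)%R -> (a <= b)%R ->
  \int[P]_(w in annulus a b) Psi w <=
  (lam * pi * (b - a) * expR (lam * pi * (b - a)))%:E * H a.
Proof.
move=> a0 ab; have mann := measurable_annulus HX a b.
set x := (lam * pi * (b - a))%R; set y := (lam * pi * a)%R.
have x0 : (0 <= x)%R by rewrite mulr_ge0 ?(ltW mu0)// subr_ge0.
pose e w := expeR (- \sum_(n <oo) ring_fun a b 0 (L a) (X n w)).
have me : measurable_fun setT e by exact: mring.
have e0 w : 0 <= e w by exact: expeR_ge0.
apply: (@le_trans _ _ (\int[P]_(w in annulus a b) (expeR (- G a) * e w))).
  apply: ae_ge0_le_integral => //.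
  - exact: measurable_funTS.
  - by move=> w _; rewrite mule_ge0 ?expeR_ge0.
  - by apply: measurable_funTS; apply: emeasurable_funM.
  apply: filterS2 Hmin PsiE => w minw Pw /andP[/= aq qb].
  have q0w : (0 < q0 w)%R by exact: lt_trans aq.
  rewrite Pw// -expeRND//; last by apply: nneseries_ge0 => n _ _; exact: ring_fun_ge0.
  rewrite lee_expeR leeN2 leeD//; first by apply: Gmono => //; exact: ltW.
  rewrite series_head; last by move=> n; exact: ring_fun_ge0.
  have -> : ring_fun a b 0 (L a) (X 0%N w) = 0 by rewrite /ring_fun leNgt aq/= qb.
  rewrite add0e; apply: lee_nneseries => [n _ _|n _]; first exact: ring_fun_ge0.
  have nle : (sqn (X n w) <= a)%R = false.
    by apply/negbTE; rewrite -ltNge; exact: lt_le_trans aq (minw n).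
  rewrite /ring_fun nle.
  by case: ifP => // _; apply: Lmono => //; exact: ltW.
rewrite ge0_integralZl//; [|exact: measurable_funTS|exact: expeR_ge0].
rewrite /e (integral_annulus lam0 HX Hmin (@mL a) (L0 a) (ltW a0) ab (lexx 0%R)).
rewrite oppr0 expR0 subrr mulr0 addr0 -/y.
have -> : (lam * pi * b = y + x)%R by rewrite /x /y; ring.
have Dab : expeR (- (lam%:E * outer_int b (L a))) <=
    (expR x)%:E * expeR (- (lam%:E * outer_int a (L a))).
  rewrite -[(expR x)%:E]/(expeR x%:E) -expeRD lee_expeR.
  have Dle : lam%:E * outer_int a (L a) <= x%:E + lam%:E * outer_int b (L a).
    apply: (le_trans (lee_wpmul2l _ (outer_int_annulus a (ltW a0) ab))).
      by rewrite lee_fin ltW.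
    rewrite ge0_muleDr ?outer_int_ge0 ?lee_fin ?mulr_ge0 ?pi_ge0 ?subr_ge0//.
    by rewrite -EFinM mulrA.
  rewrite leeNl oppeD; last by rewrite fin_num_adde_defr.
  by rewrite oppeK addeC leeBlDl.
rewrite HE ?(ltW a0)// -/y.
have yx : (expR (- y) - expR (- (y + x)) <= x * expR (- y))%R.
  rewrite opprD expRD -{1}[expR (- y)]mulr1 -mulrBr mulrC ler_wpM2r ?expR_ge0//.
  by rewrite lerBlDr addrC -lerBlDr; exact: expR_ge1Dx.
have yx0 : (0 <= expR (- y) - expR (- (y + x)))%R by rewrite subr_ge0 ler_expR lerN2 lerDl.
apply: (@le_trans _ _ (expeR (- G a) * ((x * expR (- y))%:E *
    ((expR x)%:E * expeR (- (lam%:E * outer_int a (L a))))))).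
  apply: lee_wpmul2l; first exact: expeR_ge0.
  by apply: lee_pmul; rewrite ?lee_fin ?expeR_ge0.
rewrite le_eqVlt; apply/orP; left; apply/eqP.
set A1 := expeR (- G a); set D1 := expeR (- (lam%:E * outer_int a (L a))).
rewrite (EFinM x (expR (- y))) (EFinM x (expR x)) [LHS]muleC -!muleA; congr (_ * _).
by rewrite [D1 * A1]muleC [LHS]muleCA.
Qed.

(** Freezing at the right endpoint and charging [th] to every point of the annulus only raises the
    exponent. The nearest point lies in the annulus and is charged too, although it is absent from
    the sum from 1; the factor [expR th] compensates. In [key] the inequality [expR u - 1 >= u] then
    eliminates [th], so its size does not matter. *)
Lemma nearest_lower a b : (0 < a)%R -> (a <= b)%R ->
  (lam * pi * (b - a))%:E * H b <= \int[P]_(w in annulus a b) Psi w.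
Proof.
move=> a0 ab; have mann := measurable_annulus HX a b.
have b0 : (0 < b)%R by exact: lt_le_trans ab.
have [th th0 Lth] := Lbound a0 ab.
set x := (lam * pi * (b - a))%R; pose y := (lam * pi * a)%R.
have x0 : (0 <= x)%R by rewrite mulr_ge0 ?(ltW mu0)// subr_ge0.
pose e w := expeR (- \sum_(n <oo) ring_fun a b th (L b) (X n w)).
have me : measurable_fun setT e by exact: mring.
have e0 w : 0 <= e w by exact: expeR_ge0.
have Gth : 0 <= expeR (- G b) * (expR th)%:E by rewrite mule_ge0 ?expeR_ge0// lee_fin expR_ge0.
apply: (@le_trans _ _ (\int[P]_(w in annulus a b) (expeR (- G b) * (expR th)%:E * e w))); last first.
  apply: ae_ge0_le_integral => //.
  - by move=> w _; rewrite mule_ge0.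
  - by apply: measurable_funTS; apply: emeasurable_funM.
  - exact: measurable_funTS.
  apply: filterS2 Hmin PsiE => w minw Pw /andP[/= aq qb].
  have q0w : (0 < q0 w)%R by exact: lt_trans aq.
  rewrite Pw// /e series_head; last by move=> n; exact: ring_fun_ge0.
  have -> : ring_fun a b th (L b) (X 0%N w) = th%:E by rewrite /ring_fun leNgt aq/= qb.
  have S0 : 0 <= \sum_(1 <= n <oo) ring_fun a b th (L b) (X n w).
    by apply: nneseries_ge0 => n _ _; exact: ring_fun_ge0.
  rewrite (expeRND _ S0) ?lee_fin// muleA -(muleA _ (expR th)%:E) -[expeR (- th%:E)]/((expR (- th))%:E).
  rewrite -EFinM -expRD subrr expR0 mule1 -expeRND//.
  rewrite lee_expeR leeN2 leeD//; first exact: Gmono.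
  apply: lee_nneseries => [n _ _|n _]; first exact: L0.
  have an : (a < sqn (X n w))%R by exact: lt_le_trans aq (minw n).
  have nle : (sqn (X n w) <= a)%R = false by apply/negbTE; rewrite -ltNge.
  rewrite /ring_fun nle.
  have Lqb : L (q0 w) (X n w) <= L b (X n w) by exact: Lmono.
  by case: ifP => // _; exact: le_trans Lqb (Lth _ an).
rewrite ge0_integralZl//; last exact: measurable_funTS.
rewrite /e (integral_annulus lam0 HX Hmin (@mL b) (L0 b) (ltW a0) ab th0).
rewrite HE ?(ltW b0)// -/x -/y.
have -> : (lam * pi * b = y + x)%R by rewrite /x /y; ring.
have key : (x * expR (- (y + x)) <= expR th * (expR (- (y + x * (1 - expR (- th)))) - expR (- (y + x))))%R.
  have k1 : (x * expR (- th) <= expR (x * expR (- th)) - 1)%R.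
    by rewrite lerBrDl; exact: expR_ge1Dx.
  have k2 : (x <= expR th * (expR (x * expR (- th)) - 1))%R.
    apply: le_trans (ler_wpM2l (expR_ge0 th) k1).
    by rewrite mulrCA -expRD subrr expR0 mulr1.
  have -> : (- (y + x * (1 - expR (- th))) = - (y + x) + x * expR (- th))%R by ring.
  rewrite [expR (_ + x * _)]expRD.
  have -> : (expR th * (expR (- (y + x)) * expR (x * expR (- th)) - expR (- (y + x))) =
      expR th * (expR (x * expR (- th)) - 1) * expR (- (y + x)))%R by ring.
  by rewrite ler_wpM2r ?expR_ge0.
rewrite [leRHS](_ : _ = (expR th * (expR (- (y + x * (1 - expR (- th)))) - expR (- (y + x))))%:E *
  (expeR (- G b) * expeR (- (lam%:E * outer_int b (L b))))); last first.
  by rewrite !EFinM -!muleA muleCA; congr (_ * _); rewrite muleCA.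
rewrite [leLHS](_ : _ = (x * expR (- (y + x)))%:E *
  (expeR (- G b) * expeR (- (lam%:E * outer_int b (L b))))); last by rewrite EFinM !muleA.
rewrite lee_wpmul2r ?lee_fin//.
by rewrite mule_ge0 ?expeR_ge0.
Qed.

Let H0 v : 0 <= H v. Proof. exact: expeR_ge0. Qed.
Let H1 v : (0 <= v)%R -> H v <= 1.
Proof.
move=> v0; apply: expeRN_le1.
by rewrite !adde_ge0// lee_fin !mulr_ge0 ?pi_ge0 ?(ltW lam0).
Qed.
Let Hfin v : (0 <= v)%R -> H v \is a fin_num.
Proof. by move=> v0; rewrite ge0_fin_numE// (le_lt_trans (H1 v0))// ltry. Qed.

Lemma measurable_nearest_density : measurable_fun (`]0%R, +oo[%classic : set R) H.
Proof.
(* The value 1 bounds the density, so this extension is nonincreasing on the whole line and hence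
   measurable. *)
pose f (v : R) := if (0 < v)%R then fine (H v) else 1%R.
apply: (eq_measurable_fun (EFin \o f)).
  by move=> v; rewrite inE/= in_itv/= andbT /f => v0; rewrite v0 fineK// Hfin// ltW.
apply/measurable_EFinP; apply: nonincreasing_measurable => // v v' vv'.
rewrite /f; have [v0|v0] := ltP 0%R v.
  have v'0 := lt_le_trans v0 vv'.
  by rewrite v'0; apply: fine_le; [exact/Hfin/ltW|exact/Hfin/ltW|exact: Hmono].
case: ifPn => // v'0.
by rewrite -lee_fin fineK; [exact/H1/ltW|exact/Hfin/ltW].
Qed.

(** * Riemann sums on a grid of mesh [dl] *)

Section Grid.
Variable dl : R.
Hypothesis dl0 : (0 < dl)%R.
Let B k : set R := `](k%:R * dl)%R, (k.+1%:R * dl)%R]%classic.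
Let A k := annulus (k%:R * dl) (k.+1%:R * dl).
Let hk k := \int[leb]_(v in B k) H v.
Let ak k := \int[P]_(w in A k) Psi w.
Let t := (lam * pi * dl)%R.

Let grid_lt k : (k%:R * dl < k.+1%:R * dl)%R.
Proof. by rewrite ltr_pM2r// ltr_nat. Qed.
Let grid_sub k : (k.+1%:R * dl - k%:R * dl = dl)%R.
Proof. by rewrite -mulrBl -natrB// subSnn mul1r. Qed.
Let grid_ge0 k : (0 <= k%:R * dl)%R. Proof. by rewrite mulr_ge0// ltW. Qed.
Let grid_gt0 k : (0 < k.+1%:R * dl)%R. Proof. by rewrite mulr_gt0. Qed.

Let inB k v : B k v <-> (k%:R * dl < v <= k.+1%:R * dl)%R.
Proof. by rewrite /B/= ?in_itv. Qed.

Let mB k : measurable (B k). Proof. exact: measurable_itv. Qed.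

Let BS k : B k `<=` `]0%R, +oo[%classic.
Proof. by move=> v /=; rewrite !in_itv/= andbT => /andP[/(le_lt_trans (grid_ge0 k))]. Qed.

Let mHB k : measurable_fun (B k) H.
Proof.
by apply: measurable_funS (@BS k) measurable_nearest_density; exact: measurable_itv.
Qed.

Let lebB k : leb (B k) = dl%:E.
Proof. by rewrite lebesgue_measure_itv/= lte_fin grid_lt -EFinB grid_sub. Qed.

Let int_cst k (c : \bar R) : \int[leb]_(v in B k) cst c v = c * dl%:E.
Proof. by rewrite integral_cst; [congr (_ * _); exact: lebB|exact: mB]. Qed.

Let hk0 k : 0 <= hk k. Proof. exact: integral_ge0. Qed.
Let ak0 k : 0 <= ak k. Proof. exact: integral_ge0. Qed.

Let le_intB k (f g : R -> \bar R) : (forall v, 0 <= f v) -> (forall v, 0 <= g v) ->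
  measurable_fun (B k) f -> measurable_fun (B k) g ->
  (forall v, (k%:R * dl < v <= k.+1%:R * dl)%R -> f v <= g v) ->
  \int[leb]_(v in B k) f v <= \int[leb]_(v in B k) g v.
Proof.
move=> f0 g0 mf mg fg; apply: ge0_le_integral => //; exact: mB.
Qed.

(** As the density is nonincreasing, its value at a grid point lies between its means over the next
    and the preceding cell. Endpoint values thus become integrals, at the price of a shift by one
    cell. *)
Let hk_ge k : dl%:E * H (k.+1%:R * dl) <= hk k.
Proof.
rewrite muleC -(int_cst k); apply: le_intB; [by move=> v; exact: H0|by move=> v; exact: H0|exact: measurable_cst|exact: mHB|].
move=> v /andP[kv vk]; apply: Hmono => //.
exact: le_lt_trans (grid_ge0 k) kv.
Qed.

Let hk_le k : hk k.+1 <= dl%:E * H (k.+1%:R * dl).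
Proof.
rewrite muleC -(int_cst k.+1); apply: le_intB; [by move=> v; exact: H0|by move=> v; exact: H0|exact: mHB|exact: measurable_cst|].
move=> v /andP[kv vk]; by apply: Hmono => //; exact: ltW.
Qed.

Let hk_le_dl k : hk k <= dl%:E.
Proof.
rewrite -[leRHS]mul1e -(int_cst k); apply: le_intB => // v /andP[kv vk]; apply: H1.
exact: le_trans (grid_ge0 k) (ltW kv).
Qed.

Let ak_upper k : ak k.+1 <= (lam * pi * expR t)%:E * hk k.
Proof.
have := nearest_upper (grid_gt0 k) (ltW (grid_lt k.+1)); rewrite grid_sub -/t -/(ak k.+1).
move=> /le_trans; apply; rewrite /t mulrAC EFinM -muleA.
apply: lee_wpmul2l; last exact: hk_ge.
by rewrite lee_fin !mulr_ge0 ?expR_ge0 ?pi_ge0 ?(ltW lam0).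
Qed.

Let ak_lower k : (lam * pi)%:E * hk k.+2 <= ak k.+1.
Proof.
have := nearest_lower (grid_gt0 k) (ltW (grid_lt k.+1)); rewrite grid_sub -/(ak k.+1).
apply: le_trans.
rewrite [leRHS](_ : _ = (lam * pi)%:E * (dl%:E * H (k.+2%:R * dl))); last by rewrite muleA -EFinM.
apply: lee_wpmul2l; last exact: hk_le.
by rewrite lee_fin (ltW mu0).
Qed.

(** The cell at the origin has left endpoint 0, where [nearest_upper] does not apply; [Psi <= 1] and
    the probability of the cell suffice. *)
Let ak_0 : ak 0 <= t%:E.
Proof.
apply: (@le_trans _ _ (P (A 0))); last first.
  by have := P_annulus lam0 HX Hmin (grid_ge0 0) (ltW (grid_lt 0)); rewrite grid_sub.
rewrite -[leRHS]mul1e -integral_cst; last exact: (measurable_annulus HX).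
apply: ge0_le_integral => //; first exact: (measurable_annulus HX).
exact: measurable_funTS.
Qed.

Let grid_cover (r : R) : (0 < r)%R -> exists k, (k%:R * dl < r <= k.+1%:R * dl)%R.
Proof.
move=> r0; have rd : (0 < r / dl)%R by rewrite divr_gt0.
have ex : exists n, (r <= n%:R * dl)%R.
  exists (Num.truncn (r / dl)).+1.
  by rewrite -ler_pdivrMr// ltW// truncnS_gt.
case: (ex_minnP ex) => -[|n] rn minn; first by move: rn; rewrite mul0r leNgt r0.
exists n; rewrite rn andbT ltNge; apply/negP => /minn.
by rewrite ltnn.
Qed.

Let grid_uniq i j (r : R) : (i%:R * dl < r <= i.+1%:R * dl)%R ->
  (j%:R * dl < r <= j.+1%:R * dl)%R -> i = j.
Proof.
move=> /andP[ir ri] /andP[jr rj].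
have := lt_le_trans ir rj; have := lt_le_trans jr ri.
rewrite !ltr_pM2r// !ltr_nat !ltnS => ji ij.
by apply/eqP; rewrite eqn_leq ij ji.
Qed.

Let sum_hk : \int[leb]_(v in `]0%R, +oo[) H v = \sum_(k <oo) hk k.
Proof.
have UB : `]0%R, +oo[%classic = \bigcup_k B k.
  apply/seteqP; split=> v; last by move=> [k _]; exact: BS.
  by rewrite /= in_itv/= andbT => /grid_cover[k vk]; exists k.
rewrite UB ge0_integral_bigcup// -?UB; first exact: measurable_nearest_density.
move=> i j _ _ [v [Bi Bj]]; exact: grid_uniq ((inB i v).1 Bi) ((inB j v).1 Bj).
Qed.

Let sum_ak : \int[P]_w Psi w = \sum_(k <oo) ak k.
Proof.
have mA k : measurable (A k) by exact: (measurable_annulus HX).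
have UA : [set w | (0 < q0 w)%R] = \bigcup_k A k.
  apply/seteqP; split=> w /=.
    by move=> /grid_cover[k wk]; exists k.
  by move=> [k _ /andP[kw _]]; exact: le_lt_trans (grid_ge0 k) kw.
rewrite -ge0_integral_bigcup//; last 2 first.
- exact: measurable_funTS.
- move=> i j _ _ [w [Ai Aj]]; exact: grid_uniq Ai Aj.
rewrite -UA.
have mpos : measurable [set w | (0 < q0 w)%R] by rewrite UA; exact: bigcupT_measurable.
have [N [mN PN0 Nq]] := q0_gt0 lam0 HX.
have P0 : P (~` [set w | (0 < q0 w)%R]) = 0.
  apply/eqP; rewrite eq_le measure_ge0 andbT -PN0.
  apply: le_measure; [by rewrite inE; exact: measurableC|by rewrite inE|].
  by move=> w /= H'; exact: Nq.
rewrite (@ge0_negligible_integral _ _ _ P setT (~` [set w | (0 < q0 w)%R]))//.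
- by rewrite setTD setCK.
- exact: measurableC.
Qed.

Lemma grid_upper : \int[P]_w Psi w <=
  t%:E + (expR t)%:E * ((pi * lam)%:E * \int[leb]_(v in `]0%R, +oo[) H v).
Proof.
rewrite sum_ak series_head// leeD ?ak_0//.
rewrite sum_hk muleA -EFinM -nneseriesZl//.
have -> : \sum_(1 <= k <oo) ak k = \sum_(k <oo) ak k.+1.
  by rewrite -nneseries_addn//; apply: eq_eseriesr => k _; rewrite addn1.
apply: lee_nneseries => // k _.
by have := ak_upper k; rewrite mulrC [(lam * pi)%R]mulrC.
Qed.

(** [ak_lower] pairs density cell [k + 2] with cell [k + 1] of [Psi]. The density cells 0 and 1
    remain unpaired; each has integral at most [dl], whence [2 * t]. Cell 0 of [Psi] is simply
    dropped. *)
Lemma grid_lower : (pi * lam)%:E * \int[leb]_(v in `]0%R, +oo[) H v <=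
  (2 * t)%:E + \int[P]_w Psi w.
Proof.
rewrite sum_hk (@nneseries_split _ _ 0 2)// add0n big_nat_recl// big_nat1.
have S0 : 0 <= \sum_(2 <= k <oo) hk k by exact: nneseries_ge0.
have h01 : 0 <= hk 0 + hk 1 by rewrite adde_ge0.
rewrite (ge0_muleDr _ h01 S0); apply: leeD.
  apply: (@le_trans _ _ ((pi * lam)%:E * (dl%:E + dl%:E))).
    apply: lee_wpmul2l; last by apply: leeD; exact: hk_le_dl.
    by rewrite lee_fin mulr_ge0 ?pi_ge0 ?(ltW lam0).
  by rewrite -EFinD -EFinM lee_fin /t; lra.
rewrite sum_ak -nneseriesZl//.
have -> : \sum_(2 <= k <oo) (pi * lam)%:E * hk k = \sum_(k <oo) (pi * lam)%:E * hk k.+2.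
  rewrite -(@nneseries_addn _ (fun k => (pi * lam)%:E * hk k)).
    by apply: eq_eseriesr => k _; rewrite addn2.
  by move=> k; rewrite mule_ge0// lee_fin mulr_ge0 ?pi_ge0 ?(ltW lam0).
apply: (@le_trans _ _ (\sum_(k <oo) ak k.+1)).
  apply: lee_nneseries => [k _ _|k _]; last by rewrite [(pi * lam)%R]mulrC; exact: ak_lower.
  by rewrite mule_ge0// lee_fin mulr_ge0 ?pi_ge0 ?(ltW lam0).
rewrite [leRHS]series_head//.
have -> : \sum_(1 <= k <oo) ak k = \sum_(k <oo) ak k.+1.
  by rewrite -nneseries_addn//; apply: eq_eseriesr => k _; rewrite addn1.
by rewrite leeDr.
Qed.

End Grid.

Lemma nearest_integral :
  \int[P]_w Psi w = (pi * lam)%:E * \int[leb]_(v in `[0%R, +oo[%classic) H v.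
Proof.
rewrite -integral_itv_obnd_cbnd; last exact: measurable_nearest_density.
set I := \int[leb]_(v in _) H v; set e := \int[P]_w Psi w.
have e0 : 0 <= e by exact: integral_ge0.
have e1 : e <= 1.
  apply: (@le_trans _ _ (\int[P]_w (cst 1) w)); first exact: ge0_le_integral.
  by rewrite integral_cst// mul1e; have := @probability_setT _ _ _ P; rewrite le_eqVlt => /eqP ->.
have efin : e \is a fin_num by rewrite ge0_fin_numE// (le_lt_trans e1)// ltry.
have c0 : 0 <= (pi * lam)%:E :> \bar R by rewrite lee_fin mulr_ge0 ?pi_ge0 ?(ltW lam0).
have Y0 : 0 <= (pi * lam)%:E * I by rewrite mule_ge0// integral_ge0.
have low dl (dl0 : (0 < dl)%R) := grid_lower dl0.
have up dl (dl0 : (0 < dl)%R) := grid_upper dl0.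
(* The lower bound at the single mesh 1 already shows that the integral is finite. Below, the mesh
   is [t / (lam * pi)], then [eps / 2 / (lam * pi)], so that the error terms are exactly [t] and
   [eps]. *)
have Yfin : (pi * lam)%:E * I \is a fin_num.
  rewrite ge0_fin_numE// (le_lt_trans (low 1%R ltr01))// -/e -(fineK efin) -EFinD.
  exact: ltry.
rewrite -/I -/e in low up.
move: Y0 e0 low up Yfin efin; case: ((pi * lam)%:E * I) => [Y| |]//; case: e {e1} => [e| |]//.
rewrite !lee_fin => Y0 e0 low up _ _.
congr (_ %:E); apply: le_anti; apply/andP; split.
- apply: le_of_perturbations => // t t0.
  have := up (t / (lam * pi))%R (divr_gt0 t0 mu0).
  by rewrite -EFinM -EFinD lee_fin mulrC divfK ?gt_eqF.
- apply/ler_addgt0Pr => eps eps0.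
  have := low (eps / 2 / (lam * pi))%R (divr_gt0 (divr_gt0 eps0 (ltr0Sn R 1)) mu0).
  rewrite -EFinD lee_fin [(lam * pi * _)%R]mulrC divfK ?gt_eqF//.
  by move=> h; rewrite (le_trans h)//; lra.
Qed.

End NearestIntegral.

(** * Measurability and tails *)

Section LimMeasurable.
Local Open Scope ereal_scope.
Context {R : realType} {d : measure_display} {T : measurableType d}.

Lemma cvg_limn_einf_esup (u : (\bar R)^nat) : limn_einf u = limn_esup u ->
  u @ \oo --> limn_esup u.
Proof.
move=> E; apply: (@squeeze_cvge _ _ _ _ (einfs u) u (esups u)).
- apply: nearW => n; apply/andP; split.
    by apply: ereal_inf_lbound; exists n => /=.
  by apply: ereal_sup_ubound; exists n => /=.
- by rewrite -E limn_einf_lim; exact: is_cvg_einfs.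
- by rewrite limn_esup_lim; exact: is_cvg_esups.
Qed.

(* [limn] takes the default value [point] on divergent sequences. *)
Lemma measurable_limn (f : nat -> T -> \bar R) : (forall n, measurable_fun setT (f n)) ->
  measurable_fun setT (fun x => limn (f ^~ x)).
Proof.
move=> mf.
have mS := measurable_fun_limn_esup mf.
have mI : measurable_fun setT (fun x => limn_einf (f ^~ x)).
  apply: (eq_measurable_fun (fun x => - limn_esup (-%E \o (f ^~ x)))).
    by move=> x _; rewrite limn_esupN oppeK.
  apply: (measurableT_comp (@oppe_measurable _ _)).
  apply: (@measurable_fun_limn_esup _ _ _ _ (fun n x => - f n x)) => n.
  exact: (measurableT_comp (@oppe_measurable _ _)).
apply: (eq_measurable_fun (fun x => if limn_einf (f ^~ x) == limn_esup (f ^~ x)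
  then limn_esup (f ^~ x) else point)).
  move=> x _; case: eqP => [E|E].
    by apply/esym/cvg_lim => //; exact: cvg_limn_einf_esup.
  apply/esym/getPN => l fl; apply: E.
  by have [-> ->] := cvg_limn_einf_sup fl.
apply: measurable_fun_ifT => //.
exact: measurable_fun_eqe.
Qed.

(** Terms of any sign are needed: the series inside [SINR] are defined at every sample point,
    whereas the gains are nonnegative only almost surely. *)
Lemma measurable_eseries m (h : nat -> T -> \bar R) :
  (forall n, measurable_fun setT (h n)) ->
  measurable_fun setT (fun x => \sum_(m <= n <oo) h n x).
Proof.
move=> mh; apply: (@measurable_limn (fun n x => \sum_(m <= i < n) h i x)) => n.
exact: emeasurable_sum.
Qed.

Lemma measurable_invr (f : T -> R) : measurable_fun setT f ->
  measurable_fun setT (fun x => (f x)^-1)%R.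
Proof.
(* [powR] with exponent -1 is the inverse on nonnegative reals only, hence the detour through the
   square; both expressions are 0 where [f] vanishes. *)
move=> mf; apply: (eq_measurable_fun (fun x => f x * powR (f x ^+ 2) (-1)))%R.
  move=> x _; rewrite powR_inv1 ?sqr_ge0//.
  have [->|fx0] := eqVneq (f x) 0%R; first by rewrite mul0r invr0.
  by rewrite expr2 invfM mulrA divff// mul1r.
apply: measurable_funM => //; apply: (measurableT_comp (@measurable_powR R (-1))).
exact: measurable_funX.
Qed.

Lemma measurable_ediv (num : T -> R) (den : T -> \bar R) :
  measurable_fun setT num -> measurable_fun setT den ->
  measurable_fun setT (fun x => ediv (num x) (den x)).
Proof.
move=> mn md.
have mfd : measurable_fun setT (fun x => fine (den x)).
  exact: (measurableT_comp (@fine_measurable R setT measurableT) md).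
apply: (eq_measurable_fun (fun x => if den x == +oo then 0 else if den x == -oo then 0 else
  if fine (den x) == 0%R then +oo else (num x * (fine (den x))^-1)%:E)).
  by move=> x _; case: (den x).
apply: measurable_fun_ifT => //; first exact: measurable_fun_eqe.
apply: measurable_fun_ifT => //; first exact: measurable_fun_eqe.
apply: measurable_fun_ifT => //; first exact: measurable_fun_eqr.
by apply/measurable_EFinP; apply: measurable_funM => //; exact: measurable_invr.
Qed.

Lemma measurable_ln1pE (f : T -> \bar R) : measurable_fun setT f ->
  measurable_fun setT (fun x => ln1pE (f x)).
Proof.
move=> mf.
have ml : measurable_fun setT (fun r : R => ln (1 + r)).
  by apply: (measurableT_comp (@measurable_ln R)); exact: measurable_funD.
apply: (eq_measurable_fun (fun x => if f x == -oo then 0 else er_map (fun r => ln (1 + r)) (f x))).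
  by move=> x _; case: (f x).
apply: measurable_fun_ifT => //; first exact: measurable_fun_eqe.
exact: (measurableT_comp (@measurable_er_map _ (measurableTypeR R) _ _ ml) mf).
Qed.

Lemma measurable_SINR (Pm Pf W alpha sigma2 : R) (X : nat -> T -> pt R)
    (busy : nat -> T -> bool) (Y : nat -> T -> pt R) (M : nat -> nat -> T -> bool)
    (U : nat -> nat -> T -> pt R) (h : T -> R) (gm : nat -> T -> R) (gf : nat * nat -> T -> R) :
  (forall n, measurable_fun setT (X n)) -> (forall n, measurable_fun setT (busy n)) ->
  (forall n, measurable_fun setT (Y n)) -> (forall k j, measurable_fun setT (M k j)) ->
  (forall k j, measurable_fun setT (U k j)) -> measurable_fun setT h ->
  (forall n, measurable_fun setT (gm n)) -> (forall kj, measurable_fun setT (gf kj)) ->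
  measurable_fun setT (SINR Pm Pf W alpha sigma2 X busy Y M U h gm gf).
Proof.
move=> mX mb mY mM mU mh mgm mgf; apply: measurable_ediv.
  apply: measurable_funM; last exact: measurable_powR_eucl.
  exact: measurable_funM.
apply: emeasurable_funD => //; apply: emeasurable_funD.
  apply: measurable_eseries => n; apply: measurable_fun_ifT => //.
  apply/measurable_EFinP; apply: measurable_funM; last exact: measurable_powR_eucl.
  exact: measurable_funM.
apply: measurable_eseries => k; apply: measurable_eseries => j.
apply: measurable_fun_ifT => //; apply/measurable_EFinP; apply: measurable_funM.
  exact: measurable_funM.
by apply: measurable_powR_eucl; exact: measurable_addp.
Qed.

End LimMeasurable.

Section Tails.
Local Open Scope ereal_scope.
Context {R : realType} {d : measure_display} {Ω : measurableType d}.
Variable P : probability Ω R.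
Local Notation leb := (@lebesgue_measure R).

Lemma layer_cake (V : Ω -> \bar R) : measurable_fun setT V -> (forall w, 0 <= V w) ->
  \int[P]_w V w = \int[leb]_(t in `[0%R, +oo[) P [set w | t%:E < V w].
Proof.
move=> mV V0.
pose f (p : Ω * measurableTypeR R) : \bar R :=
  if (0 <= p.2)%R && (p.2%:E < V p.1) then 1 else 0.
have f0 p : 0 <= f p by rewrite /f; case: ifP.
have mid : measurable_fun setT (idfun : measurableTypeR R -> R).
  by move=> _ B mB; rewrite setTI.
have m2 : measurable_fun setT (fun p : Ω * measurableTypeR R => (p.2 : R)).
  exact: (measurableT_comp mid measurable_snd).
have mf : measurable_fun setT f.
  apply: measurable_fun_ifT => //; apply: measurable_and.
    by apply: measurable_fun_ler => //; exact: measurable_cst.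
  apply: measurable_fun_lte; first exact/measurable_EFinP.
  exact: (measurableT_comp mV measurable_fst).
have := fubini_tonelli (m1 := P) (m2 := leb) f mf f0; rewrite /fubini_F /fubini_G.
have -> : \int[P]_w \int[leb]_t f (w, t) = \int[P]_w V w.
  apply: eq_integral => w _.
  transitivity (\int[leb]_(t in [set t : R | (0 <= t)%R && (t%:E < V w)]) (cst 1) t).
    rewrite [RHS]integral_mkcond; apply: eq_integral => t _; rewrite patchE /f/=.
    have -> : (t \in [set t : R | (0 <= t)%R && (t%:E < V w)]) = (0 <= t)%R && (t%:E < V w).
      by apply/idP/idP; rewrite inE.
    by [].
  have itvE : [set t : R | (0 <= t)%R && (t%:E < V w)] =
      if V w is r%:E then `[0%R, r[%classic else `[0%R, +oo[%classic.
    apply/seteqP; split=> t /=; move: (V0 w); case: (V w) => [r| |]//= _;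
      by rewrite ?in_itv/= ?lte_fin ?ltry ?andbT.
  rewrite itvE; case: (V w) (V0 w) => [r| |]// r0.
    rewrite integral_cst// mul1e.
    rewrite [LHS]lebesgue_measure_itv/= lte_fin.
    case: ifPn => [_|]; first by rewrite sube0.
    by rewrite -leNgt => r0'; congr (_ %:E); apply: le_anti; rewrite r0' -lee_fin r0.
  rewrite integral_cst// mul1e.
  by rewrite [LHS]lebesgue_measure_itv/= ltry.
move=> ->; rewrite [RHS]integral_mkcond; apply: eq_integral => t _; rewrite patchE.
have mt : measurable [set w | t%:E < V w].
  by rewrite -[X in measurable X]setTI; exact: emeasurable_fun_o_infty.
rewrite mem_setE in_itv/= andbT /f/=; case: ifPn => t0 /=; last by rewrite integral0.
transitivity (\int[P]_(w in [set w | t%:E < V w]) (cst 1) w).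
  rewrite [RHS]integral_mkcond; apply: eq_integral => w _; rewrite patchE.
  have -> : (w \in [set w | t%:E < V w]) = (t%:E < V w) by apply/idP/idP; rewrite inE.
  by [].
by rewrite integral_cst// mul1e.
Qed.

(** The conventions of [ediv] match the product form: an infinite denominator makes both sides
    false, a zero one makes both true since [h] is positive. *)
Lemma ediv_gt (T h Pm ra : R) (D : \bar R) : (0 < T)%R -> (0 < h)%R -> (0 < Pm)%R ->
  (0 < ra)%R -> 0 <= D ->
  (T%:E < ediv (Pm * h * ra^-1) D) = ((T * ra / Pm)%:E * D < h%:E).
Proof.
move=> T0 h0 Pm0 ra0; have s0 : (0 < T * ra / Pm)%R by rewrite divr_gt0// mulr_gt0.
case: D => [r| |]// r0 /=; last first.
  by rewrite gt0_muley ?lte_fin//= ltNge (ltW T0).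
move: r0; rewrite lee_fin le_eqVlt => /predU1P[<-|r0].
  by rewrite eqxx mule0 ltry lte_fin h0.
rewrite gt_eqF// -EFinM !lte_fin ltr_pdivlMr// [X in _ = (X < _)%R]mulrAC ltr_pdivrMr//.
by rewrite ltr_pdivlMr// [(h * Pm)%R]mulrC mulrAC.
Qed.

Lemma P_exp_gt (mu : R) (h : Ω -> R) (z : \bar R) : (0 < mu)%R -> exp_rv P mu h ->
  0 <= z -> P [set w | z < (mu * h w)%:E] = expeR (- z).
Proof.
move=> mu0 [mh Ph]; case: z => [z| |]// z0; last first.
  by rewrite (_ : [set w | _] = set0) ?measure0//; apply/seteqP; split=> w.
have -> : [set w | z%:E < (mu * h w)%:E] = [set w | (z / mu < h w)%R].
  by apply/seteqP; split=> w /=; rewrite lte_fin ltr_pdivrMr// mulrC.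
by rewrite Ph ?divr_ge0 ?(ltW mu0)// mulrC divfK ?gt_eqF.
Qed.

Lemma exp_rv_gt0 (mu : R) (g : Ω -> R) : exp_rv P mu g -> {ae P, forall w, (0 < g w)%R}.
Proof.
move=> [mg Pg].
have mA : measurable [set w | (0 < g w)%R].
  by rewrite -[X in measurable X]setTI; exact: measurable_fun_ltr.
exists (~` [set w | (0 < g w)%R]); split=> //; first exact: measurableC.
by rewrite probability_setC// Pg// mulr0 oppr0 expR0 subee.
Qed.

End Tails.

(** * Conditional exponents *)

Section ScaledInterference.
Local Open Scope ereal_scope.
Context {R : realType}.

(* With [s = T |X_0|^alpha / Pm], the event [SINR > T] is
   [scaled_interference < mu * h]. *)
Definition scaled_interference {S : Type} (mu Pm Pf W alpha sigma2 T : R)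
    (X : nat -> S -> pt R) (busy : nat -> S -> bool) (Y : nat -> S -> pt R)
    (M : nat -> nat -> S -> bool) (U : nat -> nat -> S -> pt R)
    (gm : nat -> S -> R) (gf : nat * nat -> S -> R) (w : S) : \bar R :=
  let s := (T * powR (eucl (X 0%N w)) alpha / Pm)%R in
  (mu * s * sigma2)%:E +
  (\sum_(1 <= n <oo) (if busy n w then
      (mu * (s * Pm * powR (eucl (X n w)) (- alpha)) * Num.max 0 (gm n w))%:E else 0) +
   \sum_(0 <= k <oo) \sum_(0 <= j <oo) (if M k j w then
      (mu * (s * W * Pf * powR (eucl (addp (Y k w) (U k j w))) (- alpha)) *
       Num.max 0 (gf (k, j) w))%:E else 0)).

Variables (mu Pm Pf W alpha sigma2 T : R).
Hypotheses (mu0 : (0 < mu)%R) (Pm0 : (0 < Pm)%R) (Pf0 : (0 < Pf)%R) (W0 : (0 < W)%R).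
Hypotheses (sigma0 : (0 <= sigma2)%R) (T0 : (0 < T)%R).

Let s0 (x : pt R) : (0 <= T * powR (eucl x) alpha / Pm)%R.
Proof. by rewrite divr_ge0 ?mulr_ge0 ?powR_ge0// ltW. Qed.

Let max0 (g : R) : (0 <= Num.max 0 g)%R. Proof. by rewrite le_max lexx. Qed.

Let macro_ge0 (x y : pt R) (b : bool) (g : R) : 0 <= (if b then
  (mu * (T * powR (eucl x) alpha / Pm * Pm * powR (eucl y) (- alpha)) * Num.max 0 g)%:E else 0).
Proof.
case: b => //; rewrite lee_fin; apply: mulr_ge0 => //; apply: mulr_ge0; first exact: ltW.
by apply: mulr_ge0; [apply: mulr_ge0 => //; exact: ltW|exact: powR_ge0].
Qed.

Let femto_ge0 (x y : pt R) (b : bool) (g : R) : 0 <= (if b then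
  (mu * (T * powR (eucl x) alpha / Pm * W * Pf * powR (eucl y) (- alpha)) * Num.max 0 g)%:E else 0).
Proof.
case: b => //; rewrite lee_fin; apply: mulr_ge0 => //; apply: mulr_ge0; first exact: ltW.
apply: mulr_ge0; last exact: powR_ge0.
by apply: mulr_ge0; [apply: mulr_ge0 => //; exact: ltW|exact: ltW].
Qed.

Section Positivity.
Context {S : Type}.
Variables (X : nat -> S -> pt R) (busy : nat -> S -> bool) (Y : nat -> S -> pt R)
    (M : nat -> nat -> S -> bool) (U : nat -> nat -> S -> pt R)
    (gm : nat -> S -> R) (gf : nat * nat -> S -> R).

Lemma scaled_noise_ge0 (x : pt R) :
  0 <= (mu * (T * powR (eucl x) alpha / Pm) * sigma2)%:E.
Proof.
by rewrite lee_fin; apply: mulr_ge0 => //; apply: mulr_ge0; [exact: ltW|exact: s0].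
Qed.

Lemma scaled_macro_ge0 (x : pt R) w : 0 <= \sum_(1 <= n <oo) (if busy n w then
  (mu * (T * powR (eucl x) alpha / Pm * Pm * powR (eucl (X n w)) (- alpha)) *
    Num.max 0 (gm n w))%:E else 0).
Proof. by apply: nneseries_ge0 => n _ _; exact: macro_ge0. Qed.

Lemma scaled_femto_ge0 (x : pt R) w :
  0 <= \sum_(0 <= k <oo) \sum_(0 <= j <oo) (if M k j w then
      (mu * (T * powR (eucl x) alpha / Pm * W * Pf *
       powR (eucl (addp (Y k w) (U k j w))) (- alpha)) * Num.max 0 (gf (k, j) w))%:E else 0).
Proof.
by apply: nneseries_ge0 => k _ _; apply: nneseries_ge0 => j _ _; exact: femto_ge0.
Qed.

Lemma scaled_interference_ge0 w :
  0 <= scaled_interference mu Pm Pf W alpha sigma2 T X busy Y M U gm gf w.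
Proof.
by rewrite !adde_ge0//; [exact: scaled_noise_ge0|exact: scaled_macro_ge0|exact: scaled_femto_ge0].
Qed.

Lemma SINR_gt (h : S -> R) w : (0 < h w)%R -> (forall n, 0 < gm n w)%R ->
    (forall kj, 0 < gf kj w)%R -> (0 < sqn (X 0%N w))%R ->
  (T%:E < SINR Pm Pf W alpha sigma2 X busy Y M U h gm gf w) =
  (scaled_interference mu Pm Pf W alpha sigma2 T X busy Y M U gm gf w < (mu * h w)%:E).
Proof.
move=> hw gmw gfw q0w.
have e0 : (0 < powR (eucl (X 0%N w)) alpha)%R by rewrite powR_gt0// sqrtr_gt0.
set s := (T * powR (eucl (X 0%N w)) alpha / Pm)%R.
have sp : (0 < s)%R by rewrite divr_gt0// mulr_gt0.
have mus : (0 <= mu * s)%R by rewrite mulr_ge0 ?ltW.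
have gm0 n : Num.max 0%R (gm n w) = gm n w by apply/max_idPr; exact: ltW.
have gf0 kj : Num.max 0%R (gf kj w) = gf kj w by apply/max_idPr; exact: ltW.
have m0 n : 0 <= (if busy n w then (Pm * gm n w * powR (eucl (X n w)) (- alpha))%:E else 0).
  by case: ifP => // _; rewrite lee_fin !mulr_ge0 ?powR_ge0 ?ltW.
have f0 k j : 0 <= (if M k j w then
    (W * Pf * gf (k, j) w * powR (eucl (addp (Y k w) (U k j w))) (- alpha))%:E else 0).
  by case: ifP => // _; rewrite lee_fin !mulr_ge0 ?powR_ge0 ?ltW.
have Im0 : 0 <= interf_m Pm alpha X busy gm w by exact: nneseries_ge0.
have If0 : 0 <= interf_f W Pf alpha Y M U gf w.
  by apply: nneseries_ge0 => k _ _; exact: nneseries_ge0.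
have sig0 : 0 <= sigma2%:E by rewrite lee_fin.
rewrite /SINR powRN ediv_gt ?adde_ge0// -/s.
rewrite -(@lte_pmul2l _ mu%:E)// muleA -!EFinM; congr (_ < _).
rewrite ge0_muleDr ?adde_ge0// ge0_muleDr// -EFinM addeC /scaled_interference -/s.
congr (_ + (_ + _)).
- rewrite /interf_m -nneseriesZl//; apply: eq_eseriesr => n _; case: ifP => _; last by rewrite mule0.
  by rewrite gm0 -EFinM; congr (_ %:E); ring.
- rewrite /interf_f -nneseriesZl; last by move=> k _; exact: nneseries_ge0.
  apply: eq_eseriesr => k _; rewrite -nneseriesZl//; apply: eq_eseriesr => j _.
  case: ifP => _; last by rewrite mule0.
  by rewrite gf0 -EFinM; congr (_ %:E); ring.
Qed.

End Positivity.

Lemma measurable_scaled_interference d' (S : measurableType d')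
    (X : nat -> S -> pt R) (busy : nat -> S -> bool) (Y : nat -> S -> pt R)
    (M : nat -> nat -> S -> bool) (U : nat -> nat -> S -> pt R)
    (gm : nat -> S -> R) (gf : nat * nat -> S -> R) :
  (forall n, measurable_fun setT (X n)) -> (forall n, measurable_fun setT (busy n)) ->
  (forall n, measurable_fun setT (Y n)) -> (forall k j, measurable_fun setT (M k j)) ->
  (forall k j, measurable_fun setT (U k j)) ->
  (forall n, measurable_fun setT (gm n)) -> (forall kj, measurable_fun setT (gf kj)) ->
  measurable_fun setT (scaled_interference mu Pm Pf W alpha sigma2 T X busy Y M U gm gf).
Proof.
move=> mX mb mY mM mU mgm mgf.
have ms : measurable_fun setT (fun w => T * powR (eucl (X 0%N w)) alpha / Pm)%R.
  apply: measurable_funM => //; apply: measurable_funM => //.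
  exact: measurable_powR_eucl.
apply: emeasurable_funD; first by apply/measurable_EFinP; do 2 apply: measurable_funM => //.
apply: emeasurable_funD.
- apply: measurable_nneseries => [n w|n]; first exact: macro_ge0.
  apply: measurable_fun_ifT => //; apply/measurable_EFinP; apply: measurable_funM.
    apply: measurable_funM => //; apply: measurable_funM; last exact: measurable_powR_eucl.
    exact: measurable_funM.
  exact: measurable_maxr.
- apply: measurable_nneseries => [k w|k].
    by apply: nneseries_ge0 => j _ _; exact: femto_ge0.
  apply: measurable_nneseries => [j w|j]; first exact: femto_ge0.
  apply: measurable_fun_ifT => //; apply/measurable_EFinP; apply: measurable_funM.
    apply: measurable_funM => //; apply: measurable_funM.
      by apply: measurable_funM => //; exact: measurable_funM.
    by apply: measurable_powR_eucl; exact: measurable_addp.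
  by apply: measurable_maxr => //; exact: mgf.
Qed.

End ScaledInterference.

(** * Exponent of one interfering macro station *)

Section MacroExponent.
Local Open Scope ereal_scope.
Context {R : realType}.
Variables (T alpha p : R).
Hypotheses (T0 : (0 < T)%R) (alpha0 : (0 < alpha)%R) (p01 : (0 < p <= 1)%R).

Definition path_ratio (v : R) (x : pt R) : R := (1 + T^-1 * powR (sqn x / v) (alpha / 2))^-1.
(** What a station at [x] leaves after its fading and its thinning mark are integrated out, when the
    serving station is at squared distance [v]. *)
Definition macro_exponent (v : R) (x : pt R) : \bar R := (- ln (1 - p * path_ratio v x))%:E.

Let p0 : (0 < p)%R. Proof. by case/andP: p01. Qed.
Let p1 : (p <= 1)%R. Proof. by case/andP: p01. Qed.

Lemma path_ratio_gt0 v x : (0 < path_ratio v x)%R.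
Proof. by rewrite invr_gt0 ltr_pwDl// mulr_ge0 ?powR_ge0// invr_ge0 ltW. Qed.

Lemma path_ratio_lt1 v x : (0 < v)%R -> (0 < sqn x)%R -> (p * path_ratio v x < 1)%R.
Proof.
move=> v0 x0; apply: (@le_lt_trans _ _ (path_ratio v x)).
  by rewrite ler_piMl//; exact/ltW/path_ratio_gt0.
have t0 : (0 < T^-1 * powR (sqn x / v) (alpha / 2))%R.
  by rewrite mulr_gt0 ?invr_gt0// powR_gt0// divr_gt0.
by rewrite invf_lt1 ?ltrDl// addr_gt0.
Qed.

Lemma path_ratio_mono v v' x : (0 < v)%R -> (v <= v')%R ->
  (path_ratio v x <= path_ratio v' x)%R.
Proof.
move=> v0 vv'; have v'0 := lt_le_trans v0 vv'.
have Ti0 : (0 <= T^-1)%R by rewrite invr_ge0 ltW.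
rewrite lef_pV2 ?posrE ?ltr_pwDl ?mulr_ge0 ?powR_ge0//.
rewrite lerD2l ler_wpM2l//; apply: ge0_ler_powR.
- by rewrite divr_ge0// ltW.
- by rewrite nnegrE divr_ge0 ?sqn_ge0// ltW.
- by rewrite nnegrE divr_ge0 ?sqn_ge0// ltW.
- by rewrite ler_wpM2l ?sqn_ge0// lef_pV2.
Qed.

Lemma path_ratio_far v (a : R) x : (0 < v)%R -> (0 < a)%R -> (a < sqn x)%R ->
  (path_ratio v x <= (1 + T^-1 * powR (a / v) (alpha / 2))^-1)%R.
Proof.
move=> v0 a0 ax.
have Ti0 : (0 <= T^-1)%R by rewrite invr_ge0 ltW.
rewrite lef_pV2 ?posrE ?ltr_pwDl ?mulr_ge0 ?powR_ge0//.
rewrite lerD2l ler_wpM2l//; apply: ge0_ler_powR.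
- by rewrite divr_ge0// ltW.
- by rewrite nnegrE divr_ge0// ltW.
- by rewrite nnegrE divr_ge0 ?sqn_ge0// ltW.
- by rewrite ler_pM2r ?invr_gt0// ltW.
Qed.

Lemma macro_exponent_ge0 v x : 0 <= macro_exponent v x.
Proof.
rewrite lee_fin oppr_ge0 ln_le0// gerBl mulr_ge0 ?(ltW p0)//.
exact/ltW/path_ratio_gt0.
Qed.

Lemma measurable_path_ratio v : measurable_fun setT (path_ratio v).
Proof.
apply: measurable_invr; apply: measurable_funD => //; apply: measurable_funM => //.
apply: (measurableT_comp (@measurable_powR R (alpha / 2))).
by apply: measurable_funM => //; exact: measurable_sqn.
Qed.

Lemma measurable_macro_exponent v : measurable_fun setT (macro_exponent v).
Proof.
apply/measurable_EFinP; apply: (measurableT_comp (@oppr_measurable R _)).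
apply: (measurableT_comp (@measurable_ln R)); apply: measurable_funB => //.
by apply: measurable_funM => //; exact: measurable_path_ratio.
Qed.

Lemma macro_exponent_mono v v' x : (0 < v)%R -> (v <= v')%R ->
  macro_exponent v x <= macro_exponent v' x.
Proof.
move=> v0 vv'; have v'0 := lt_le_trans v0 vv'; rewrite lee_fin lerN2.
(* At the origin the ratio does not depend on [v]. Elsewhere [p * path_ratio] is below 1, so the
   logarithm is taken at a positive number even if [p] is 1. *)
have [x0|x0] := eqVneq (sqn x) 0%R.
  by rewrite /path_ratio x0 !mul0r.
have xp : (0 < sqn x)%R by rewrite lt_neqAle eq_sym x0 sqn_ge0.
rewrite ler_ln ?posrE ?subr_gt0 ?path_ratio_lt1//.
by rewrite lerB// ler_wpM2l ?(ltW p0)// path_ratio_mono.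
Qed.

Lemma macro_exponent_bound a b : (0 < a)%R -> (a <= b)%R ->
  exists2 th : R, (0 <= th)%R & forall x, (a < sqn x)%R -> macro_exponent b x <= th%:E.
Proof.
move=> a0 ab; have b0 := lt_le_trans a0 ab.
(* The ratio at squared distance [a], which bounds it at all farther points; it is below 1 because
   [a] is positive, so the bound [th] is finite. *)
pose t := (1 + T^-1 * powR (a / b) (alpha / 2))^-1%R.
have t0' : (0 < T^-1 * powR (a / b) (alpha / 2))%R.
  by rewrite mulr_gt0 ?invr_gt0// powR_gt0// divr_gt0.
have t0 : (0 < t)%R by rewrite invr_gt0 addr_gt0.
have t1 : (t < 1)%R by rewrite invf_lt1 ?ltrDl// addr_gt0.
have pt1 : (p * t < 1)%R by rewrite (le_lt_trans _ t1)// ler_piMl// ltW.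
exists (- ln (1 - p * t))%R.
  by rewrite oppr_ge0 ln_le0// gerBl mulr_ge0 ?ltW.
move=> x ax; rewrite lee_fin lerN2 ler_ln ?posrE ?subr_gt0 ?path_ratio_lt1//; last first.
  exact: lt_trans ax.
by rewrite lerB// ler_wpM2l ?(ltW p0)// path_ratio_far.
Qed.

Lemma macro_exponentE v x y : (0 < v)%R -> v = sqn x -> (0 < sqn y)%R ->
  (1 - (1 + T * powR (eucl x) alpha * powR (eucl y) (- alpha))^-1 = path_ratio v y)%R.
Proof.
move=> v0 vE y0; rewrite !powR_eucl -vE /path_ratio mulNr powRN.
have -> : powR (sqn y / v) (alpha / 2) = (powR (sqn y) (alpha / 2) / powR v (alpha / 2))%R.
  rewrite powRM ?sqn_ge0 ?invr_ge0 ?(ltW v0)//; congr (_ * _)%R.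
  have -> : (v^-1 = powR v (-1))%R by rewrite powR_inv1 ?ltW.
  by rewrite -powRrM mulN1r powRN.
set e := powR v _; set f := powR (sqn y) _.
have e0 : (0 < e)%R by rewrite powR_gt0.
have f0 : (0 < f)%R by rewrite powR_gt0.
field; rewrite !gt_eqF ?addr_gt0 ?mulr_gt0//.
Qed.

(** Under the exponential the logarithm disappears and [p * path_ratio] remains. The retention
    probability thus enters linearly, which is how the thinned intensity [lm * Pbusy] arises. *)
Lemma outer_int_macro v : (0 < v)%R ->
  outer_int v (macro_exponent v) = p%:E * ((pi * v)%:E * phi T alpha).
Proof.
move=> v0; rewrite /outer_int -(integral_outer_phi T0 alpha0 v0).
have mset := measurable_sqn_gt v.
transitivity (\int[@leb2 R]_(x in [set x | (v < sqn x)%R]) (p%:E * (path_ratio v x)%:E)); last first.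
  apply: ge0_integralZl; [exact: mset| | |by rewrite lee_fin ltW].
    by apply: measurable_funTS; apply/measurable_EFinP; exact: (measurable_path_ratio v).
  by move=> x _; rewrite lee_fin; exact/ltW/path_ratio_gt0.
apply: eq_integral => x; rewrite inE => vx.
have x0 : (0 < sqn x)%R := lt_trans v0 (vx : (v < sqn x)%R).
suff : 1 - expeR (- macro_exponent v x) = p%:E * (path_ratio v x)%:E by [].
have -> : expeR (- macro_exponent v x) = (1 - p * path_ratio v x)%:E.
  by rewrite /macro_exponent /= opprK lnK ?posrE ?subr_gt0 ?path_ratio_lt1.
by rewrite -EFinB -EFinM; congr (_ %:E); ring.
Qed.

Lemma phi_ge0 : 0 <= phi T alpha.
Proof.
rewrite mule_ge0 ?lee_fin ?powR_ge0// integral_ge0// => u _.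
by rewrite lee_fin invr_ge0 addr_ge0// powR_ge0.
Qed.

End MacroExponent.

Section FemtoExponent.
Local Open Scope ereal_scope.
Context {R : realType}.
Variables (alpha lc Rc : R).
Hypotheses (lc0 : (0 <= lc)%R) (Rc0 : (0 < Rc)%R).

Let gain_ge0 (s : R) (x y : pt R) : (0 < s)%R ->
  (0 <= (1 + s^-1 * powR (eucl (addp x y)) alpha)^-1)%R.
Proof. by move=> s0; rewrite invr_ge0 addr_ge0// mulr_ge0 ?powR_ge0// invr_ge0 ltW. Qed.

Let exponent_ge0 (s : R) x : (0 < s)%R -> 0 <= lc%:E * \int[@leb2 R]_(y in disk Rc)
  ((1 + s^-1 * powR (eucl (addp x y)) alpha)^-1)%:E.
Proof.
by move=> s0; rewrite mule_ge0 ?lee_fin// integral_ge0// => y _; rewrite lee_fin gain_ge0.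
Qed.

Lemma one_sub_eta_ge0 (s : R) x : (0 < s)%R -> 0 <= 1 - Defs.eta lc Rc alpha s x.
Proof. by move=> s0; rewrite /Defs.eta one_sub_expeRN_ge0// exponent_ge0. Qed.

Lemma femto_integral_mono (s s' : R) : (0 < s)%R -> (s <= s')%R ->
  \int[@leb2 R]_x (1 - Defs.eta lc Rc alpha s x) <=
  \int[@leb2 R]_x (1 - Defs.eta lc Rc alpha s' x).
Proof.
move=> s0 ss'; have s'0 := lt_le_trans s0 ss'.
have me (t : R) : (0 < t)%R -> measurable_fun setT (fun x => 1 - Defs.eta lc Rc alpha t x).
  move=> t0; rewrite /Defs.eta; apply: measurable_one_sub_expeRN.
  exact: measurable_disk_int.
apply: ge0_le_integral => //; [by move=> x _; exact: one_sub_eta_ge0|exact: me|exact: me|].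
move=> x _; rewrite leeB// lee_expeR leeN2.
apply: lee_wpmul2l; first by rewrite lee_fin.
have mdk := measurable_disk (ltW Rc0).
have mg (t : R) : (0 < t)%R -> measurable_fun (disk Rc)
    (fun y : pt R => ((1 + t^-1 * powR (eucl (addp x y)) alpha)^-1)%:E).
  by move=> t0; apply: measurable_funTS; exact: measurable_path_gain.
apply: ge0_le_integral; [exact: mdk| |exact: mg|exact: mg|].
  by move=> y _; rewrite lee_fin gain_ge0.
have den0 (t : R) y : (0 < t)%R -> (0 < 1 + t^-1 * powR (eucl (addp x y)) alpha)%R.
  by move=> t0; rewrite ltr_pwDl// mulr_ge0 ?powR_ge0// invr_ge0 ltW.
move=> y _; rewrite lee_fin lef_pV2 ?posrE ?den0//.
by rewrite lerD2l ler_wpM2r ?powR_ge0// lef_pV2.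
Qed.

End FemtoExponent.

(** * Coverage probability *)

Section Model.
Local Open Scope ereal_scope.
Context (R : realType) (d : measure_display) (Ω : measurableType d).
Variable P : probability Ω R.
Variables (alpha mu Pm Pf W sigma2 lm Pbusy lp lc Rc : R).
Hypotheses (halpha : (0 < alpha)%R) (hmu : (0 < mu)%R) (hPm : (0 < Pm)%R) (hPf : (0 < Pf)%R).
Hypotheses (hW : (0 < W)%R) (hsigma : (0 <= sigma2)%R) (hlm : (0 < lm)%R).
Hypotheses (hPbusy : (0 < Pbusy <= 1)%R) (hlp : (0 < lp)%R) (hlc : (0 <= lc)%R).
Hypothesis hRc : (0 < Rc)%R.
Variables (Xm : nat -> Ω -> pt R) (busy : nat -> Ω -> bool) (Y : nat -> Ω -> pt R).
Variables (M : nat -> nat -> Ω -> bool) (U : nat -> nat -> Ω -> pt R).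
Variables (h : Ω -> R) (gm : nat -> Ω -> R) (gf : nat * nat -> Ω -> R).
Hypothesis HXm : is_hPPP P Xm lm.
Hypothesis Hsorted : {ae P, forall w, forall n, (eucl (Xm n w) <= eucl (Xm n.+1 w))%R}.
Hypothesis Hbusy : forall n, measurable_fun setT (busy n) /\ P [set w | busy n w] = Pbusy%:E.
Hypothesis HY : is_hPPP P Y lp.
Hypothesis HU : forall k, is_PPP P (M k) (U k) (fun B => lc%:E * @leb2 R (B `&` disk Rc)).
Hypothesis Hh : exp_rv P mu h.
Hypothesis Hgm : forall n, exp_rv P mu (gm n).
Hypothesis Hgf : forall kj, exp_rv P mu (gf kj).
Hypothesis Hind_busy : indep_rvs P busy.
Hypothesis Hind_clusters : mutually_independent P
      (fun k => gen_events (fun j w => (M k j w, U k j w))).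
Hypothesis Hind_gm : indep_rvs P gm.
Hypothesis Hind_gf : indep_rvs P gf.

Let F (i : 'I_7) : set (set Ω) := tnth
  [tuple gen_events Xm; gen_events busy; gen_events Y;
         gen_events (fun kj w => (M kj.1 kj.2 w, U kj.1 kj.2 w));
         events_of h; gen_events gm; gen_events gf] i.
Hypothesis Hind : mutually_independent P F.

Let mXm n : measurable_fun setT (Xm n). Proof. by case: HXm. Qed.
Let mbusy n : measurable_fun setT (busy n). Proof. by case: (Hbusy n). Qed.
Let mY n : measurable_fun setT (Y n). Proof. by case: HY. Qed.
Let mM k j : measurable_fun setT (M k j). Proof. by case: (HU k). Qed.
Let mU k j : measurable_fun setT (U k j). Proof. by case: (HU k). Qed.
Let mh : measurable_fun setT h. Proof. by case: Hh. Qed.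
Let mgm n : measurable_fun setT (gm n). Proof. by case: (Hgm n). Qed.
Let mgf kj : measurable_fun setT (gf kj). Proof. by case: (Hgf kj). Qed.

Let i0 : 'I_7 := @Ordinal 7 0 isT.
Let i1 : 'I_7 := @Ordinal 7 1 isT.
Let i2 : 'I_7 := @Ordinal 7 2 isT.
Let i3 : 'I_7 := @Ordinal 7 3 isT.
Let i4 : 'I_7 := @Ordinal 7 4 isT.
Let i5 : 'I_7 := @Ordinal 7 5 isT.
Let i6 : 'I_7 := @Ordinal 7 6 isT.

Let F0 : F i0 = gen_events Xm. Proof. by rewrite /F (tnth_nth set0). Qed.
Let F1 : F i1 = gen_events busy. Proof. by rewrite /F (tnth_nth set0). Qed.
Let F2 : F i2 = gen_events Y. Proof. by rewrite /F (tnth_nth set0). Qed.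
Let F3 : F i3 = gen_events (fun kj w => (M kj.1 kj.2 w, U kj.1 kj.2 w)).
Proof. by rewrite /F (tnth_nth set0). Qed.
Let F4 : F i4 = events_of h. Proof. by rewrite /F (tnth_nth set0). Qed.
Let F5 : F i5 = gen_events gm. Proof. by rewrite /F (tnth_nth set0). Qed.
Let F6 : F i6 = gen_events gf. Proof. by rewrite /F (tnth_nth set0). Qed.

Let piF i : pi_events (F i).
Proof.
case: i => -[|[|[|[|[|[|[|m]]]]]]] mlt //; rewrite /F (tnth_nth set0) /=.
- exact: pi_gen_events.
- exact: pi_gen_events.
- exact: pi_gen_events.
- by apply: pi_gen_events => kj; exact: measurable_fun_pair.
- exact: pi_events_of.
- exact: pi_gen_events.
- exact: pi_gen_events.
Qed.

Local Notation sub S := (g_sigma_algebraType (join_events F S)).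

Let jX S n : S i0 -> measurable_fun setT (Xm n : sub S -> pt R).
Proof. by move=> Si; apply: (join_measurable piF Si); rewrite F0; exact: measurable_gen_events. Qed.
Let jb S n : S i1 -> measurable_fun setT (busy n : sub S -> bool).
Proof. by move=> Si; apply: (join_measurable piF Si); rewrite F1; exact: measurable_gen_events. Qed.
Let jY S n : S i2 -> measurable_fun setT (Y n : sub S -> pt R).
Proof. by move=> Si; apply: (join_measurable piF Si); rewrite F2; exact: measurable_gen_events. Qed.
Let jMU S k j : S i3 -> measurable_fun setT ((fun w => (M k j w, U k j w)) : sub S -> bool * pt R).
Proof.
move=> Si; apply: (join_measurable piF Si); rewrite F3.
exact: (@measurable_gen_events _ _ _ _ _ (fun kj w => (M kj.1 kj.2 w, U kj.1 kj.2 w)) (k, j)).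
Qed.
Let jM S k j : S i3 -> measurable_fun setT (M k j : sub S -> bool).
Proof. by move=> Si; exact: (measurableT_comp measurable_fst (jMU k j Si)). Qed.
Let jU S k j : S i3 -> measurable_fun setT (U k j : sub S -> pt R).
Proof. by move=> Si; exact: (measurableT_comp measurable_snd (jMU k j Si)). Qed.
Let jh S : S i4 -> measurable_fun setT (h : sub S -> R).
Proof.
move=> Si; apply: (join_measurable piF Si); rewrite F4.
exact: (@measurable_events_of _ _ _ _ h _ _ idfun (@measurable_id _ _ setT)).
Qed.
Let jgm S n : S i5 -> measurable_fun setT (gm n : sub S -> R).
Proof. by move=> Si; apply: (join_measurable piF Si); rewrite F5; exact: measurable_gen_events. Qed.
Let jgf S kj : S i6 -> measurable_fun setT (gf kj : sub S -> R).
Proof. by move=> Si; apply: (join_measurable piF Si); rewrite F6; exact: measurable_gen_events. Qed.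

Local Notation sinr := (SINR Pm Pf W alpha sigma2 Xm busy Y M U h gm gf).

Lemma measurable_sinr : measurable_fun setT sinr.
Proof. exact: measurable_SINR. Qed.

Lemma nearest_sqn : {ae P, forall w, forall n, (sqn (Xm 0%N w) <= sqn (Xm n w))%R}.
Proof.
apply: filterS Hsorted => w sw n.
suff : (eucl (Xm 0%N w) <= eucl (Xm n w))%R by rewrite /eucl ler_sqrt// sqn_ge0.
by elim: n => // n IH; exact: le_trans IH (sw n).
Qed.

Lemma model_ae : {ae P, forall w, [/\ (0 < h w)%R, (forall n, 0 < gm n w)%R,
  (forall kj, 0 < gf kj w)%R & (0 < sqn (Xm 0%N w))%R]}.
Proof.
have A1 := exp_rv_gt0 Hh.
have A2 : {ae P, forall w, forall n, (0 < gm n w)%R}.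
  by apply: ae_foralln => n; exact: exp_rv_gt0.
have A3 : {ae P, forall w, forall k j, (0 < gf (k, j) w)%R}.
  by apply: ae_foralln => k; apply: ae_foralln => j; exact: exp_rv_gt0.
have A4 := q0_gt0 hlm HXm.
apply: filterS2 (filterI A1 A2) (filterI A3 A4) => w [a1 a2] [a3 a4].
by split=> // -[k j]; exact: a3.
Qed.

Variable T : R.
Hypothesis T0 : (0 < T)%R.

(** [w1] carries the macro positions and [w2] every other source of randomness except [h]; on the
    diagonal this is the actual scaled interference. *)
Let Z (w1 w2 : Ω) : \bar R := scaled_interference mu Pm Pf W alpha sigma2 T
  (fun n p => Xm n p.1) (fun n p => busy n p.2) (fun n p => Y n p.2)
  (fun k j p => M k j p.2) (fun k j p => U k j p.2)
  (fun n p => gm n p.2) (fun kj p => gf kj p.2) (w1, w2).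

Let Z0 w1 w2 : 0 <= Z w1 w2.
Proof. exact: scaled_interference_ge0. Qed.

Let mZ S : S i0 -> S i1 -> S i2 -> S i3 -> S i5 -> S i6 ->
  measurable_fun setT ((fun w => Z w w) : sub S -> \bar R).
Proof.
move=> S0 S1 S2 S3 S5 S6.
exact: (@measurable_scaled_interference R mu Pm Pf W alpha sigma2 T hmu hPm hPf hW T0 _ (sub S)
  Xm busy Y M U gm gf (fun n => jX n S0) (fun n => jb n S1) (fun n => jY n S2)
  (fun k j => jM k j S3) (fun k j => jU k j S3) (fun n => jgm n S5) (fun kj => jgf kj S6)).
Qed.

Let mZP : measurable_fun setT (fun w => Z w w).
Proof.
by apply: (pi_sub_measurable (pi_join_events piF setT)); exact: mZ.
Qed.

Lemma sinr_gt_laplace : P [set w | T%:E < sinr w] = \int[P]_w expeR (- Z w w).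
Proof.
have mA : measurable [set w | T%:E < sinr w].
  by rewrite -[X in measurable X]setTI; apply: emeasurable_fun_o_infty => //; exact: measurable_sinr.
have mmuh : measurable_fun setT (fun w => (mu * h w)%:E).
  by apply/measurable_EFinP; exact: measurable_funM.
transitivity (\int[P]_w (if Z w w < (mu * h w)%:E then 1 else 0 : \bar R)).
  transitivity (\int[P]_w (if T%:E < sinr w then 1 else 0 : \bar R)).
    transitivity (\int[P]_(w in [set w | T%:E < sinr w]) (cst 1) w).
      by rewrite integral_cst// mul1e.
    rewrite integral_mkcond; apply: eq_integral => w _; rewrite patchE.
    by have -> : (w \in [set w | T%:E < sinr w]) = (T%:E < sinr w) by apply/idP/idP; rewrite inE.
  apply: ge0_ae_eq_integral => //.
  - apply: measurable_fun_ifT => //; apply: measurable_fun_lte => //.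
    exact: measurable_sinr.
  - by apply: measurable_fun_ifT => //; apply: measurable_fun_lte.
  - by move=> w _; case: ifP.
  - by move=> w _; case: ifP.
  apply: filterS model_ae => w [a1 a2 a3 a4] _ /=.
  have := @SINR_gt R mu Pm Pf W alpha sigma2 T hmu hPm hPf hW hsigma T0 _ Xm busy Y M U gm gf h w a1 a2 a3 a4.
  rewrite -[scaled_interference _ _ _ _ _ _ _ _ _ _ _ _ _ _ _]/(Z w w) => ->.
  by [].
pose S1 : set 'I_7 := [set i | i != i4].
rewrite (@join_decoupling _ _ _ P _ F piF Hind S1 [set i4]
  (fun w1 w2 => if Z w1 w1 < (mu * h w2)%:E then 1 else 0)).
- apply: eq_integral => w _; rewrite -(P_exp_gt hmu Hh (Z0 w w)).
  have mB : measurable [set w2 | Z w w < (mu * h w2)%:E].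
    rewrite -[X in measurable X]setTI.
    exact: emeasurable_fun_o_infty.
  transitivity (\int[P]_(w2 in [set w2 | Z w w < (mu * h w2)%:E]) (cst 1) w2).
    rewrite [RHS]integral_mkcond; apply: eq_integral => w2 _; rewrite patchE.
    by have -> : (w2 \in [set w2 | Z w w < (mu * h w2)%:E]) = (Z w w < (mu * h w2)%:E)
      by apply/idP/idP; rewrite inE.
  by rewrite integral_cst// mul1e.
- by rewrite -subset0 => i [/= /eqP].
- apply: measurable_fun_ifT => //; apply: measurable_fun_lte.
    have mz : measurable_fun setT ((fun w => Z w w) : sub S1 -> \bar R) by exact: mZ.
    exact: (measurableT_comp mz measurable_fst).
  apply/measurable_EFinP; apply: measurable_funM => //.
  have mhS : measurable_fun setT (h : sub [set i4] -> R) by exact: jh.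
  exact: (measurableT_comp mhS measurable_snd).
- by move=> w1 w2; case: ifP.
Qed.

Definition conditional_coverage (w : Ω) : \bar R := \int[P]_w2 expeR (- Z w w2).

Let S0 : set 'I_7 := [set i0].
Let S0C : set 'I_7 := [set i | i != i0].

Let mZ2 : measurable_fun setT (fun p : sub S0 * sub S0C => expeR (- Z p.1 p.2)).
Proof.
apply: measurable_expeRN.
pose TT := (sub S0 * sub S0C)%type.
have m0 n : measurable_fun setT (fun p : TT => Xm n p.1).
  by exact: (measurableT_comp (jX n (erefl : S0 i0)) measurable_fst).
have m1 n : measurable_fun setT (fun p : TT => busy n p.2).
  by exact: (measurableT_comp (jb n (isT : S0C i1)) measurable_snd).
have m2 n : measurable_fun setT (fun p : TT => Y n p.2).
  by exact: (measurableT_comp (jY n (isT : S0C i2)) measurable_snd).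
have m3 k j : measurable_fun setT (fun p : TT => M k j p.2).
  by exact: (measurableT_comp (jM k j (isT : S0C i3)) measurable_snd).
have m4 k j : measurable_fun setT (fun p : TT => U k j p.2).
  by exact: (measurableT_comp (jU k j (isT : S0C i3)) measurable_snd).
have m5 n : measurable_fun setT (fun p : TT => gm n p.2).
  by exact: (measurableT_comp (jgm n (isT : S0C i5)) measurable_snd).
have m6 kj : measurable_fun setT (fun p : TT => gf kj p.2).
  by exact: (measurableT_comp (jgf kj (isT : S0C i6)) measurable_snd).
have := @measurable_scaled_interference R mu Pm Pf W alpha sigma2 T hmu hPm hPf hW T0 _ TT
  _ _ _ _ _ _ _ m0 m1 m2 m3 m4 m5 m6.
exact.
Qed.

Lemma integral_conditional_coverage : \int[P]_w expeR (- Z w w) = \int[P]_w conditional_coverage w.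
Proof.
apply: (@join_decoupling _ _ _ P _ F piF Hind S0 S0C (fun w1 w2 => expeR (- Z w1 w2))).
- by rewrite -subset0 => i [/= -> /eqP].
- exact: mZ2.
- by move=> *; exact: expeR_ge0.
Qed.

Lemma measurable_conditional_coverage : measurable_fun setT conditional_coverage.
Proof.
apply: (pi_sub_measurable (pi_join_events piF S0)).
apply: (@decoupling_measurable _ _ _ P _ (join_events F S0C)).
- exact: pi_join_events.
- exact: pi_join_events.
- exact: mZ2.
- by move=> *; exact: expeR_ge0.
Qed.

Lemma conditional_coverage_ge0 w : 0 <= conditional_coverage w.
Proof. by apply: integral_ge0 => w2 _; exact: expeR_ge0. Qed.

(** Noise and femtocells together: the part of the exponent that sees the macro stations only
    through the squared distance [v] of the serving one. *)
Let femto_exponent (v : R) : \bar R :=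
  (mu * T * powR v (alpha / 2) * sigma2 / Pm)%:E +
  lp%:E * \int[@leb2 R]_x (1 - Defs.eta lc Rc alpha (T * powR v (alpha / 2) * W * Pf / Pm) x).

Let Em (w1 w2 : Ω) := \sum_(1 <= n <oo) (if busy n w2 then
  (mu * (T * powR (eucl (Xm 0%N w1)) alpha / Pm * Pm * powR (eucl (Xm n w1)) (- alpha)) *
   Num.max 0 (gm n w2))%:E else 0).
Let Ef (w1 w2 : Ω) := \sum_(0 <= k <oo) \sum_(0 <= j <oo) (if M k j w2 then
  (mu * (T * powR (eucl (Xm 0%N w1)) alpha / Pm * W * Pf *
     powR (eucl (addp (Y k w2) (U k j w2))) (- alpha)) *
   Num.max 0 (gf (k, j) w2))%:E else 0).

(** With the macro positions frozen, the noise is a constant, the macro sum uses only the thinning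
    marks and [gm], and the femto sum only parents, clusters and [gf]; these index sets are
    disjoint. *)
Lemma conditional_coverage_split w : conditional_coverage w =
  (expR (- (mu * (T * powR (eucl (Xm 0%N w)) alpha / Pm) * sigma2)))%:E *
  (\int[P]_w2 expeR (- Em w w2) * \int[P]_w2 expeR (- Ef w w2)).
Proof.
have s0 : (0 <= T * powR (eucl (Xm 0%N w)) alpha / Pm)%R.
  by rewrite divr_ge0 ?mulr_ge0 ?powR_ge0// ltW.
have Em0 w2 : 0 <= Em w w2.
  exact: (@scaled_macro_ge0 R mu Pm alpha T hmu hPm T0 _ (fun n _ => Xm n w) busy gm (Xm 0%N w) w2).
have Ef0 w2 : 0 <= Ef w w2.
  exact: (@scaled_femto_ge0 R mu Pm Pf W alpha T hmu hPm hPf hW T0).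
have sig0 : 0 <= (mu * (T * powR (eucl (Xm 0%N w)) alpha / Pm) * sigma2)%:E.
  by rewrite lee_fin; apply: mulr_ge0 => //; apply: mulr_ge0 => //; exact: ltW.
pose SA : set 'I_7 := [set i | i = i1 \/ i = i5].
pose SB : set 'I_7 := [set i | i = i2 \/ i = i3 \/ i = i6].
have mEm : measurable_fun setT (Em w : sub SA -> \bar R).
  apply: measurable_nneseries => [n w2|n].
    case: (busy n w2) => //; rewrite lee_fin; apply: mulr_ge0; last by rewrite le_max lexx.
    apply: mulr_ge0; first exact: ltW.
    by apply: mulr_ge0; [apply: mulr_ge0 => //; exact: ltW|exact: powR_ge0].
  apply: measurable_fun_ifT => //; first by apply: jb; left.
  apply/measurable_EFinP; apply: measurable_funM => //; apply: measurable_maxr => //.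
  by apply: jgm; right.
have mEf : measurable_fun setT (Ef w : sub SB -> \bar R).
  have c0 : (0 <= T * powR (eucl (Xm 0%N w)) alpha / Pm * W * Pf)%R.
    by apply: mulr_ge0; [apply: mulr_ge0 => //; exact: ltW|exact: ltW].
  apply: (@measurable_shot_noise R alpha mu hmu _ (sub SB) Y M U gf _ c0).
  - by move=> k; apply: jY; left.
  - by move=> k j; apply: jM; right; left.
  - by move=> k j; apply: jU; right; left.
  - by move=> kj; apply: jgf; right; right.
have mEmP : measurable_fun setT (Em w).
  exact: (pi_sub_measurable (pi_join_events piF SA)).
have mEfP : measurable_fun setT (Ef w).
  exact: (pi_sub_measurable (pi_join_events piF SB)).
rewrite /conditional_coverage.
transitivity (\int[P]_w2 ((expR (- (mu * (T * powR (eucl (Xm 0%N w)) alpha / Pm) * sigma2)))%:E *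
  (expeR (- Em w w2) * expeR (- Ef w w2)))).
  apply: eq_integral => w2 _; rewrite -expeRND//.
  rewrite -[(expR _)%:E]/(expeR (- (mu * (T * powR (eucl (Xm 0%N w)) alpha / Pm) * sigma2)%:E)).
  by rewrite -expeRND// adde_ge0.
rewrite ge0_integralZl ?lee_fin ?expR_ge0//; last 2 first.
- by apply: emeasurable_funM; exact: measurable_expeRN.
- by move=> w2 _; rewrite mule_ge0 ?expeR_ge0.
congr (_ * _).
rewrite (@join_decoupling _ _ _ P _ F piF Hind SA SB
  (fun w1 w2 => expeR (- Em w w1) * expeR (- Ef w w2))).
- under eq_integral => w1 _.
    rewrite ge0_integralZl//; [|exact: measurable_expeRN|by move=> *; exact: expeR_ge0|exact: expeR_ge0].
    over.
  rewrite ge0_integralZr//; [exact: measurable_expeRN|by move=> *; exact: expeR_ge0|].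
  by apply: integral_ge0 => *; exact: expeR_ge0.
- by rewrite -subset0 => i [/= [->|->]] [|[|]].
- apply: emeasurable_funM; apply: measurable_expeRN.
    exact: (measurableT_comp mEm measurable_fst).
  exact: (measurableT_comp mEf measurable_snd).
- by move=> *; rewrite mule_ge0 ?expeR_ge0.
Qed.

Let femto_exponent_ge0 v : (0 < v)%R -> 0 <= femto_exponent v.
Proof.
move=> v0; apply: adde_ge0.
  rewrite lee_fin; apply: mulr_ge0; last by rewrite invr_ge0 ltW.
  by apply: mulr_ge0 => //; apply: mulr_ge0; [apply: mulr_ge0; exact: ltW|exact: powR_ge0].
rewrite mule_ge0 ?lee_fin ?(ltW hlp)// integral_ge0// => x _; apply: one_sub_eta_ge0 => //.
by rewrite divr_gt0// !mulr_gt0// powR_gt0.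
Qed.

Let femto_exponent_mono v v' : (0 < v)%R -> (v <= v')%R -> femto_exponent v <= femto_exponent v'.
Proof.
move=> v0 vv'; have v'0 := lt_le_trans v0 vv'.
have pw : (powR v (alpha / 2) <= powR v' (alpha / 2))%R.
  by apply: ge0_ler_powR; rewrite ?nnegrE ?divr_ge0 ?(ltW halpha) ?(ltW v0) ?(ltW v'0).
have Pmi : (0 <= Pm^-1)%R by rewrite invr_ge0 ltW.
apply: leeD.
  rewrite lee_fin ler_wpM2r// ler_wpM2r// ler_wpM2l// mulr_ge0 ?ltW//.
apply: lee_wpmul2l; first by rewrite lee_fin ltW.
apply: femto_integral_mono => //; first by rewrite divr_gt0// !mulr_gt0// powR_gt0.
by rewrite ler_wpM2r// ler_wpM2r ?(ltW hPf)// ler_wpM2r ?(ltW hW)// ler_wpM2l// ltW.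
Qed.

Let macro := macro_exponent T alpha Pbusy.

Lemma conditional_coverageE w : (0 < sqn (Xm 0%N w))%R ->
  (forall n, sqn (Xm 0%N w) <= sqn (Xm n w))%R ->
  conditional_coverage w = expeR (- (femto_exponent (sqn (Xm 0%N w)) +
    \sum_(1 <= n <oo) macro (sqn (Xm 0%N w)) (Xm n w))).
Proof.
move=> v0 minw; rewrite conditional_coverage_split.
set v := sqn (Xm 0%N w).
have e0 : (0 < powR (eucl (Xm 0%N w)) alpha)%R by rewrite powR_gt0// sqrtr_gt0.
have sp : (0 < T * powR (eucl (Xm 0%N w)) alpha / Pm)%R by rewrite divr_gt0// mulr_gt0.
have cm0 n : (0 <= T * powR (eucl (Xm 0%N w)) alpha / Pm * Pm * powR (eucl (Xm n w)) (- alpha))%R.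
  by apply: mulr_ge0; [apply: mulr_ge0; exact: ltW|exact: powR_ge0].
have -> : \int[P]_w2 expeR (- Em w w2) = expeR (- \sum_(1 <= n <oo) macro v (Xm n w)).
  rewrite (laplace_macro piF Hind F1 F5 _ hmu hPbusy Hbusy Hgm Hind_busy Hind_gm cm0)//.
  congr (expeR (- _)); apply: eq_eseriesr => n _.
  by rewrite divfK ?gt_eqF// (@macro_exponentE R T alpha T0 v)//; exact: lt_le_trans (minw n).
have cf0 : (0 < T * powR (eucl (Xm 0%N w)) alpha / Pm * W * Pf)%R.
  by apply: mulr_gt0 => //; apply: mulr_gt0.
have -> : \int[P]_w2 expeR (- Ef w w2) = expeR (- (lp%:E * \int[@leb2 R]_x
    (1 - Defs.eta lc Rc alpha (T * powR v (alpha / 2) * W * Pf / Pm) x))).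
  transitivity (expeR (- (lp%:E * \int[@leb2 R]_x (1 - Defs.eta lc Rc alpha
      (T * powR (eucl (Xm 0%N w)) alpha / Pm * W * Pf) x)))).
    exact: (@laplace_femto R d Ω P _ F piF Hind Y M U gf i2 i3 i6 F2 F3 F6 isT isT isT
      alpha mu lp lc Rc hmu hlp hlc hRc HY HU Hgf Hind_clusters Hind_gf _ cf0).
  suff -> : (T * powR (eucl (Xm 0%N w)) alpha / Pm * W * Pf =
      T * powR v (alpha / 2) * W * Pf / Pm)%R by [].
  by rewrite powR_eucl -/v; field; rewrite gt_eqF.
have I0 : 0 <= lp%:E * \int[@leb2 R]_x
    (1 - Defs.eta lc Rc alpha (T * powR v (alpha / 2) * W * Pf / Pm) x).
  rewrite mule_ge0 ?lee_fin ?(ltW hlp)// integral_ge0// => x _; apply: one_sub_eta_ge0 => //.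
  by rewrite divr_gt0// !mulr_gt0// powR_gt0.
have M0 : 0 <= \sum_(1 <= n <oo) macro v (Xm n w).
  by apply: nneseries_ge0 => n _ _; exact: macro_exponent_ge0.
have N0 : 0 <= (mu * T * powR v (alpha / 2) * sigma2 / Pm)%:E.
  rewrite lee_fin; apply: mulr_ge0; last by rewrite invr_ge0 ltW.
  by apply: mulr_ge0 => //; apply: mulr_ge0; [apply: mulr_ge0; exact: ltW|exact: powR_ge0].
rewrite /femto_exponent expeRND ?adde_ge0// expeRND// [in RHS]muleAC -muleA; congr (_ * (_ * _)).
by rewrite /= powR_eucl -/v; congr (expR (- _))%:E; field; rewrite gt_eqF.
Qed.

Lemma nearest_density_model v : (0 < v)%R ->
  nearest_density lm macro femto_exponent v =
  expeR (expo lm (lm * Pbusy) lp lc Rc Pm Pf W mu sigma2 alpha T v).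
Proof.
move=> v0; rewrite /nearest_density /expo /femto_exponent; congr expeR.
rewrite outer_int_macro//.
set A := (lm * pi * v)%:E; set B := (mu * T * _ * _ / _)%:E; set C := lp%:E * _.
have C0 : 0 <= C.
  rewrite mule_ge0 ?lee_fin ?(ltW hlp)// integral_ge0// => x _; apply: one_sub_eta_ge0 => //.
  by rewrite divr_gt0// !mulr_gt0// powR_gt0.
have p0 := phi_ge0 T alpha.
have -> : lm%:E * (Pbusy%:E * ((pi * v)%:E * phi T alpha)) = (pi * v * (lm * Pbusy))%:E * phi T alpha.
  by rewrite !muleA -!EFinM; congr (_ %:E * _); ring.
have -> : (pi * v * lm)%:E = A by congr (_ %:E); ring.
have D0 : 0 <= (pi * v * (lm * Pbusy))%:E * phi T alpha.
  rewrite mule_ge0// lee_fin; have /andP[pb _] := hPbusy.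
  by apply: mulr_ge0; [apply: mulr_ge0; [exact: pi_ge0|exact: ltW]|apply: mulr_ge0; exact: ltW].
have A0 : 0 <= A by rewrite lee_fin !mulr_ge0 ?pi_ge0 ?(ltW hlm) ?(ltW v0).
have B0 : 0 <= B.
  rewrite lee_fin; apply: mulr_ge0; last by rewrite invr_ge0 ltW.
  by apply: mulr_ge0 => //; apply: mulr_ge0; [apply: mulr_ge0; exact: ltW|exact: powR_ge0].
rewrite oppe_addN ?adde_ge0//; congr (_ - _).
by rewrite oppe_addN ?adde_ge0// oppe_addN// addeA -addeA [- B - C]addeC addeA.
Qed.

Lemma coverage_probability : P [set w | T%:E < sinr w] = (pi * lm)%:E *
  \int[@lebesgue_measure R]_(v in `[0%R, +oo[%classic)
     expeR (expo lm (lm * Pbusy) lp lc Rc Pm Pf W mu sigma2 alpha T v).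
Proof.
rewrite sinr_gt_laplace integral_conditional_coverage.
(* [nearest_integral] requires nonnegativity at every real [v], whereas [femto_exponent] is
   controlled only for positive [v]. The final identity compares integrals over the open half-line,
   where the two agree. *)
pose G v := if (0 < v)%R then femto_exponent v else 0.
have GE v : (0 < v)%R -> G v = femto_exponent v by move=> v0; rewrite /G v0.
have HE v : (0 < v)%R -> nearest_density lm macro G v =
    expeR (expo lm (lm * Pbusy) lp lc Rc Pm Pf W mu sigma2 alpha T v).
  by move=> v0; rewrite -nearest_density_model// /nearest_density GE.
have G0 v : 0 <= G v by rewrite /G; case: ifPn => // v0; exact: femto_exponent_ge0.
have Gmono v v' : (0 < v)%R -> (v <= v')%R -> G v <= G v'.
  move=> v0 vv'; rewrite (GE _ v0) (GE _ (lt_le_trans v0 vv')); exact: femto_exponent_mono.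
have mL v := measurable_macro_exponent T alpha Pbusy v.
have L0 v x := macro_exponent_ge0 alpha T0 hPbusy v x.
have Lmono v v' x := @macro_exponent_mono R T alpha Pbusy T0 halpha hPbusy v v' x.
have Lbound a b := @macro_exponent_bound R T alpha Pbusy T0 halpha hPbusy a b.
have Hmono v v' : (0 < v)%R -> (v <= v')%R ->
    nearest_density lm macro G v' <= nearest_density lm macro G v.
  move=> v0 vv'; have v'0 := lt_le_trans v0 vv'.
  have p0 := phi_ge0 T alpha; have /andP[pb _] := hPbusy.
  rewrite lee_expeR leeN2 !outer_int_macro//; apply: leeD; first apply: leeD.
  - by rewrite lee_fin ler_wpM2l// mulr_ge0 ?pi_ge0// ltW.
  - exact: Gmono.
  apply: lee_wpmul2l; first by rewrite lee_fin ltW.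
  apply: lee_wpmul2l; first by rewrite lee_fin ltW.
  by apply: lee_wpmul2r => //; rewrite lee_fin ler_wpM2l// pi_ge0.
have Psi1 w : conditional_coverage w <= 1.
  apply: (@le_trans _ _ (\int[P]_w2 (cst 1) w2)); last first.
    by rewrite integral_cst// mul1e; exact: probability_le1.
  apply: ge0_le_integral => //; first by move=> *; exact: expeR_ge0.
    have mw : measurable_fun setT (fun w2 : sub S0C => ((w : sub S0), w2)).
      exact: measurable_fun_pair.
    apply: (@pi_sub_measurable _ _ _ _ _ _ (pi_join_events piF S0C)).
    exact: (measurableT_comp mZ2 mw).
  by move=> w2 _; exact: expeRN_le1.
have PsiE : {ae P, forall w, (0 < sqn (Xm 0%N w))%R -> conditional_coverage w =
    expeR (- (G (sqn (Xm 0%N w)) + \sum_(1 <= n <oo) macro (sqn (Xm 0%N w)) (Xm n w)))}.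
  by apply: filterS nearest_sqn => w minw v0; rewrite GE// conditional_coverageE.
rewrite (nearest_integral hlm HXm nearest_sqn mL L0 Lmono Lbound G0 Gmono
  measurable_conditional_coverage conditional_coverage_ge0 Psi1 PsiE Hmono).
congr (_ * _).
have mH := @measurable_nearest_density R lm hlm macro G L0 G0 Hmono.
rewrite -!integral_itv_obnd_cbnd//; last first.
  apply: (eq_measurable_fun (nearest_density lm macro G)) => // v.
  by rewrite inE/= in_itv/= andbT => v0; rewrite HE.
by apply: eq_integral => v; rewrite inE/= in_itv/= andbT => v0; rewrite HE.
Qed.

End Model.

(** * Mean rate *)

Section MeanRate.
Local Open Scope ereal_scope.
Context {R : realType} {d : measure_display} {Ω : measurableType d}.
Variable P : probability Ω R.
Local Notation leb := (@lebesgue_measure R).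

(** The maximum with 0 makes the equivalence hold for every [x]: negative logarithms, the default
    value 0 of [ln] on nonpositive reals, and [-oo] all give false on both sides. *)
Lemma ln1pE_gt (x : \bar R) (t : R) : (0 <= t)%R ->
  (t%:E < maxe 0 (ln1pE x)) = ((expR t - 1)%:E < x).
Proof.
move=> t0; have tN0 : (t < 0)%R = false by apply/negbTE; rewrite -leNgt.
rewrite lt_max lte_fin tN0; case: x => [r| |] /=; rewrite ?ltry//.
rewrite !lte_fin; have [r0|r0] := ltP 0%R (1 + r)%R.
  by rewrite -ltr_expR lnK// ltrBlDl.
by rewrite ln0// tN0 ltrBlDl; apply/esym/negbTE; rewrite -leNgt (le_trans r0)// expR_ge0.
Qed.

Lemma ln1pE_ge0 (x : \bar R) : 0 <= x -> 0 <= ln1pE x.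
Proof. by case: x => [r| |]//=; rewrite !lee_fin => r0; rewrite ln_ge0// lerDl. Qed.

Lemma mean_rate (S : Ω -> \bar R) : measurable_fun setT S -> {ae P, forall w, 0 <= S w} ->
  \int[P]_w ln1pE (S w) =
  \int[leb]_(t in `[0%R, +oo[) P [set w | (expR t - 1)%:E < S w].
Proof.
move=> mS S0; have ml := measurable_ln1pE mS.
have mV : measurable_fun setT (fun w => maxe 0 (ln1pE (S w))) by exact: measurable_maxe.
rewrite (ae_eq_integral (fun w => maxe 0 (ln1pE (S w))))//; last first.
  apply: filterS S0 => w Sw _; apply/esym/max_idPr; exact: ln1pE_ge0.
rewrite layer_cake//; last by move=> w; rewrite le_max lexx.
apply: eq_integral => t; rewrite inE/= in_itv/= andbT => t0; congr (P _).
by apply/seteqP; split=> w /=; rewrite ln1pE_gt.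
Qed.

(** Nothing is assumed on the measurability of [g]: the tail probability is nonincreasing in [t],
    hence measurable, and [g (expR t - 1)] is a multiple of it for [t > 0]. At [t = 0] the
    hypothesis on [g] is silent, so the open half-line is used. *)
Lemma mean_rate_scaled (c : R) (g : R -> \bar R) (S : Ω -> \bar R) : (0 < c)%R ->
    measurable_fun setT S -> {ae P, forall w, 0 <= S w} -> (forall t, 0 <= g t) ->
    (forall T, (0 < T)%R -> P [set w | T%:E < S w] = c%:E * g T) ->
  \int[P]_w ln1pE (S w) = c%:E * \int[leb]_(t in `[0%R, +oo[) g (expR t - 1)%R.
Proof.
move=> c0 mS S0 g0 Sg; rewrite mean_rate//.
have mA (T : R) : measurable [set w | T%:E < S w].
  by rewrite -[X in measurable X]setTI; exact: emeasurable_fun_o_infty.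
pose p (t : R) := P [set w | (expR t - 1)%:E < S w].
have pE t : (fine (p t))%:E = p t by rewrite fineK// fin_num_measure.
have mp : measurable_fun (`]0%R, +oo[%classic : set R) p.
  apply: (eq_measurable_fun (fun t => (fine (p t))%:E)) => [t _|]; first exact: pE.
  apply/measurable_EFinP; apply: nonincreasing_measurable => // s t st.
  rewrite -lee_fin !pE; apply: le_measure; rewrite ?inE//.
  by move=> w /=; apply: le_lt_trans; rewrite lee_fin lerD2r ler_expR.
have pg (t : R) : t \in `]0%R, +oo[%classic -> p t = c%:E * g (expR t - 1)%R.
  by rewrite inE/= in_itv/= andbT => t0; rewrite /p Sg// subr_gt0 expR_gt1.
have mg : measurable_fun (`]0%R, +oo[%classic : set R) (fun t => g (expR t - 1)%R).
  apply: (eq_measurable_fun (fun t => (c^-1)%:E * p t)) => [t t0|].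
    by rewrite pg// muleA -EFinM mulVf ?gt_eqF// mul1e.
  by apply: emeasurable_funM => //; exact: measurable_cst.
rewrite -!integral_itv_obnd_cbnd//; rewrite -ge0_integralZl//; last by rewrite lee_fin ltW.
exact: eq_integral.
Qed.

End MeanRate.

Lemma SINR_ge0 (R : realType) (S : Type) (Pm Pf W alpha sigma2 : R) (X : nat -> S -> pt R)
    (busy : nat -> S -> bool) (Y : nat -> S -> pt R) (M : nat -> nat -> S -> bool)
    (U : nat -> nat -> S -> pt R) (h : S -> R) (gm : nat -> S -> R) (gf : nat * nat -> S -> R)
    (w : S) : 0 <= Pm -> 0 <= Pf -> 0 <= W -> 0 <= sigma2 -> 0 <= h w ->
    (forall n, 0 <= gm n w) -> (forall kj, 0 <= gf kj w) ->
  (0 <= SINR Pm Pf W alpha sigma2 X busy Y M U h gm gf w)%E.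
Proof.
move=> Pm0 Pf0 W0 s0 h0 gm0 gf0; rewrite /SINR.
have Im0 : (0 <= interf_m Pm alpha X busy gm w)%E.
  apply: nneseries_ge0 => n _ _; case: ifP => // _.
  by rewrite lee_fin !mulr_ge0 ?powR_ge0.
have If0 : (0 <= interf_f W Pf alpha Y M U gf w)%E.
  apply: nneseries_ge0 => k _ _; apply: nneseries_ge0 => j _ _; case: ifP => // _.
  by rewrite lee_fin !mulr_ge0 ?powR_ge0.
have : (0 <= interf_m Pm alpha X busy gm w + interf_f W Pf alpha Y M U gf w + sigma2%:E)%E.
  by rewrite !adde_ge0// lee_fin.
case: (_ + _)%E => [r| |]//=; rewrite lee_fin => r0; case: ifP => // _.
by rewrite lee_fin divr_ge0// !mulr_ge0// powR_ge0.
Qed.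

Unset Implicit Arguments.

Theorem theorem3 (R : realType) (d : measure_display) (Ω : measurableType d)
  (P : probability Ω R)
  (alpha mu Pm Pf W sigma2 lm Pbusy lp lc Rc : R)
  (halpha : 2 < alpha) (hmu : 0 < mu) (hPm : 0 < Pm) (hPf : 0 < Pf)
  (hW : 0 < W <= 1) (hsigma : 0 <= sigma2) (hlm : 0 < lm)
  (hPbusy : 0 < Pbusy <= 1) (hlp : 0 < lp) (hlc : 0 <= lc) (hRc : 0 < Rc)
  (* macro BSs Phi_m, enumerated by increasing distance to o: b0 = Xm 0 *)
  (Xm : nat -> Ω -> pt R)
  (* independent thinning marks: Phi_m' = {Xm n | busy n} *)
  (busy : nat -> Ω -> bool)
  (* parent process Phi_p *)
  (Y : nat -> Ω -> pt R)
  (* cluster k: daughters Y k + U k j for the j with M k j *)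
  (M : nat -> nat -> Ω -> bool) (U : nat -> nat -> Ω -> pt R)
  (* fading *)
  (h : Ω -> R) (gm : nat -> Ω -> R) (gf : nat * nat -> Ω -> R)
  (HXm : is_hPPP P Xm lm)
  (Hsorted : {ae P, forall w, forall n, eucl (Xm n w) <= eucl (Xm n.+1 w)})
  (Hbusy : forall n, measurable_fun setT (busy n) /\ P [set w | busy n w] = Pbusy%:E)
  (HY : is_hPPP P Y lp)
  (HU : forall k, is_PPP P (M k) (U k) (fun B => (lc%:E * @leb2 R (B `&` disk Rc))%E))
  (Hh : exp_rv P mu h) (Hgm : forall n, exp_rv P mu (gm n))
  (Hgf : forall kj, exp_rv P mu (gf kj))
  (Hind_busy : indep_rvs P busy)
  (Hind_clusters : mutually_independent P
      (fun k => gen_events (fun j w => (M k j w, U k j w))))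
  (Hind_gm : indep_rvs P gm) (Hind_gf : indep_rvs P gf)
  (Hind : mutually_independent P (fun i : 'I_7 => tnth
      [tuple gen_events Xm; gen_events busy; gen_events Y;
             gen_events (fun kj w => (M kj.1 kj.2 w, U kj.1 kj.2 w));
             events_of h; gen_events gm; gen_events gf] i)) :
  let sinr := SINR Pm Pf W alpha sigma2 Xm busy Y M U h gm gf in
  let E := expo lm (lm * Pbusy) lp lc Rc Pm Pf W mu sigma2 alpha in
  (forall T, 0 < T ->
     P [set w | (sinr w <= T%:E)%E] =
     (1 - (pi * lm)%:E *
        \int[@lebesgue_measure R]_(v in `[0%R, +oo[%classic) expeR (E T v))%E)
  /\
  (\int[P]_w ln1pE (sinr w) =
     (pi * lm)%:E *
     \int[@lebesgue_measure R]_(t in `[0%R, +oo[%classic)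
        \int[@lebesgue_measure R]_(v in `[0%R, +oo[%classic)
           expeR (E (expR t - 1)%R v))%E.
Proof.
have halpha0 : 0 < alpha by exact: lt_trans halpha.
have /andP[hW0 _] := hW.
move=> sinr E.
have msinr : measurable_fun setT sinr.
  exact: (@measurable_sinr R d Ω P alpha mu Pm Pf W sigma2 lm Pbusy lp lc Rc
    Xm busy Y M U h gm gf HXm Hbusy HY HU Hh Hgm Hgf).
have cov T : 0 < T -> P [set w | (T%:E < sinr w)%E] = ((pi * lm)%:E *
    \int[@lebesgue_measure R]_(v in `[0%R, +oo[%classic) expeR (E T v))%E.
  move=> T0; exact: (@coverage_probability R d Ω P alpha mu Pm Pf W sigma2 lm Pbusy lp lc Rc
    halpha0 hmu hPm hPf hW0 hsigma hlm hPbusy hlp hlc hRc Xm busy Y M U h gm gf HXm Hsorted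
    Hbusy HY HU Hh Hgm Hgf Hind_busy Hind_clusters Hind_gm Hind_gf Hind T T0).
split=> [T T0|].
- rewrite -cov// -probability_setC; last first.
    by rewrite -[X in measurable X]setTI; exact: emeasurable_fun_o_infty.
  by congr (P _); apply/seteqP; split=> w /=; rewrite leNgt => /negP.
- apply: (mean_rate_scaled (g := fun T => \int[@lebesgue_measure R]_(v in `[0%R, +oo[%classic)
    expeR (E T v))%E) => //.
  + by rewrite mulr_gt0// pi_gt0.
  + have := @model_ae R d Ω P mu lm hlm Xm h gm gf HXm Hh Hgm Hgf.
    apply: filterS => w [h0 gm0 gf0 _].
    by apply: SINR_ge0 => //; try exact: ltW; move=> *; exact: ltW.
  + by move=> t; apply: integral_ge0 => v _; exact: expeR_ge0.
Qed.
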